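(* Let $A \subseteq B$ be an extension of Noetherian commutative rings such that $B$ is a finite locally free $A$-algebra. Then there exist an affine $A$-scheme $\mathcal{M}_{B/A}$ and, for each integer $k \geq 1$, a quasiaffine $A$-scheme $\mathcal{M}_{k,B/A}$ of finite type, together with natural bijections $$\mathrm{Hom}_{\mathrm{Sch}/A}(\mathrm{Spec}\, A, \mathcal{M}_{B/A}) \simeq \{\theta \in B \mid \theta \text{ is a monogenerator for } B \text{ over } A\}$$ and $$\mathrm{Hom}_{\mathrm{Sch}/A}(\mathrm{Spec}\, A, \mathcal{M}_{k,B/A}) \simeq \{\vec{\theta} \in B^k \mid \vec{\theta} \text{ is a generating } k\text{-tuple for } B \text{ over } A\}.$$ Here ''natural'' means that the schemes represent the corresponding moduli problems: for every $A$-algebra $A'$ there are bijections, functorial in $A'$, between $\mathrm{Hom}_{\mathrm{Sch}/A}(\mathrm{Spec}\, A', \mathcal{M}_{B/A})$ and the set of monogenerators of $B \otimes_A A'$ over $A'$, and between $\mathrm{Hom}_{\mathrm{Sch}/A}(\mathrm{Spec}\, A', \mathcal{M}_{k,B/A})$ and the set of generating $k$-tuples of $B \otimes_A A'$ over $A'$; the displayed bijections are the case $A' = A$.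
   Context: All rings are commutative with unit. For a finite locally free $A$-algebra $B$, an element $\theta \in B$ is a monogenerator (monogenic generator) of $B$ over $A$ if $B = A[\theta]$, i.e. if the $A$-algebra homomorphism $A[t] \to B$, $t \mapsto \theta$, is surjective. A tuple $\vec\theta = (\theta_1,\dots,\theta_k) \in B^k$ is a generating $k$-tuple of $B$ over $A$ if $B = A[\theta_1,\dots,\theta_k]$, i.e. if the $A$-algebra homomorphism $A[t_1,\dots,t_k] \to B$, $t_i \mapsto \theta_i$, is surjective. *)

(* Defs.v *)
From HB Require Import structures.
From mathcomp Require Import all_boot all_order all_algebra.
From mathcomp Require Import ring.
From mathcomp Require Import boolp classical_sets functions.
From mathcomp Require Import topology_structure subtype_topology compact.

Set Implicit Arguments.
Unset Strict Implicit.
Unset Printing Implicit Defensive.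

Import GRing.Theory.
Local Open Scope classical_set_scope.
Local Open Scope quotient_scope.
Local Open Scope ring_scope.

(* Rings are commutative with unit and may be zero, hence [comPzRingType].
   An A-algebra is a ring B with a morphism [phi : {rmorphism A -> B}]. *)

Definition invertible (R : comPzRingType) (x : R) : Prop := exists y, x * y = 1.

Definition is_ideal (R : comPzRingType) (I : set R) : Prop :=
  [/\ I 0, forall x y, I x -> I y -> I (x + y) & forall a x, I x -> I (a * x)].

Definition noetherian (R : comPzRingType) : Prop :=
  forall I : set R, is_ideal I ->
    exists (n : nat) (g : 'I_n -> R),
      I = [set x | exists c : 'I_n -> R, x = \sum_i c i * g i].

(* t |-> theta maps sum_i c_i t^i to sum_i phi(c_i) theta^i; the definition
   spells out the surjectivity of A[t] -> B. *)
Definition is_monogenerator (A B : comPzRingType) (phi : {rmorphism A -> B})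
    (theta : B) : Prop :=
  forall b : B, exists c : seq A, b = \sum_(i < size c) phi c`_i * theta ^+ i.

(* A polynomial in k variables is a sum of terms a * t^m, listed here as pairs
   (a, m) of a coefficient and an exponent vector. *)
Definition is_generating (A B : comPzRingType) (phi : {rmorphism A -> B})
    (k : nat) (theta : k.-tuple B) : Prop :=
  forall b : B, exists p : seq (A * {ffun 'I_k -> nat}),
    b = \sum_(u <- p) phi u.1 * \prod_(i < k) tnth theta i ^+ u.2 i.

Definition finite_type_morphism (A B : comPzRingType)
    (phi : {rmorphism A -> B}) : Prop :=
  exists (k : nat) (theta : k.-tuple B), is_generating phi theta.

Record mulset (R : comPzRingType) := MulSet {
  mset :> set R;
  mset1 : mset 1;
  msetM : forall x y, mset x -> mset y -> mset (x * y)
}.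

Record frac (R : comPzRingType) (S : mulset R) := Frac {
  fnum : R;
  fden : R;
  fdenP : mset S fden
}.

HB.instance Definition _ (R : comPzRingType) (S : mulset R) :=
  gen_eqMixin (frac S).
HB.instance Definition _ (R : comPzRingType) (S : mulset R) :=
  gen_choiceMixin (frac S).

Section Localization.
Variables (R : comPzRingType) (S : mulset R).
Implicit Types x y z : frac S.

Definition frac_equiv x y : bool :=
  `[< exists s, mset S s /\ s * (fnum x * fden y) = s * (fnum y * fden x) >].

Fact frac_equiv_refl : reflexive frac_equiv.
Proof. by move=> x; apply/asboolP; exists 1; split => //; exact: mset1. Qed.

Fact frac_equiv_sym : symmetric frac_equiv.
Proof. by move=> x y; apply/asboolP/asboolP => -[s [Ss e]]; exists s. Qed.

Fact frac_equiv_trans : transitive frac_equiv.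
Proof.
move=> y x z /asboolP[s [Ss e1]] /asboolP[t [St e2]]; apply/asboolP.
exists (s * t * fden y); split.
  by apply: msetM (fdenP y); exact: msetM.
transitivity (t * fden z * (s * (fnum x * fden y))); first by ring.
rewrite e1; transitivity (s * fden x * (t * (fnum y * fden z))); first by ring.
by rewrite e2; ring.
Qed.

Canonical frac_equiv_equiv :=
  EquivRel frac_equiv frac_equiv_refl frac_equiv_sym frac_equiv_trans.

Definition loc := {eq_quot frac_equiv}.
HB.instance Definition _ := Choice.on loc.
HB.instance Definition _ : EqQuotient _ frac_equiv loc := EqQuotient.on loc.

Definition mkfrac (a s : R) (Ss : mset S s) : loc := \pi_loc (Frac a Ss).

Lemma mkfrac_eq a s (Ss : mset S s) b t (St : mset S t) :
  mkfrac a Ss = mkfrac b St <-> exists r, mset S r /\ r * (a * t) = r * (b * s).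
Proof.
split=> [/eqmodP/asboolP//|h].
by apply/eqmodP/asboolP.
Qed.

Lemma mkfracP (x : loc) : exists a s (Ss : mset S s), x = mkfrac a Ss.
Proof.
by elim/quotW: x => -[a s Ss]; exists a, s, Ss.
Qed.

Definition loc_add (x y : loc) : loc :=
  mkfrac (fnum (repr x) * fden (repr y) + fnum (repr y) * fden (repr x))
    (msetM (fdenP (repr x)) (fdenP (repr y))).
Definition loc_mul (x y : loc) : loc :=
  mkfrac (fnum (repr x) * fnum (repr y))
    (msetM (fdenP (repr x)) (fdenP (repr y))).
Definition loc_opp (x : loc) : loc :=
  mkfrac (- fnum (repr x)) (fdenP (repr x)).

Lemma repr_mkfrac a s (Ss : mset S s) :
  exists r, mset S r /\
    r * (fnum (repr (mkfrac a Ss)) * s) = r * (a * fden (repr (mkfrac a Ss))).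
Proof.
have : \pi_loc (repr (mkfrac a Ss)) = mkfrac a Ss by rewrite reprK.
by move=> /eqmodP/asboolP.
Qed.

Lemma mkfracD a s (Ss : mset S s) b t (St : mset S t) :
  loc_add (mkfrac a Ss) (mkfrac b St) = mkfrac (a * t + b * s) (msetM Ss St).
Proof.
apply/mkfrac_eq.
have [r [Sr e]] := repr_mkfrac a Ss; have [q [Sq f]] := repr_mkfrac b St.
set x := repr _ in e *; set y := repr _ in f *.
exists (r * q); split; first exact: msetM.
transitivity (q * fden y * t * (r * (fnum x * s)) +
              r * fden x * s * (q * (fnum y * t))); first by ring.
by rewrite e f; ring.
Qed.

Lemma mkfracM a s (Ss : mset S s) b t (St : mset S t) :
  loc_mul (mkfrac a Ss) (mkfrac b St) = mkfrac (a * b) (msetM Ss St).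
Proof.
apply/mkfrac_eq.
have [r [Sr e]] := repr_mkfrac a Ss; have [q [Sq f]] := repr_mkfrac b St.
set x := repr _ in e *; set y := repr _ in f *.
exists (r * q); split; first exact: msetM.
transitivity ((r * (fnum x * s)) * (q * (fnum y * t))); first by ring.
by rewrite e f; ring.
Qed.

Lemma mkfracN a s (Ss : mset S s) : loc_opp (mkfrac a Ss) = mkfrac (- a) Ss.
Proof.
apply/mkfrac_eq; have [r [Sr e]] := repr_mkfrac a Ss.
by exists r; split => //; rewrite !mulNr !mulrN e.
Qed.

Let sameden a s (Ss : mset S s) b t (St : mset S t) :
  a * t = b * s -> mkfrac a Ss = mkfrac b St.
Proof. by move=> e; apply/mkfrac_eq; exists 1; split; [exact: mset1|rewrite e]. Qed.

Fact loc_addA : associative loc_add.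
Proof.
move=> x y z; have [a [s [Ss ->]]] := mkfracP x.
have [b [t [St ->]]] := mkfracP y; have [c [u [Su ->]]] := mkfracP z.
by rewrite !mkfracD; apply: sameden; ring.
Qed.

Fact loc_addC : commutative loc_add.
Proof.
move=> x y; have [a [s [Ss ->]]] := mkfracP x.
have [b [t [St ->]]] := mkfracP y.
by rewrite !mkfracD; apply: sameden; ring.
Qed.

Fact loc_add0 : left_id (mkfrac 0 (mset1 S)) loc_add.
Proof.
move=> x; have [a [s [Ss ->]]] := mkfracP x.
by rewrite !mkfracD; apply: sameden; ring.
Qed.

Fact loc_addN : left_inverse (mkfrac 0 (mset1 S)) loc_opp loc_add.
Proof.
move=> x; have [a [s [Ss ->]]] := mkfracP x.
by rewrite mkfracN mkfracD; apply: sameden; ring.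
Qed.

HB.instance Definition _ :=
  GRing.isZmodule.Build loc loc_addA loc_addC loc_add0 loc_addN.

Fact loc_mulA : associative loc_mul.
Proof.
move=> x y z; have [a [s [Ss ->]]] := mkfracP x.
have [b [t [St ->]]] := mkfracP y; have [c [u [Su ->]]] := mkfracP z.
by rewrite !mkfracM; apply: sameden; ring.
Qed.

Fact loc_mulC : commutative loc_mul.
Proof.
move=> x y; have [a [s [Ss ->]]] := mkfracP x.
have [b [t [St ->]]] := mkfracP y.
by rewrite !mkfracM; apply: sameden; ring.
Qed.

Fact loc_mul1 : left_id (mkfrac 1 (mset1 S)) loc_mul.
Proof.
move=> x; have [a [s [Ss ->]]] := mkfracP x.
by rewrite !mkfracM; apply: sameden; ring.
Qed.

Fact loc_mulD : left_distributive loc_mul +%R.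
Proof.
move=> x y z; have [a [s [Ss ->]]] := mkfracP x.
have [b [t [St ->]]] := mkfracP y; have [c [u [Su ->]]] := mkfracP z.
have D (v w : loc) : v + w = loc_add v w by [].
by rewrite !D !(mkfracM, mkfracD); apply: sameden; ring.
Qed.

HB.instance Definition _ :=
  GRing.Zmodule_isComPzRing.Build loc loc_mulA loc_mulC loc_mul1 loc_mulD.

Lemma mkfrac_add a s (Ss : mset S s) b t (St : mset S t) :
  mkfrac a Ss + mkfrac b St = mkfrac (a * t + b * s) (msetM Ss St).
Proof. exact: mkfracD. Qed.

Lemma mkfrac_mul a s (Ss : mset S s) b t (St : mset S t) :
  mkfrac a Ss * mkfrac b St = mkfrac (a * b) (msetM Ss St).
Proof. exact: mkfracM. Qed.

Lemma mkfrac_opp a s (Ss : mset S s) : - mkfrac a Ss = mkfrac (- a) Ss.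
Proof. exact: mkfracN. Qed.

Lemma mkfrac0 : 0 = mkfrac 0 (mset1 S). Proof. by []. Qed.

Lemma mkfrac1 : 1 = mkfrac 1 (mset1 S). Proof. by []. Qed.

End Localization.

Section LocalizationMap.
Variables (R R' : comPzRingType) (phi : {rmorphism R -> R'}).
Variables (S : mulset R) (T : mulset R').
Hypothesis ST : forall x, mset S x -> mset T (phi x).

(* a / s |-> phi(a) / phi(s) *)
Definition loc_map :=
  fun x : loc S => mkfrac (phi (fnum (repr x))) (ST (fdenP (repr x))) : loc T.
Local Notation f := loc_map.

Lemma loc_mapE a s (Ss : mset S s) : f (mkfrac a Ss) = mkfrac (phi a) (ST Ss).
Proof.
apply/mkfrac_eq; have [r [Sr e]] := repr_mkfrac a Ss.
exists (phi r); split; first exact: ST.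
by rewrite -!rmorphM e.
Qed.

Fact loc_map_zmod_morphism : zmod_morphism f.
Proof.
move=> x y; have [a [s [Ss ->]]] := mkfracP x.
have [b [t [St ->]]] := mkfracP y.
rewrite mkfrac_opp mkfrac_add !loc_mapE mkfrac_opp mkfrac_add.
apply/mkfrac_eq; exists 1; split; first exact: mset1.
by rewrite !(rmorphD, rmorphM, rmorphN).
Qed.

Fact loc_map_monoid_morphism : monoid_morphism f.
Proof.
split=> [|x y].
  rewrite !mkfrac1 loc_mapE; apply/mkfrac_eq; exists 1; split.
    exact: mset1.
  by rewrite rmorph1.
have [a [s [Ss ->]]] := mkfracP x; have [b [t [St ->]]] := mkfracP y.
rewrite mkfrac_mul !loc_mapE mkfrac_mul.
apply/mkfrac_eq; exists 1; split; first exact: mset1.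
by rewrite !rmorphM.
Qed.

HB.instance Definition _ :=
  GRing.isZmodMorphism.Build (loc S) (loc T) f loc_map_zmod_morphism.
HB.instance Definition _ :=
  GRing.isMonoidMorphism.Build (loc S) (loc T) f loc_map_monoid_morphism.

End LocalizationMap.

Section Powers.
Variables (R : comPzRingType) (f : R).

Fact powers1 : [set x : R | exists n, x = f ^+ n] 1.
Proof. by exists 0%N; rewrite expr0. Qed.

Fact powersM (x y : R) : [set x : R | exists n, x = f ^+ n] x ->
  [set x : R | exists n, x = f ^+ n] y ->
  [set x : R | exists n, x = f ^+ n] (x * y).
Proof. by move=> [m ->] [n ->]; exists (m + n)%N; rewrite exprD. Qed.

Definition powers : mulset R := MulSet powers1 powersM.

End Powers.

Fact powers_morph (A B : comPzRingType) (phi : {rmorphism A -> B}) (f x : A) :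
  mset (powers f) x -> mset (powers (phi f)) (phi x).
Proof. by move=> [n ->]; exists n; rewrite rmorphXn. Qed.

Definition finite_free (A B : comPzRingType) (phi : {rmorphism A -> B}) : Prop :=
  exists (n : nat) (e : 'I_n -> B), forall b : B,
    exists! c : {ffun 'I_n -> A}, b = \sum_i phi (c i) * e i.

(* The D(f_i) cover Spec A, and B_{f_i} is finite free over A_{f_i} for all i;
   the rank may depend on i. *)
Definition finite_locally_free (A B : comPzRingType)
    (phi : {rmorphism A -> B}) : Prop :=
  exists (r : nat) (f : 'I_r -> A),
    (exists g : 'I_r -> A, \sum_i g i * f i = 1) /\
    forall i, finite_free (loc_map (@powers_morph A B phi (f i))).

(* The formal sum of b_i (x) c_i is represented by the list of the (b_i, c_i). *)
Inductive tensor_rel (A B C : comPzRingType) (phi : {rmorphism A -> B})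
    (psi : {rmorphism A -> C}) : seq (B * C) -> seq (B * C) -> Prop :=
| TRefl s : tensor_rel phi psi s s
| TSym s t : tensor_rel phi psi s t -> tensor_rel phi psi t s
| TTrans s t u :
    tensor_rel phi psi s t -> tensor_rel phi psi t u -> tensor_rel phi psi s u
| TCat s s' t t' : tensor_rel phi psi s s' -> tensor_rel phi psi t t' ->
    tensor_rel phi psi (s ++ t) (s' ++ t')
| TSwap s t : tensor_rel phi psi (s ++ t) (t ++ s)
| TAddl b b' c : tensor_rel phi psi [:: (b + b', c)] [:: (b, c); (b', c)]
| TAddr b c c' : tensor_rel phi psi [:: (b, c + c')] [:: (b, c); (b, c')]
| TScal a b c : tensor_rel phi psi [:: (phi a * b, c)] [:: (b, psi a * c)]
| TZero c : tensor_rel phi psi [:: (0, c)] [::].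

Section Tensor.
Variables (A B C : comPzRingType).
Variables (phi : {rmorphism A -> B}) (psi : {rmorphism A -> C}).
Local Notation "s ~ t" := (tensor_rel phi psi s t) (at level 70).
Local Notation sumT := (seq (B * C)).

Definition tensor_equiv (s t : sumT) : bool := `[< s ~ t >].

Fact tensor_equiv_refl : reflexive tensor_equiv.
Proof. by move=> s; apply/asboolP; exact: TRefl. Qed.

Fact tensor_equiv_sym : symmetric tensor_equiv.
Proof. by move=> s t; apply/asboolP/asboolP; exact: TSym. Qed.

Fact tensor_equiv_trans : transitive tensor_equiv.
Proof.
by move=> t s u /asboolP st /asboolP tu; apply/asboolP; exact: TTrans tu.
Qed.

Canonical tensor_equiv_equiv := EquivRel tensor_equiv
  tensor_equiv_refl tensor_equiv_sym tensor_equiv_trans.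

Definition tensor := {eq_quot tensor_equiv}.
HB.instance Definition _ := Choice.on tensor.
HB.instance Definition _ : EqQuotient _ tensor_equiv tensor :=
  EqQuotient.on tensor.

Definition tclass (s : sumT) : tensor := \pi_tensor s.

Lemma tclassP s t : tclass s = tclass t <-> s ~ t.
Proof. by split=> [/eqmodP/asboolP|h] //; apply/eqmodP/asboolP. Qed.

Lemma tclass_surj (x : tensor) : exists s, x = tclass s.
Proof. by exists (repr x); rewrite /tclass reprK. Qed.

Lemma repr_tclass s : repr (tclass s) ~ s.
Proof. by apply/tclassP; rewrite /tclass reprK. Qed.

Definition pure_tensor (b : B) (c : C) : tensor := tclass [:: (b, c)].

Definition tmul (s t : sumT) : sumT :=
  [seq (x.1 * y.1, x.2 * y.2) | x <- s, y <- t].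
Definition tscale (x : B * C) (t : sumT) : sumT :=
  [seq (x.1 * y.1, x.2 * y.2) | y <- t].
Definition topp (s : sumT) : sumT := [seq (- x.1, x.2) | x <- s].

Lemma tmul_cons x s t : tmul (x :: s) t = tscale x t ++ tmul s t.
Proof. by []. Qed.

Lemma tscale_rel x s t : s ~ t -> tscale x s ~ tscale x t.
Proof.
elim=> [u|u v _|u v w _ + _|u u' v v' _ + _|u v|b b' c|b c c'|a b c|c].
- exact: TRefl.
- exact: TSym.
- exact: TTrans.
- by rewrite /tscale !map_cat; exact: TCat.
- by rewrite /tscale !map_cat; exact: TSwap.
- by rewrite /tscale /= mulrDr; exact: TAddl.
- by rewrite /tscale /= mulrDr; exact: TAddr.
- by rewrite /tscale /= (mulrCA _ (phi a)) (mulrCA _ (psi a)); exact: TScal.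
- by rewrite /tscale /= mulr0; exact: TZero.
Qed.

Lemma tmul_relr s t t' : t ~ t' -> tmul s t ~ tmul s t'.
Proof.
move=> tt'; elim: s => [|x s ih]; first exact: TRefl.
by rewrite !tmul_cons; apply: TCat ih; exact: tscale_rel.
Qed.

Lemma perm_rel s t : perm_eq s t -> s ~ t.
Proof.
elim: s t => [|x s ih] t.
  by rewrite perm_sym => /perm_nilP ->; exact: TRefl.
move=> pst; have xt : x \in t by rewrite -(perm_mem pst) mem_head.
case/splitPr: xt pst => t1 t2 pst.
have pst' : perm_eq s (t1 ++ t2).
  by rewrite -(perm_cons x) (permPl pst) -cat1s perm_catCA.
rewrite -[x :: s]cat1s -[x :: t2]cat1s catA.
apply: TTrans (_ : ([:: x] ++ t1) ++ t2 ~ _); last first.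
  by apply: TCat (TRefl _ _ _); exact: TSwap.
by rewrite -catA; apply: TCat; [exact: TRefl|exact: ih].
Qed.

Lemma tmulC s t : tmul s t ~ tmul t s.
Proof.
elim: s => [|x s ih]; first by rewrite /tmul allpairs0r; exact: TRefl.
rewrite tmul_cons; apply: TTrans (TCat (TRefl _ _ _) ih) _.
have -> : tscale x t = [seq (y.1 * x.1, y.2 * x.2) | y <- t].
  by apply: eq_map => y; rewrite mulrC [y.2 * _]mulrC.
apply: TSym; apply: perm_rel.
apply/permPl.
exact: (@perm_allpairs_consr _ (fun=> B * C)%type _
  (fun y z => (y.1 * z.1, y.2 * z.2)) t (fun=> x) (fun=> s)).
Qed.

Lemma tmul_rel s s' t t' : s ~ s' -> t ~ t' -> tmul s t ~ tmul s' t'.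
Proof.
move=> ss' tt'; apply: TTrans (tmul_relr _ tt') _.
by apply: TTrans (tmulC _ _) _; apply: TTrans (tmul_relr _ ss') (tmulC _ _).
Qed.

Lemma topp_rel s t : s ~ t -> topp s ~ topp t.
Proof.
have E u : topp u = tscale (-1, 1) u.
  by apply: eq_map => x /=; rewrite mulN1r mul1r.
by rewrite !E; exact: tscale_rel.
Qed.

Definition tensor_add (x y : tensor) : tensor := tclass (repr x ++ repr y).
Definition tensor_opp (x : tensor) : tensor := tclass (topp (repr x)).
Definition tensor_mul (x y : tensor) : tensor := tclass (tmul (repr x) (repr y)).

Lemma tclassD s t : tensor_add (tclass s) (tclass t) = tclass (s ++ t).
Proof. by apply/tclassP; apply: TCat; exact: repr_tclass. Qed.

Lemma tclassN s : tensor_opp (tclass s) = tclass (topp s).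
Proof. by apply/tclassP; apply: topp_rel; exact: repr_tclass. Qed.

Lemma tclassM s t : tensor_mul (tclass s) (tclass t) = tclass (tmul s t).
Proof. by apply/tclassP; apply: tmul_rel; exact: repr_tclass. Qed.

Fact tensor_addA : associative tensor_add.
Proof.
move=> x y z; have [s ->] := tclass_surj x; have [t ->] := tclass_surj y.
by have [u ->] := tclass_surj z; rewrite !tclassD catA.
Qed.

Fact tensor_addC : commutative tensor_add.
Proof.
move=> x y; have [s ->] := tclass_surj x; have [t ->] := tclass_surj y.
by rewrite !tclassD; apply/tclassP; exact: TSwap.
Qed.

Fact tensor_add0 : left_id (tclass [::]) tensor_add.
Proof. by move=> x; have [s ->] := tclass_surj x; rewrite tclassD. Qed.

Fact tensor_addN : left_inverse (tclass [::]) tensor_opp tensor_add.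
Proof.
move=> x; have [s ->] := tclass_surj x; rewrite tclassN tclassD; apply/tclassP.
elim: s => [|[b c] s ih]; first exact: TRefl.
rewrite -[(b, c) :: s]cat1s catA.
apply: TTrans (_ : [:: (- b, c); (b, c)] ++ (topp s ++ s) ~ _).
  rewrite -[topp _]/([:: (- b, c)] ++ topp s) -[[:: _; _]]/([:: _] ++ [:: _]).
  rewrite -!catA; apply: TCat; first exact: TRefl.
  by rewrite !catA; apply: TCat (TRefl _ _ _); exact: TSwap.
apply: TTrans (TCat (TSym (TAddl _ _ _ _ _)) ih) _.
by rewrite addNr; exact: TZero.
Qed.

HB.instance Definition _ := GRing.isZmodule.Build tensor
  tensor_addA tensor_addC tensor_add0 tensor_addN.

Fact tensor_mulA : associative tensor_mul.
Proof.
move=> x y z; have [s ->] := tclass_surj x; have [t ->] := tclass_surj y.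
have [u ->] := tclass_surj z; rewrite !tclassM; congr tclass.
have H w v : tmul (tscale w v) u = tscale w (tmul v u).
  elim: v => [//|v0 v ih].
  rewrite [tscale w (v0 :: v)]/= !tmul_cons ih [RHS]map_cat.
  congr (_ ++ _); rewrite /tscale -map_comp.
  by apply: eq_map => y' /=; rewrite !mulrA.
elim: s => [//|w s ih]; rewrite !tmul_cons -H ih.
by rewrite [RHS]allpairs_cat.
Qed.

Fact tensor_mulC : commutative tensor_mul.
Proof.
move=> x y; have [s ->] := tclass_surj x; have [t ->] := tclass_surj y.
by rewrite !tclassM; apply/tclassP; exact: tmulC.
Qed.

Fact tensor_mul1 : left_id (pure_tensor 1 1) tensor_mul.
Proof.
move=> x; have [s ->] := tclass_surj x; rewrite tclassM; congr tclass.
rewrite tmul_cons cats0 -[RHS]map_id; apply: eq_map => -[b c] /=.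
by rewrite !mul1r.
Qed.

Fact tensor_mulD : left_distributive tensor_mul +%R.
Proof.
move=> x y z; have [s ->] := tclass_surj x; have [t ->] := tclass_surj y.
have [u ->] := tclass_surj z.
have D (v w : tensor) : v + w = tensor_add v w by [].
by rewrite !D !(tclassM, tclassD) /tmul allpairs_cat.
Qed.

HB.instance Definition _ := GRing.Zmodule_isComPzRing.Build tensor
  tensor_mulA tensor_mulC tensor_mul1 tensor_mulD.

Definition tensor_inr (c : C) : tensor := pure_tensor 1 c.
Definition tensor_inl (b : B) : tensor := pure_tensor b 1.

Fact tensor_inr_zmod_morphism : zmod_morphism tensor_inr.
Proof.
have D c c' : tensor_inr (c + c') = tensor_inr c + tensor_inr c'.
  apply: etrans (esym (tclassD _ _)).
  by apply/tclassP; exact: TAddr.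
by move=> c c'; apply/eqP; rewrite eq_sym subr_eq -D subrK.
Qed.

Fact tensor_inr_monoid_morphism : monoid_morphism tensor_inr.
Proof.
split=> [//|c c']; apply: etrans (esym (tclassM _ _)).
by rewrite /tmul /= mulr1.
Qed.

HB.instance Definition _ := GRing.isZmodMorphism.Build C tensor tensor_inr
  tensor_inr_zmod_morphism.
HB.instance Definition _ := GRing.isMonoidMorphism.Build C tensor tensor_inr
  tensor_inr_monoid_morphism.

End Tensor.

Section TensorMap.
Variables (A B C C' : comPzRingType) (phi : {rmorphism A -> B}).
Variables (psi : {rmorphism A -> C}) (psi' : {rmorphism A -> C'}).
Variable u : {rmorphism C -> C'}.
Hypothesis upsi : forall a, u (psi a) = psi' a.

(* b (x) c |-> b (x) u(c), for a morphism u of A-algebras *)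
Definition tensor_map of (forall a, u (psi a) = psi' a) :=
  fun x : tensor phi psi =>
    tclass phi psi' [seq (y.1, u y.2) | y <- repr x].

Lemma tensor_mapE s : tensor_map upsi (tclass phi psi s) =
  tclass phi psi' [seq (y.1, u y.2) | y <- s].
Proof.
apply/tclassP; have := repr_tclass phi psi s; move: (repr _) => t.
elim=> [v|v w _|v w z _ + _|v v' w w' _ + _|v w|b b' c|b c c'|a b c|c].
- exact: TRefl.
- exact: TSym.
- exact: TTrans.
- by rewrite !map_cat; exact: TCat.
- by rewrite !map_cat; exact: TSwap.
- exact: TAddl.
- by rewrite /= rmorphD; exact: TAddr.
- by rewrite /= rmorphM upsi; exact: TScal.
- exact: TZero.
Qed.

End TensorMap.

Record opens (X : topologicalType) := Opens {
  oset :> set X;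
  opensP : open oset
}.

Section Opens.
Variable X : topologicalType.

Lemma opens_eq (U V : opens X) : oset U = oset V -> U = V.
Proof.
case: U V => [U oU] [V oV] /= e; case: _ / e oV => oV.
by congr Opens; exact: Prop_irrelevance.
Qed.

Definition opensI (U V : opens X) : opens X :=
  Opens (openI (opensP U) (opensP V)).

Fact opensIl (U V : opens X) : opensI U V `<=` U.
Proof. exact: subIsetl. Qed.

Fact opensIr (U V : opens X) : opensI U V `<=` V.
Proof. exact: subIsetr. Qed.

End Opens.

Definition preim (X Y : topologicalType) (f : X -> Y) (fc : continuous f)
    (V : opens Y) : opens X :=
  Opens (iffLR (continuousP f) fc V (opensP V)).

Record presheaf (X : topologicalType) := Presheaf {
  sec : opens X -> comPzRingType;
  res : forall U V : opens X, U `<=` V -> {rmorphism sec V -> sec U};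
  res_id : forall (U : opens X) (h : U `<=` U) s, res h s = s;
  res_comp : forall (U V W : opens X) (h : U `<=` V) (k : V `<=` W)
    (l : U `<=` W) s, res h (res k s) = res l s
}.
Arguments sec {X} _ _.
Arguments res {X} _ {U V} _.

Definition is_sheaf (X : topologicalType) (F : presheaf X) : Prop :=
  forall (I : Type) (V : I -> opens X) (U : opens X)
    (VU : forall i, V i `<=` U), U `<=` \bigcup_i V i ->
  (forall s t : sec F U, (forall i, res F (VU i) s = res F (VU i) t) -> s = t) /\
  (forall s : forall i, sec F (V i),
    (forall i j, res F (@opensIl _ (V i) (V j)) (s i) =
                 res F (@opensIr _ (V i) (V j)) (s j)) ->
    exists t : sec F U, forall i, res F (VU i) t = s i).

(* The stalk at x is the filtered colimit of the rings of sections over the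
   neighbourhoods of x.  So the germ of s at x is zero (a unit) if and only if
   the restriction of s to some neighbourhood of x is zero (a unit). *)
Definition germ_zero (X : topologicalType) (F : presheaf X) (x : X)
    (U : opens X) (s : sec F U) : Prop :=
  exists (V : opens X) (VU : V `<=` U), oset V x /\ res F VU s = 0.

Definition germ_unit (X : topologicalType) (F : presheaf X) (x : X)
    (U : opens X) (s : sec F U) : Prop :=
  exists (V : opens X) (VU : V `<=` U), oset V x /\ invertible (res F VU s).

(* The stalk at x is nonzero, and s or 1 - s is a unit for every germ s. *)
Definition local_stalk (X : topologicalType) (F : presheaf X) (x : X) : Prop :=
  (forall U : opens X, oset U x -> ~ germ_zero x (1 : sec F U)) /\
  (forall (U : opens X) (s : sec F U), oset U x ->
    germ_unit x s \/ germ_unit x (1 - s)).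

Record lrspace := LRSpace {
  space :> topologicalType;
  sheaf : presheaf space;
  sheafP : is_sheaf sheaf;
  stalkP : forall x, local_stalk sheaf x
}.

Notation sections X U := (sec (sheaf X) U).

Record lrs_hom (X Y : lrspace) := LRSHom {
  hfun :> X -> Y;
  hcont : continuous hfun;
  hsharp : forall V : opens Y,
    {rmorphism sections Y V -> sections X (preim hcont V)};
  hsharp_res : forall (U V : opens Y) (h : U `<=` V)
    (k : preim hcont U `<=` preim hcont V) s,
    hsharp U (res (sheaf Y) h s) = res (sheaf X) k (hsharp V s);
  hlocal : forall (x : X) (V : opens Y) (s : sections Y V), oset V (hfun x) ->
    germ_unit x (hsharp V s) -> germ_unit (hfun x) s
}.
Arguments hcont {X Y} _.
Arguments hsharp {X Y} _ _.

Lemma rmorphism_eq (R S : pzSemiRingType) (f g : {rmorphism R -> S}) :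
  (forall x, f x = g x) -> f = g.
Proof.
case: f g => [f cf] [g cg] /= /funext e; case: _ / e cg => cg.
congr GRing.RMorphism.Pack.
case: cf cg => [[a] [b]] [[c] [d]].
by rewrite (Prop_irrelevance a c) (Prop_irrelevance b d).
Qed.

Lemma lrs_hom_eq (X Y : lrspace) (f g : lrs_hom X Y) :
  (forall x, f x = g x) ->
  (forall (V : opens Y) (W : opens X) (h : W `<=` preim (hcont f) V)
     (k : W `<=` preim (hcont g) V) s,
     res (sheaf X) h (hsharp f V s) = res (sheaf X) k (hsharp g V s)) ->
  f = g.
Proof.
case: f g => [f fc fs fr fl] [g gc gs gr gl] /= /funext e.
case: _ / e gc gs gr gl => gc.
rewrite -(Prop_irrelevance fc gc) => gs gr gl H.
have E : fs = gs.
  apply: functional_extensionality_dep => V; apply: rmorphism_eq => s.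
  by have := H V (preim fc V) (@subset_refl _ (preim fc V))
    (@subset_refl _ (preim fc V)) s; rewrite !res_id.
case: _ / E gr gl {H} => gr gl.
by rewrite (Prop_irrelevance fr gr) (Prop_irrelevance fl gl).
Qed.

Section Identity.
Variable X : lrspace.

Fact lrs_id_cont : continuous (idfun : X -> X).
Proof. by move=> x; exact: cvg_id. Qed.

Definition lrs_id_sub (V : opens X) : preim lrs_id_cont V `<=` V :=
  @subset_refl _ _.

Fact lrs_id_res (U V : opens X) (h : U `<=` V)
    (k : preim lrs_id_cont U `<=` preim lrs_id_cont V) s :
  res (sheaf X) (lrs_id_sub (V := U)) (res (sheaf X) h s) =
  res (sheaf X) k (res (sheaf X) (lrs_id_sub (V := V)) s).
Proof.
have l : preim lrs_id_cont U `<=` V by [].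
by rewrite !(res_comp _ _ l).
Qed.

Fact lrs_id_local (x : X) (V : opens X) (s : sections X V) : oset V (idfun x) ->
  germ_unit x (res (sheaf X) (lrs_id_sub (V := V)) s) -> germ_unit (idfun x) s.
Proof.
move=> _ [W [WV [Wx]]]; rewrite (res_comp _ _ (WV : W `<=` V)) => ?.
by exists W, WV.
Qed.

Definition lrs_id : lrs_hom X X :=
  @LRSHom X X idfun lrs_id_cont (fun V => res (sheaf X) (lrs_id_sub (V := V)))
    lrs_id_res lrs_id_local.

End Identity.

Section Composition.
Variables (X Y Z : lrspace) (g : lrs_hom Y Z) (f : lrs_hom X Y).

Fact lrs_comp_cont : continuous (g \o f).
Proof. by move=> x; apply: continuous_comp; exact: hcont. Qed.

Definition lrs_comp_sub (W : opens Z) :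
    preim lrs_comp_cont W `<=` preim (hcont f) (preim (hcont g) W) :=
  @subset_refl _ _.

Definition lrs_comp_sharp (W : opens Z) :
    {rmorphism sections Z W -> sections X (preim lrs_comp_cont W)} :=
  res (sheaf X) (lrs_comp_sub (W := W)) \o
    (hsharp f (preim (hcont g) W) \o hsharp g W).

Fact lrs_comp_res (U V : opens Z) (h : U `<=` V)
    (k : preim lrs_comp_cont U `<=` preim lrs_comp_cont V) s :
  lrs_comp_sharp U (res (sheaf Z) h s) =
  res (sheaf X) k (lrs_comp_sharp V s).
Proof.
have k' : preim (hcont g) U `<=` preim (hcont g) V by move=> y /h.
have k'' : preim (hcont f) (preim (hcont g) U) `<=`
    preim (hcont f) (preim (hcont g) V) by move=> x /k'.
rewrite /lrs_comp_sharp /= (hsharp_res _ k') (hsharp_res _ k'').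
by rewrite !(res_comp _ _ (k : preim lrs_comp_cont U `<=`
  preim (hcont f) (preim (hcont g) V))).
Qed.

Fact lrs_comp_local (x : X) (V : opens Z) (s : sections Z V) : oset V ((g \o f) x) ->
  germ_unit x (lrs_comp_sharp V s) -> germ_unit ((g \o f) x) s.
Proof.
move=> Vx [W [WV [Wx]]]; rewrite /lrs_comp_sharp /=.
rewrite (res_comp _ _ (WV : W `<=`
  preim (hcont f) (preim (hcont g) V))) => u.
apply: hlocal => //; apply: (@hlocal _ _ f) => //.
by exists W, WV.
Qed.

Definition lrs_comp : lrs_hom X Z := LRSHom lrs_comp_res lrs_comp_local.

End Composition.

Lemma lrs_compA (X Y Z T : lrspace) (h : lrs_hom Z T) (g : lrs_hom Y Z)
    (f : lrs_hom X Y) :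
  lrs_comp h (lrs_comp g f) = lrs_comp (lrs_comp h g) f.
Proof.
apply: lrs_hom_eq => // V W k l s.
have fk : preim (hcont f) (preim (lrs_comp_cont (g := h) (f := g)) V) `<=`
  preim (hcont f) (preim (hcont g) (preim (hcont h) V)).
  by move=> x.
rewrite /= /lrs_comp_sharp /= (hsharp_res _ fk).
rewrite (res_comp _ _ (k : W `<=`
  preim (hcont (lrs_comp g f)) (preim (hcont h) V))).
rewrite [in RHS](res_comp _ _ (l : W `<=`
  preim (hcont f) (preim (hcont (lrs_comp h g)) V))).
by rewrite !(res_comp _ _ (k : W `<=`
  preim (hcont f) (preim (hcont g) (preim (hcont h) V)))).
Qed.

Section OpenSubspace.
Variables (X : lrspace) (U : opens X).
Local Notation US := (set_type (oset U)).
Implicit Types V W : opens US.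

Fact img_open V : open (set_val @` V : set X).
Proof.
case: V => V oV /=; have [W oW WV] : exists2 W, open W & set_val @^-1` W = V.
  by case: oV => W oW <-; exists W.
suff -> : set_val @` V = W `&` U by apply: openI => //; exact: opensP.
rewrite -WV; apply/seteqP; split=> [_ [x Wx <-]|x [Wx Ux]].
  by split=> //; exact: set_valP.
by exists (SigSub (mem_set Ux)).
Qed.

Definition img V : opens X := Opens (img_open V).

Fact img_sub V W : V `<=` W -> img V `<=` img W.
Proof. by move=> VW _ [x Vx <-]; exists x => //; exact: VW. Qed.

Definition open_presheaf : presheaf US :=
  @Presheaf US (fun V => sections X (img V))
    (fun V W (h : V `<=` W) => res (sheaf X) (img_sub h))
    (fun V h s => res_id (img_sub h) s)
    (fun V W T h k l s => res_comp (img_sub h) (img_sub k) (img_sub l) s).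

Lemma img_val V (x : US) : oset (img V) (val x) <-> oset V x.
Proof.
split=> [[y Vy] /val_inj <- //|Vx].
by exists x.
Qed.

Fact open_is_sheaf : is_sheaf open_presheaf.
Proof.
move=> I V W VW cov.
have cov' : img W `<=` \bigcup_i img (V i).
  by move=> _ [x /cov[i _ Vix] <-]; exists i => //; exists x.
have [loc glue] := sheafP (fun i => img_sub (VW i)) cov'.
split=> [s t st|s st]; first exact: loc.
apply: glue => i j.
have E : opensI (img (V i)) (img (V j)) `<=` img (opensI (V i) (V j)).
  by move=> _ [[x Vix <-] [y Vjy /val_inj xy]]; exists x => //; rewrite -xy in Vix *.
have /(congr1 (res (sheaf X) E)) /= := st i j.
by rewrite (res_comp _ _ (@opensIl _ (img (V i)) (img (V j))))
  (res_comp _ _ (@opensIr _ (img (V i)) (img (V j)))).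
Qed.

Lemma open_cut (V : opens X) : open (set_val @^-1` V : set US).
Proof. by exists V => //; exact: opensP. Qed.

Fact open_stalkP (x : US) : local_stalk open_presheaf x.
Proof.
have [n0 loc] := stalkP (val x); split=> [V Vx [W [WV [Wx z]]]|V s Vx].
  by apply: (n0 (img V)); [exact/img_val|exists (img W), (img_sub WV); split=> //; exact/img_val].
have H (t : sections X (img V)) : germ_unit (val x) t ->
    @germ_unit _ open_presheaf x V t.
  move=> [W [WV [Wx [u e]]]].
  have CV : Opens (open_cut W) `<=` V by move=> y /WV/img_val.
  have CW : img (Opens (open_cut W)) `<=` W by move=> _ [y Wy <-].
  exists (Opens (open_cut W)), CV; split=> //; exists (res (sheaf X) CW u).
  have := congr1 (res (sheaf X) CW) e.
  by rewrite rmorphM rmorph1 (res_comp _ _ (img_sub CV)).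
by case: (loc (img V) s); [exact/img_val|left; exact: H|right; exact: H].
Qed.

Definition open_lrspace : lrspace := LRSpace open_is_sheaf open_stalkP.

End OpenSubspace.

Record prime_ideal (R : comPzRingType) := PrimeIdeal {
  pset :> set R;
  primeI : is_ideal pset;
  prime1 : ~ pset 1;
  primeM : forall x y, pset (x * y) -> pset x \/ pset y
}.

HB.instance Definition _ (R : comPzRingType) := gen_eqMixin (prime_ideal R).
HB.instance Definition _ (R : comPzRingType) := gen_choiceMixin (prime_ideal R).

Lemma prime_eq (R : comPzRingType) (p q : prime_ideal R) :
  pset p = pset q -> p = q.
Proof.
case: p q => [p Ip p1 pM] [q Iq q1 qM] /= e; case: _ / e Iq q1 qM => *.
by congr PrimeIdeal; exact: Prop_irrelevance.
Qed.

Section ZariskiTopology.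
Variable R : comPzRingType.

(* The open sets are the complements of the sets
   V(E) = {p | E is contained in p}. *)
Definition zariski_open : set_system (prime_ideal R) :=
  [set U | exists E : set R, U = [set p | ~ E `<=` pset p]].

Fact zariski_openT : zariski_open setT.
Proof.
exists [set 1]; apply/seteqP; split=> // p _ /= E.
by apply: (@prime1 _ p); exact: E.
Qed.

Fact zariski_openI : setI_closed zariski_open.
Proof.
move=> _ _ [E ->] [F ->].
exists [set z | exists x y, [/\ E x, F y & z = x * y]].
apply/seteqP; split=> p /=.
  move=> [/existsNP[x /not_implyP[Ex px]] /existsNP[y /not_implyP[Fy py]]] H.
  by case: (@primeM _ p x y) => //; apply: H; exists x, y.
have [_ _ pM] := primeI p.
move=> H; split=> K; apply: H => _ [x [y [Ex Fy ->]]].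
  by rewrite mulrC; apply: pM; exact: K.
by apply: pM; exact: K.
Qed.

Fact zariski_open_bigU (I : Type) (f : I -> set (prime_ideal R)) :
  (forall i, zariski_open (f i)) -> zariski_open (\bigcup_i f i).
Proof.
move=> fo; exists [set x | [set p : prime_ideal R | ~ pset p x] `<=` \bigcup_i f i].
apply/seteqP; split=> p /=.
  move=> [i _ fip] H; have [E fE] := fo i.
  move: (fip); rewrite fE => /existsNP[x /not_implyP[Ex px]].
  apply: px; apply: H => q qx; exists i => //; rewrite fE => K.
  by apply: qx; exact: K.
by move=> /existsNP[x /not_implyP[Hx px]]; exact: Hx.
Qed.

HB.instance Definition _ := isOpenTopological.Build (prime_ideal R)
  zariski_openT zariski_openI zariski_open_bigU.

Lemma zariskiP (U : set (prime_ideal R)) : open U <-> zariski_open U.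
Proof. by []. Qed.

Fact basic_open_open (f : R) : open [set p : prime_ideal R | ~ pset p f].
Proof.
apply/zariskiP; exists [set f]; apply/seteqP; split=> p /= H.
  by move=> /(_ f erefl).
by move=> K; apply: H => _ ->.
Qed.

Definition basic_open (f : R) : opens (prime_ideal R) :=
  Opens (basic_open_open f).

End ZariskiTopology.

Section StructureSheaf.
Variable R : comPzRingType.
Local Notation spec := (prime_ideal R).

Fact compl1 (p : spec) : (~` pset p) 1.
Proof. exact: prime1. Qed.

Fact complM (p : spec) (x y : R) :
  (~` pset p) x -> (~` pset p) y -> (~` pset p) (x * y).
Proof. by move=> px py /primeM[]. Qed.

Definition compl (p : spec) : mulset R := MulSet (@compl1 p) (@complM p).

(* families of elements of the local rings R_p which are fractions a / f
   locally on U *)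
Definition locally_fraction (U : opens spec)
    (s : forall p : spec, oset U p -> loc (compl p)) : Prop :=
  forall p : spec, oset U p ->
    exists (V : opens spec) (a f : R), [/\ V `<=` U, oset V p &
      forall (q : spec) (Uq : oset U q), oset V q ->
        exists fq : mset (compl q) f, s q Uq = mkfrac a fq].

Record spec_sec (U : opens spec) := SpecSec {
  sfun : forall p : spec, oset U p -> loc (compl p);
  sfunP : locally_fraction sfun
}.

HB.instance Definition _ (U : opens spec) := gen_eqMixin (spec_sec U).
HB.instance Definition _ (U : opens spec) := gen_choiceMixin (spec_sec U).

Lemma spec_sec_eq (U : opens spec) (s t : spec_sec U) :
  (forall p Up, sfun s (p := p) Up = sfun t Up) -> s = t.
Proof.
case: s t => [s sP] [t tP] /= st.
have e : s = t.
  apply: functional_extensionality_dep => p.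
  by apply: functional_extensionality_dep => Up; exact: st.
by case: _ / e tP {st} => tP; rewrite (Prop_irrelevance sP tP).
Qed.

Section Ring.
Variable U : opens spec.

Fact sec_const (a : R) :
  @locally_fraction U (fun p _ => mkfrac a (mset1 (compl p))).
Proof.
move=> p Up; exists U, a, 1; split=> // q Uq _.
by exists (mset1 (compl q)).
Qed.

Fact sec_add (s t : spec_sec U) :
  @locally_fraction U (fun p Up => sfun s Up + sfun t Up).
Proof.
move=> p Up; have [V [a [f [VU Vp sV]]]] := sfunP s Up.
have [W [b [g [WU Wp tW]]]] := sfunP t Up.
exists (opensI V W), (a * g + b * f), (f * g); split=> //.
  by move=> q [/VU].
move=> q Uq [Vq Wq]; have [fq ->] := sV q Uq Vq; have [gq ->] := tW q Uq Wq.
by exists (msetM fq gq); rewrite mkfrac_add.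
Qed.

Fact sec_mul (s t : spec_sec U) :
  @locally_fraction U (fun p Up => sfun s Up * sfun t Up).
Proof.
move=> p Up; have [V [a [f [VU Vp sV]]]] := sfunP s Up.
have [W [b [g [WU Wp tW]]]] := sfunP t Up.
exists (opensI V W), (a * b), (f * g); split=> //.
  by move=> q [/VU].
move=> q Uq [Vq Wq]; have [fq ->] := sV q Uq Vq; have [gq ->] := tW q Uq Wq.
by exists (msetM fq gq); rewrite mkfrac_mul.
Qed.

Fact sec_opp (s : spec_sec U) :
  @locally_fraction U (fun p Up => - sfun s Up).
Proof.
move=> p Up; have [V [a [f [VU Vp sV]]]] := sfunP s Up.
exists V, (- a), f; split=> // q Uq Vq; have [fq ->] := sV q Uq Vq.
by exists fq; rewrite mkfrac_opp.
Qed.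

Let add s t := SpecSec (sec_add s t).
Let mul s t := SpecSec (sec_mul s t).
Let opp s := SpecSec (sec_opp s).
Let zero := SpecSec (sec_const 0).
Let one := SpecSec (sec_const 1).

Fact sec_addA : associative add.
Proof. by move=> s t u; apply: spec_sec_eq => p Up /=; rewrite addrA. Qed.
Fact sec_addC : commutative add.
Proof. by move=> s t; apply: spec_sec_eq => p Up /=; rewrite addrC. Qed.
Fact sec_add0 : left_id zero add.
Proof. by move=> s; apply: spec_sec_eq => p Up /=; rewrite -mkfrac0 add0r. Qed.
Fact sec_addN : left_inverse zero opp add.
Proof. by move=> s; apply: spec_sec_eq => p Up /=; rewrite addNr. Qed.

HB.instance Definition _ := GRing.isZmodule.Build (spec_sec U)
  sec_addA sec_addC sec_add0 sec_addN.

Fact sec_mulA : associative mul.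
Proof. by move=> s t u; apply: spec_sec_eq => p Up /=; rewrite mulrA. Qed.
Fact sec_mulC : commutative mul.
Proof. by move=> s t; apply: spec_sec_eq => p Up /=; rewrite mulrC. Qed.
Fact sec_mul1 : left_id one mul.
Proof. by move=> s; apply: spec_sec_eq => p Up /=; rewrite -mkfrac1 mul1r. Qed.
Fact sec_mulD : left_distributive mul +%R.
Proof. by move=> s t u; apply: spec_sec_eq => p Up /=; rewrite mulrDl. Qed.

HB.instance Definition _ := GRing.Zmodule_isComPzRing.Build (spec_sec U)
  sec_mulA sec_mulC sec_mul1 sec_mulD.

End Ring.

Lemma sfunD U (s t : spec_sec U) p Up :
  sfun (s + t) (p := p) Up = sfun s Up + sfun t Up.
Proof. by []. Qed.

Lemma sfunN U (s : spec_sec U) p Up : sfun (- s) (p := p) Up = - sfun s Up.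
Proof. by []. Qed.

Lemma sfunM U (s t : spec_sec U) p Up :
  sfun (s * t) (p := p) Up = sfun s Up * sfun t Up.
Proof. by []. Qed.

Lemma sfun1 (U : opens spec) p Up : sfun (1 : spec_sec U) (p := p) Up = 1.
Proof. by []. Qed.

Lemma sfun0 (U : opens spec) p Up : sfun (0 : spec_sec U) (p := p) Up = 0.
Proof. by []. Qed.

Section Restrict.
Variables (U V : opens spec) (h : U `<=` V).

Fact sec_res (s : spec_sec V) :
  @locally_fraction U (fun p Up => sfun s (h Up)).
Proof.
move=> p Up; have [W [a [f [WV Wp sW]]]] := sfunP s (h Up).
exists (opensI U W), a, f; split=> // [q []//|q Uq [_ Wq]].
exact: sW.
Qed.

Definition spec_res (s : spec_sec V) : spec_sec U := SpecSec (sec_res s).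

Fact spec_res_zmod_morphism : zmod_morphism spec_res.
Proof. by move=> s t; exact: spec_sec_eq. Qed.

Fact spec_res_monoid_morphism : monoid_morphism spec_res.
Proof. by split=> [|s t]; exact: spec_sec_eq. Qed.

HB.instance Definition _ := GRing.isZmodMorphism.Build
  (spec_sec V) (spec_sec U) spec_res spec_res_zmod_morphism.
HB.instance Definition _ := GRing.isMonoidMorphism.Build
  (spec_sec V) (spec_sec U) spec_res spec_res_monoid_morphism.

End Restrict.

Lemma sfun_irr U (s : spec_sec U) p (h k : oset U p) : sfun s h = sfun s k.
Proof. by rewrite (Prop_irrelevance h k). Qed.

Fact spec_res_id (U : opens spec) (h : U `<=` U) s : spec_res h s = s.
Proof. by apply: spec_sec_eq => p Up; rewrite /=; exact: sfun_irr. Qed.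

Fact spec_res_comp (U V W : opens spec) (h : U `<=` V) (k : V `<=` W)
  (l : U `<=` W) s : spec_res h (spec_res k s) = spec_res l s.
Proof. by apply: spec_sec_eq => p Up; rewrite /=; exact: sfun_irr. Qed.

Definition spec_presheaf : presheaf spec :=
  @Presheaf spec (fun U => spec_sec U) (fun U V h => spec_res h)
    spec_res_id spec_res_comp.

Fact spec_is_sheaf : is_sheaf spec_presheaf.
Proof.
move=> I V U VU cov; split=> [s t st|s st].
  apply: spec_sec_eq => p Up; have [i _ Vip] := cov p Up.
  have := congr1 (fun w : spec_sec (V i) => sfun w Vip) (st i).
  by rewrite /= (sfun_irr s _ Up) (sfun_irr t _ Up).
pose i p (Up : oset U p) := s2val (cid2 (cov p Up)).
have Vi p (Up : oset U p) : oset (V (i p Up)) p.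
  exact: s2valP' (cid2 (cov p Up)).
have st' j k p (Vj : oset (V j) p) (Vk : oset (V k) p) :
    sfun (s j : spec_sec (V j)) Vj = sfun (s k : spec_sec (V k)) Vk.
  have := congr1 (fun w : spec_sec (opensI (V j) (V k)) =>
    sfun w (conj Vj Vk : oset (opensI (V j) (V k)) p)) (st j k).
  by rewrite /= (sfun_irr (s j : spec_sec (V j)) _ Vj)
    (sfun_irr (s k : spec_sec (V k)) _ Vk).
have tP : @locally_fraction U
    (fun p Up => sfun (s (i p Up) : spec_sec (V (i p Up))) (Vi p Up)).
  move=> p Up.
  have [W [a [f [WV Wp sW]]]] := sfunP (s (i p Up) : spec_sec _) (Vi p Up).
  exists W, a, f; split=> // [q /WV/VU//|q Uq Wq].
  have [fq e] := sW q (WV q Wq) Wq; exists fq; rewrite -e; exact: st'.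
exists (SpecSec tP) => j; apply: spec_sec_eq => p Vjp /=; exact: st'.
Qed.

Lemma loc_unit_num (p : spec) a f (fp : mset (compl p) f) :
  invertible (mkfrac a fp) <-> ~ pset p a.
Proof.
have [_ _ pM] := primeI p.
split=> [[x]|pa]; last first.
  exists (mkfrac (S := compl p) f pa); rewrite mkfrac_mul mkfrac1.
  by apply/mkfrac_eq; exists 1; split; [exact: mset1|ring].
have [b [g [gp ->]]] := mkfracP x.
rewrite mkfrac_mul mkfrac1 => /mkfrac_eq[r [rp e]] pa.
have : mset (compl p) (r * (1 * (f * g))).
  by apply: msetM rp _; apply: msetM (mset1 _) _; exact: msetM.
apply; rewrite -e; have -> : r * (a * b * 1) = r * b * a by ring.
exact: pM.
Qed.

Lemma spec_germ_unit (p : spec) (U : opens spec) (s : spec_sec U)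
    (Up : oset U p) :
  @germ_unit _ spec_presheaf p U s <-> invertible (sfun s Up).
Proof.
split=> [[V [VU [Vp [t e]]]]|].
  exists (sfun (t : spec_sec V) Vp).
  have := congr1 (fun w : spec_sec V => sfun w Vp) e.
  by rewrite /= (sfun_irr s _ Up).
have [V [a [f [VU Vp sV]]]] := sfunP s Up.
have [fp -> /loc_unit_num pa] := sV p Up Vp.
pose W := opensI V (basic_open a).
have WU : W `<=` U by move=> q [/VU].
have tP : @locally_fraction W (fun q Wq => mkfrac (S := compl q) f (proj2 Wq)).
  move=> q Wq; exists W, f, a; split=> // q' Wq' _.
  by exists (proj2 Wq').
exists W, WU; split; first by split.
exists (SpecSec tP); apply: spec_sec_eq => q Wq.
rewrite [LHS]sfunM [RHS]sfun1 /=; have [fq ->] := sV q (WU q Wq) (proj1 Wq).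
rewrite mkfrac_mul mkfrac1; apply/mkfrac_eq; exists 1.
by split; [exact: mset1|ring].
Qed.

Fact spec_stalkP (p : spec) : local_stalk spec_presheaf p.
Proof.
have [p0 pD _] := primeI p; split=> [U Up [V [VU [Vp e]]]|U s Up].
  have : (1 : loc (compl p)) = 0.
    exact: (congr1 (fun w : spec_sec V => sfun w Vp) e).
  rewrite mkfrac0 mkfrac1 => /mkfrac_eq[r [rp]].
  by rewrite mul0r mulr0 !mulr1 => r0; apply: rp; rewrite r0.
have [V [a [f [VU Vp sV]]]] := sfunP (s : spec_sec U) Up.
have [fp e] := sV p Up Vp.
have [pa|pa] := pselect (pset p a); [right|left]; apply/(spec_germ_unit _ Up).
  rewrite [sfun _ _]sfunD sfunN sfun1 e mkfrac1 mkfrac_opp mkfrac_add.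
  apply/loc_unit_num; rewrite mul1r mulr1 => pfa; apply: (fp).
  by rewrite -(subrK a f); exact: pD.
by rewrite e; exact/loc_unit_num.
Qed.

Definition Spec : lrspace := LRSpace spec_is_sheaf spec_stalkP.

End StructureSheaf.

Section SpecMap.
Variables (R S : comPzRingType) (u : {rmorphism R -> S}).

Fact preimage_ideal (q : prime_ideal S) : is_ideal (u @^-1` pset q).
Proof.
have [q0 qD qM] := primeI q; split=> [|x y|a x] /=.
- by rewrite rmorph0.
- by rewrite rmorphD; exact: qD.
- by rewrite rmorphM; exact: qM.
Qed.

Fact preimage_prime1 (q : prime_ideal S) : ~ (u @^-1` pset q) 1.
Proof. by rewrite /preimage /= rmorph1; exact: prime1. Qed.

Fact preimage_primeM (q : prime_ideal S) x y : (u @^-1` pset q) (x * y) ->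
  (u @^-1` pset q) x \/ (u @^-1` pset q) y.
Proof. by rewrite /preimage /= rmorphM; exact: primeM. Qed.

Definition spec_fun (q : Spec S) : Spec R :=
  PrimeIdeal (preimage_ideal q) (@preimage_prime1 q) (@preimage_primeM q).

Fact spec_fun_cont : continuous spec_fun.
Proof.
apply/continuousP => _ /zariskiP[E ->]; apply/zariskiP; exists (u @` E).
apply/seteqP; split=> q /= H K; apply: H.
  by move=> x Ex; apply: K; exists x.
by move=> _ [x Ex <-]; exact: K.
Qed.

Lemma compl_preim (q : Spec S) (x : R) :
  mset (compl (spec_fun q)) x -> mset (compl q) (u x).
Proof. by []. Qed.

Section Sharp.
Variable V : opens (Spec R).

Fact sharp_locally_fraction (s : spec_sec V) :
  @locally_fraction _ (preim spec_fun_cont V)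
    (fun q Vq => loc_map (@compl_preim q) (sfun s (p := spec_fun q) Vq)).
Proof.
move=> q Vq; have [W [a [f [WV Wq sW]]]] := sfunP s (p := spec_fun q) Vq.
exists (preim spec_fun_cont W), (u a), (u f); split=> //.
  by move=> q' /WV.
move=> q' Vq' Wq'; have [fq' ->] := sW (spec_fun q') Vq' Wq'.
by exists (compl_preim fq'); rewrite loc_mapE.
Qed.

Definition spec_sharp (s : spec_sec V) : spec_sec (preim spec_fun_cont V) :=
  SpecSec (sharp_locally_fraction s).

Fact spec_sharp_zmod_morphism : zmod_morphism spec_sharp.
Proof. by move=> s t; apply: spec_sec_eq => q Vq; exact: rmorphB. Qed.

Fact spec_sharp_monoid_morphism : monoid_morphism spec_sharp.
Proof.
split=> [|s t]; apply: spec_sec_eq => q Vq; first exact: rmorph1.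
exact: rmorphM.
Qed.

HB.instance Definition _ := GRing.isZmodMorphism.Build
  (spec_sec V) (spec_sec (preim spec_fun_cont V)) spec_sharp
  spec_sharp_zmod_morphism.
HB.instance Definition _ := GRing.isMonoidMorphism.Build
  (spec_sec V) (spec_sec (preim spec_fun_cont V)) spec_sharp
  spec_sharp_monoid_morphism.

End Sharp.

Fact spec_sharp_res (U V : opens (Spec R)) (h : U `<=` V)
    (k : preim spec_fun_cont U `<=` preim spec_fun_cont V) (s : spec_sec V) :
  spec_sharp (spec_res h s) = spec_res k (spec_sharp s).
Proof.
apply: spec_sec_eq => q Uq /=; congr (loc_map _ _); exact: sfun_irr.
Qed.

Fact spec_sharp_local (q : Spec S) (V : opens (Spec R)) (s : sections (Spec R) V) :
  oset V (spec_fun q) ->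
  @germ_unit _ (sheaf (Spec S)) q (preim spec_fun_cont V)
    (spec_sharp (s : spec_sec V)) ->
  germ_unit (spec_fun q) s.
Proof.
move=> Vq /(@spec_germ_unit _ _ _ _ (Vq : oset (preim spec_fun_cont V) q)) H.
apply/(spec_germ_unit _ Vq); move: H => /=.
have [a [f [fq ->]]] := mkfracP (sfun (s : spec_sec V) Vq).
by rewrite loc_mapE => /loc_unit_num qa; exact/loc_unit_num.
Qed.

Definition Spec_map : lrs_hom (Spec S) (Spec R) :=
  @LRSHom (Spec S) (Spec R) spec_fun spec_fun_cont
    (fun V => @spec_sharp V) spec_sharp_res spec_sharp_local.

End SpecMap.

Lemma Spec_map_comp (R S T : comPzRingType) (u : {rmorphism R -> S})
    (v : {rmorphism S -> T}) (w : {rmorphism R -> T}) :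
  (forall a, v (u a) = w a) -> lrs_comp (Spec_map u) (Spec_map v) = Spec_map w.
Proof.
move=> vu.
have E (q : Spec T) : spec_fun u (spec_fun v q) = spec_fun w q.
  by apply: prime_eq; apply/seteqP; split=> a; rewrite /= /preimage /= vu.
apply: lrs_hom_eq => // V W h k s; apply: spec_sec_eq => q Wq /=.
move: (h q Wq) (k q Wq); rewrite /preimage /= => hq kq.
have H (p p' : Spec R) (e : p = p') (Vp : oset V p) (Vp' : oset V p')
    (K : forall x, mset (compl p) x -> mset (compl (spec_fun v q)) (u x))
    (L : forall x, mset (compl p') x -> mset (compl q) (w x)) :
    loc_map (@compl_preim _ _ v q) (loc_map K (sfun (s : spec_sec V) Vp)) =
    loc_map L (sfun (s : spec_sec V) Vp').
  case: _ / e Vp' L => Vp' L; rewrite (sfun_irr (s : spec_sec V) Vp' Vp).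
  have [a [f [fp ->]]] := mkfracP (sfun (s : spec_sec V) Vp).
  rewrite !loc_mapE; apply/mkfrac_eq; exists 1; split; first exact: mset1.
  by rewrite !vu.
exact: (H _ _ (E q)).
Qed.

Definition lrs_iso (X Y : lrspace) : Prop :=
  exists (f : lrs_hom X Y) (g : lrs_hom Y X),
    lrs_comp g f = lrs_id X /\ lrs_comp f g = lrs_id Y.

Definition is_affine (X : lrspace) : Prop :=
  exists R : comPzRingType, lrs_iso X (Spec R).

Definition affine_open (X : lrspace) (U : opens X) : Prop :=
  is_affine (open_lrspace U).

Definition is_scheme (X : lrspace) : Prop :=
  forall x : X, exists U : opens X, oset U x /\ affine_open U.

Definition is_quasiaffine (X : lrspace) : Prop :=
  compact [set: X] /\
  exists (R : comPzRingType) (U : opens (Spec R)), lrs_iso X (open_lrspace U).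

Definition locally_of_finite_type (X Y : lrspace) (f : lrs_hom X Y) : Prop :=
  forall x : X, exists (U : opens X) (V : opens Y)
    (UV : U `<=` preim (hcont f) V),
    [/\ oset U x, affine_open U, affine_open V &
        finite_type_morphism (res (sheaf X) UV \o hsharp f V)].

Definition quasi_compact (X Y : lrspace) (f : lrs_hom X Y) : Prop :=
  forall V : opens Y, compact V -> compact (preim (hcont f) V).

Definition of_finite_type (X Y : lrspace) (f : lrs_hom X Y) : Prop :=
  quasi_compact f /\ locally_of_finite_type f.

Record scheme_over (A : comPzRingType) := SchemeOver {
  scheme :> lrspace;
  schemeP : is_scheme scheme;
  structure_map : lrs_hom scheme (Spec A)
}.

(* Hom_{Sch/A}(Spec A', M), where A' is an A-algebra by [alpha]; morphisms of
   schemes are morphisms of locally ringed spaces. *)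
Definition points (A : comPzRingType) (M : scheme_over A) (A' : comPzRingType)
    (alpha : {rmorphism A -> A'}) : Type :=
  {f : lrs_hom (Spec A') M | lrs_comp (structure_map M) f = Spec_map alpha}.

Section Pullback.
Variables (A : comPzRingType) (M : scheme_over A) (A1 A2 : comPzRingType).
Variables (alpha1 : {rmorphism A -> A1}) (alpha2 : {rmorphism A -> A2}).
Variable u : {rmorphism A1 -> A2}.
Hypothesis ualpha : forall a, u (alpha1 a) = alpha2 a.

Fact points_map_subproof (f : points M alpha1) :
  lrs_comp (structure_map M) (lrs_comp (sval f) (Spec_map u)) = Spec_map alpha2.
Proof. by rewrite lrs_compA (svalP f); exact: Spec_map_comp. Qed.

Definition points_map (f : points M alpha1) : points M alpha2 :=
  exist _ (lrs_comp (sval f) (Spec_map u)) (points_map_subproof f).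

End Pullback.

(* M represents the functor of monogenerators of B (x)_A A' over A'. The last
   clause is the case A' = A, read through b |-> b (x) 1 as a statement about
   monogenerators of B over A. *)
Definition represents_monogenerators (A B : comPzRingType)
    (phi : {rmorphism A -> B}) (M : scheme_over A) : Prop :=
  exists Phi : forall (A' : comPzRingType) (alpha : {rmorphism A -> A'}),
      points M alpha -> tensor phi alpha,
  [/\ forall (A' : comPzRingType) (alpha : {rmorphism A -> A'}),
        set_bij [set: points M alpha]
          [set theta | is_monogenerator (@tensor_inr _ _ _ phi alpha) theta]
          (Phi A' alpha),
      forall (A1 A2 : comPzRingType) (alpha1 : {rmorphism A -> A1})
        (alpha2 : {rmorphism A -> A2}) (u : {rmorphism A1 -> A2})
        (ualpha : forall a, u (alpha1 a) = alpha2 a) (f : points M alpha1),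
        Phi A2 alpha2 (points_map ualpha f) =
        tensor_map ualpha (Phi A1 alpha1 f) &
      exists Psi : points M (idfun : {rmorphism A -> A}) -> B,
        set_bij setT [set theta | is_monogenerator phi theta] Psi /\
        forall f, Phi A idfun f = tensor_inl phi idfun (Psi f)].

Definition represents_generating_tuples (A B : comPzRingType)
    (phi : {rmorphism A -> B}) (k : nat) (M : scheme_over A) : Prop :=
  exists Phi : forall (A' : comPzRingType) (alpha : {rmorphism A -> A'}),
      points M alpha -> k.-tuple (tensor phi alpha),
  [/\ forall (A' : comPzRingType) (alpha : {rmorphism A -> A'}),
        set_bij [set: points M alpha]
          [set theta | is_generating (@tensor_inr _ _ _ phi alpha) theta]
          (Phi A' alpha),
      forall (A1 A2 : comPzRingType) (alpha1 : {rmorphism A -> A1})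
        (alpha2 : {rmorphism A -> A2}) (u : {rmorphism A1 -> A2})
        (ualpha : forall a, u (alpha1 a) = alpha2 a) (f : points M alpha1),
        Phi A2 alpha2 (points_map ualpha f) =
        map_tuple (tensor_map ualpha) (Phi A1 alpha1 f) &
      exists Psi : points M (idfun : {rmorphism A -> A}) -> k.-tuple B,
        set_bij setT [set theta | is_generating phi theta] Psi /\
        forall f, Phi A idfun f = map_tuple (tensor_inl phi idfun) (Psi f)].

(* Main.v *)
Require Import Defs.
From HB Require Import structures.
From mathcomp Require Import all_boot all_order all_algebra.
From mathcomp Require Import perm ring.
From mathcomp Require Import boolp classical_sets functions filter.
From mathcomp Require Import topology_structure subtype_topology compact.
Import Defs.

(** Locally on the spectrum of [A] the algebra [B] has a basis and a dual basis of
    functionals.  Clearing denominators gives a [frame] of [B], whose data are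
    defined over [A] itself ([locally_free_frame]; noetherianity bounds the powers
    that are needed), and which therefore passes to [B (x)_A A'] over every [A']
    ([base_frame]).  A frame also yields a finite dual basis of the projective
    module [B] ([coordinateK]), hence an element of [B (x)_A A'] is the same as a
    family of coordinates in [A'] that satisfies linear equations.

    Generating tuples.  Over a piece of rank [r] the Cayley-Hamilton theorem
    reduces every monomial in [theta_1, ..., theta_k] to monomials of degree less
    than [r] in each variable ([near_span_bounded]).  So the tuple generates iff
    these finitely many monomials span everywhere, iff their maximal minors have
    no common zero ([generating_minors]).  In the affine scheme of
    all [k]-tuples this defines a finite union of basic open sets, which is the
    scheme for generating tuples.

    Monogenerators.  If [theta] is a monogenerator, then over a piece of rank [r]
    its first [r] powers form a basis.  The dual bases glue to functionals [D_i] of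
    [B (x)_A A'], even when the rank varies, since pieces of different ranks are
    disjoint ([monogenerator_dual_powers]).  Conversely such functionals exhibit
    [theta] as a monogenerator, and they are determined by [theta]
    ([dual_powers_unique]).  Therefore monogenerators are the same as pairs of
    [theta] and [D].  The conditions on these pairs are equations, so that they
    define an affine scheme.

    In both cases a functor of families of coordinates cut out by equations is
    represented by the ring of the functions on it that are given by terms
    ([classifying], [mono_universal], [tuple_universal]).  It remains to know that
    morphisms from [Spec A'] to an open subscheme [U] of [Spec R] are the ring
    morphisms [R -> A'] under which the primes of [A'] have preimages in [U].
    This follows from [hom_ring_of_hom], which rests on the computation of the
    sections over basic open sets ([section_on_basic]), and from the universal
    property of open subspaces ([incl_lift], [open_incl_mono]).  Basic open sets
    are affine ([spec_lam_open_immersion]), and compactness is obtained by letting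
    ultrafilters converge to the prime of the elements that vanish almost
    everywhere ([limit_prime]). *)

Set Implicit Arguments.
Unset Strict Implicit.
Unset Printing Implicit Defensive.

Import GRing.Theory.
Local Open Scope classical_set_scope.
Local Open Scope quotient_scope.
Local Open Scope ring_scope.

(** * Prime ideals *)

Section Primes.
Variable R : comPzRingType.
Implicit Types (I : set R) (p : prime_ideal R).

Definition avoids (S : mulset R) I := is_ideal I /\ forall x, I x -> ~ mset S x.

Lemma ideal_union_chain (S : mulset R) I0 (C : set (set R)) : avoids S I0 ->
  C `<=` [set I | avoids S I /\ I0 `<=` I] -> total_on C subset ->
  avoids S (I0 `|` \bigcup_(I in C) I).
Proof.
move=> aI0 CS tot; have [[I00 I0D I0M] I0S] := aI0.
split; last first.
  by move=> x [/I0S//|[I /CS[[_ IS] _]]]; exact: IS.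
split=> [|x y|a x]; first by left.
  move=> [Ix|[I CI Ix]] [Iy|[J CJ Jy]].
  - by left; exact: I0D.
  - right; exists J => //; have [[[_ JD _] _] sJ] := CS _ CJ.
    by apply: JD => //; exact: sJ.
  - right; exists I => //; have [[[_ ID _] _] sI] := CS _ CI.
    by apply: ID => //; exact: sI.
  - right; have [[[_ ID _] _] _] := CS _ CI; have [[[_ JD _] _] _] := CS _ CJ.
    have [IJ|JI] := tot I J CI CJ.
      by exists J => //; apply: JD => //; exact: IJ.
    by exists I => //; apply: ID => //; exact: JI.
move=> [Ix|[I CI Ix]]; first by left; exact: I0M.
by right; exists I => //; have [[[_ _ IM] _] _] := CS _ CI; exact: IM.
Qed.

(** Among the ideals that contain [I] and miss the multiplicative set [S], a
    maximal one is prime: if neither [x] nor [y] lies in it, adjoining either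
    element produces a member of [S], and the product of the two members shows
    that [x * y] does not lie in it. *)
Lemma prime_avoiding (S : mulset R) I : avoids S I ->
  exists p, I `<=` pset p /\ forall x, pset p x -> ~ mset S x.
Proof.
move=> aI.
pose T := {J : set R | avoids S J /\ I `<=` J}.
pose le (J K : T) := `[< sval J `<=` sval K >].
have [|||C Ctot|[M [[MI MS] IM]] Mmax] := @Zorn T le.
- by move=> J; exact/asboolP.
- move=> J K L /asboolP JK /asboolP KL; apply/asboolP.
  exact: subset_trans KL.
- move=> [J PJ] [K PK] /asboolP/= JK /asboolP/= KJ.
  have E : J = K by apply/seteqP.
  by case: _ / E PK {JK KJ} => PK; rewrite (Prop_irrelevance PJ PK).
- pose D := [set J | exists H : avoids S J /\ I `<=` J, C (exist _ J H)].
  have DS : D `<=` [set J | avoids S J /\ I `<=` J] by move=> J [].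
  have Dtot : total_on D subset.
    by move=> J K [HJ CJ] [HK CK]; have [/asboolP|/asboolP] := Ctot _ _ CJ CK;
      [left|right].
  have aU := ideal_union_chain aI DS Dtot.
  have TU : avoids S (I `|` \bigcup_(I in D) I) /\
    I `<=` (I `|` \bigcup_(I in D) I) by split => //; exact: subsetUl.
  exists (exist (fun J => avoids S J /\ I `<=` J) _ TU) => -[J HJ] CJ.
  by apply/asboolP => x Jx; right; exists J => //; exists HJ.
have [M0 MD MM] := MI.
have adj x : ~ M x -> exists m a, M m /\ mset S (m + a * x).
  move=> Mx; apply: contrapT => H; apply: Mx.
  pose N := [set z | exists m a, M m /\ z = m + a * x].
  have MN : M `<=` N by move=> m Mm; exists m, 0; rewrite mul0r addr0.
  have NI : avoids S N.
    split; last by move=> z [m [a [Mm ->]]] Sz; apply: H; exists m, a.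
    split=> [|_ _ [m [a [Mm ->]]] [n [b [Mn ->]]]|c _ [m [a [Mm ->]]]].
    - exact: MN.
    - by exists (m + n), (a + b); split; [exact: MD|ring].
    - by exists (c * m), (c * a); split; [exact: MM|ring].
  have NT : avoids S N /\ I `<=` N by split => //; exact: subset_trans MN.
  have NN : le (exist (fun J => avoids S J /\ I `<=` J) M (conj (conj MI MS) IM))
      (exist (fun J => avoids S J /\ I `<=` J) N NT).
    exact/asboolP.
  have -> : M = N by have [] := Mmax _ NN.
  by exists 0, 1; rewrite mul1r add0r.
have M1 : ~ M 1 by move/MS; apply; exact: mset1.
have Mpr x y : M (x * y) -> M x \/ M y.
  move=> Mxy; apply: contrapT => /not_orP[/adj[m [a [Mm Sx]]]].
  move=> /adj[n [b [Mn Sy]]]; apply: (MS _ _ (msetM Sx Sy)).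
  have -> : (m + a * x) * (n + b * y) =
    (n + b * y) * m + (a * x * n + a * b * (x * y)) by ring.
  by apply: (MD); [exact: MM|apply: (MD); exact: MM].
by exists (PrimeIdeal MI M1 Mpr).
Qed.

Lemma powers_prime p f : ~ pset p f -> forall n, ~ pset p (f ^+ n).
Proof.
move=> pf; elim=> [|n ih]; first by rewrite expr0; exact: prime1.
by rewrite exprS => /primeM[].
Qed.

Lemma primeX p f n : pset p (f ^+ n) -> pset p f.
Proof. by apply: contraPP => /powers_prime. Qed.

Lemma prime0 p : pset p 0.
Proof. by have [] := primeI p. Qed.

Lemma primeD p x y : pset p x -> pset p y -> pset p (x + y).
Proof. by have [_ + _] := primeI p; apply. Qed.

Lemma primeMl p a x : pset p x -> pset p (a * x).
Proof. by have [_ _] := primeI p; apply. Qed.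

Lemma primeMr p a x : pset p x -> pset p (x * a).
Proof. by rewrite mulrC; exact: primeMl. Qed.

Lemma prime_sum p (J : Type) (r : seq J) (P : pred J) (F : J -> R) :
  (forall j, P j -> pset p (F j)) -> pset p (\sum_(j <- r | P j) F j).
Proof.
move=> H; elim/big_ind: _ => //; first exact: prime0.
by move=> x y; exact: primeD.
Qed.

(** The compactness argument behind the local to global steps: if no power
    of [f] were in [I], a prime containing [I] and avoiding the powers of [f]
    would contradict the hypothesis. *)
Lemma ideal_power I f : is_ideal I ->
  (forall p, ~ pset p f -> exists x, I x /\ ~ pset p x) -> exists n, I (f ^+ n).
Proof.
move=> II H; apply: contrapT => nI.
have [|p [Ip pf]] := @prime_avoiding (powers f) I.
  by split=> // x Ix [n xE]; apply: nI; exists n; rewrite -xE.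
have pf' : ~ pset p f by move=> /pf; apply; exists 1%N; rewrite expr1.
by have [x [/Ip]] := H p pf'.
Qed.

Lemma ideal_unit I : is_ideal I ->
  (forall p, exists x, I x /\ ~ pset p x) -> I 1.
Proof.
move=> II H; have [|n] := @ideal_power I 1 II; first by move=> p _.
by rewrite expr1n.
Qed.

Lemma span_ideal (J : finType) (m : J -> R) :
  is_ideal [set x | exists c : J -> R, x = \sum_j c j * m j].
Proof.
split=> [|_ _ [c ->] [d ->]|a _ [c ->]].
- by exists (fun=> 0); rewrite big1 // => j _; rewrite mul0r.
- exists (fun j => c j + d j); rewrite -big_split /=.
  by apply: eq_bigr => j _; rewrite mulrDl.
- exists (fun j => a * c j); rewrite big_distrr /=.
  by apply: eq_bigr => j _; rewrite mulrA.
Qed.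

Lemma span_mem (J : finType) (m : J -> R) j :
  exists c : J -> R, m j = \sum_j c j * m j.
Proof.
exists (fun i => (i == j)%:R); rewrite (bigD1 j) //= eqxx mul1r big1 ?addr0 //.
by move=> i /negbTE ->; rewrite mul0r.
Qed.

Lemma partition_of_unity (J : finType) (m : J -> R) :
  (forall p, exists j, ~ pset p (m j)) -> exists c : J -> R, \sum_j c j * m j = 1.
Proof.
move=> H; have [|c ->] := ideal_unit (span_ideal m); last by exists c.
by move=> p; have [j pj] := H p; exists (m j); split=> //; exact: span_mem.
Qed.

Lemma partition_cover (J : finType) (m c : J -> R) p :
  \sum_j c j * m j = 1 -> exists j, ~ pset p (m j).
Proof.
move=> e; apply: contrapT => /forallNP H; apply: (@prime1 _ p); rewrite -e.
by apply: prime_sum => j _; apply: primeMl; exact: contrapT (H j).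
Qed.

Lemma partition_powers (J : finType) (m c : J -> R) (K : J -> nat) :
  \sum_j c j * m j = 1 -> exists d : J -> R, \sum_j d j * m j ^+ K j = 1.
Proof.
move=> e; apply: partition_of_unity => p; have [j pj] := partition_cover p e.
by exists j; exact: powers_prime.
Qed.

End Primes.

(** * Sections of the structure sheaf *)

Section ToLoc.
Variables (R : comPzRingType) (S : mulset R).

Definition to_loc (a : R) : loc S := mkfrac a (mset1 S).

Fact to_loc_zmod_morphism : zmod_morphism to_loc.
Proof.
move=> a b; rewrite /to_loc mkfrac_opp mkfrac_add; apply/mkfrac_eq; exists 1.
by split; [exact: mset1|ring].
Qed.

Fact to_loc_monoid_morphism : monoid_morphism to_loc.
Proof.
split=> // a b; rewrite /to_loc mkfrac_mul; apply/mkfrac_eq; exists 1.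
by split; [exact: mset1|ring].
Qed.

HB.instance Definition _ := GRing.isZmodMorphism.Build R (loc S) to_loc
  to_loc_zmod_morphism.
HB.instance Definition _ := GRing.isMonoidMorphism.Build R (loc S) to_loc
  to_loc_monoid_morphism.

Lemma to_locM a b : to_loc (a * b) = to_loc a * to_loc b.
Proof. exact: rmorphM. Qed.

Lemma to_loc1 : to_loc 1 = 1.
Proof. by []. Qed.

Lemma to_locP a b : to_loc a = to_loc b <-> exists r, mset S r /\ r * a = r * b.
Proof.
by split=> [/mkfrac_eq|] [r [Sr]]; rewrite ?mulr1 => e; last apply/mkfrac_eq;
  exists r; rewrite ?mulr1.
Qed.

Lemma mkfracK a s (Ss : mset S s) : mkfrac a Ss * to_loc s = to_loc a.
Proof.
rewrite /to_loc mkfrac_mul; apply/mkfrac_eq; exists 1.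
by split; [exact: mset1|ring].
Qed.

Lemma to_loc_inv s : mset S s -> exists y, to_loc s * y = 1.
Proof.
move=> Ss; exists (mkfrac 1 Ss); rewrite mulrC mkfracK.
exact: rmorph1.
Qed.

Lemma to_loc_reg s x y : mset S s -> x * to_loc s = y * to_loc s -> x = y.
Proof.
move=> /to_loc_inv[z sz] e; have := congr1 ( *%R^~ z) e.
by rewrite -!mulrA sz !mulr1.
Qed.

Lemma mkfrac_unique a s (Ss : mset S s) x :
  x * to_loc s = to_loc a -> x = mkfrac a Ss.
Proof. by move=> e; apply: (to_loc_reg Ss); rewrite e mkfracK. Qed.

Lemma loc_num (x : loc S) : exists a s, mset S s /\ x * to_loc s = to_loc a.
Proof.
by have [a [s [Ss ->]]] := mkfracP x; exists a, s; split=> //; exact: mkfracK.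
Qed.

End ToLoc.

Section Sections.
Variable R : comPzRingType.
Implicit Types (U V W : opens (prime_ideal R)) (p q : prime_ideal R).

Lemma open_basic U p : oset U p ->
  exists f, ~ pset p f /\ basic_open f `<=` U.
Proof.
case: U => U /= /zariskiP[E ->] /= /existsNP[f /not_implyP[Ef pf]].
by exists f; split=> // q /= qf /(_ f Ef).
Qed.

Lemma open_from_basic (U : set (prime_ideal R)) :
  (forall p, U p -> exists f, ~ pset p f /\ basic_open f `<=` U) -> open U.
Proof.
move=> H; apply/zariskiP; exists [set f | basic_open f `<=` U].
apply/seteqP; split=> p /= => [/H[f [pf fU]] /(_ f fU)//|].
by move=> /existsNP[f /not_implyP[fU pf]]; exact: fU.
Qed.

Lemma to_loc_eq_powers w a b :
  (forall q, ~ pset q w -> to_loc (compl q) a = to_loc (compl q) b) ->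
  exists n, w ^+ n * a = w ^+ n * b.
Proof.
move=> H; have [||n] := @ideal_power R [set x | x * a = x * b] w; last by exists n.
  split=> [|x y /= e e'|c x /= e]; first by rewrite /= !mul0r.
    by rewrite !mulrDl e e'.
  by rewrite -!mulrA e.
by move=> p /H/to_locP[r [pr e]]; exists r.
Qed.

Lemma to_loc_eq a b :
  (forall q, to_loc (compl q) a = to_loc (compl q) b) -> a = b.
Proof.
move=> H; have [n] := @to_loc_eq_powers 1 a b (fun q _ => H q).
by rewrite expr1n !mul1r.
Qed.

(** Multiplying numerator and denominator of a local fraction by an element [e]
    with [D(e)] inside the neighbourhood makes the denominator itself define a
    basic open set on which the fraction is valid. *)
Lemma sfun_local U (s : spec_sec U) p (Up : oset U p) :
  exists a f, [/\ ~ pset p f, basic_open f `<=` U &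
    forall q (Uq : oset U q), ~ pset q f ->
      sfun s Uq * to_loc (compl q) f = to_loc (compl q) a].
Proof.
have [V [a [g [VU Vp sV]]]] := sfunP s Up.
have [e [pe eV]] := open_basic Vp; have [gp _] := sV p Up Vp.
exists (e * a), (e * g); split=> [/primeM[]//|q /= qeg|q Uq qeg].
  by apply/VU/eV => /= qe; apply: qeg; exact: primeMr.
have qe : ~ pset q e by move=> /primeMr; exact.
have [gq ->] := sV q Uq (eV q qe).
by rewrite !to_locM mulrCA mkfracK.
Qed.

(** The elements [c] for which [s] is a fraction [a / c ^+ n] on all of [D(c)]
    form an ideal, so that [ideal_power] applies.  For the sum: if [s] is
    [a / c ^+ n] on [D(c)] and [b / d ^+ m] on [D(d)], where
    [a * d ^+ m = b * c ^+ n] after enlarging the exponents, and if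
    [(c + d) ^+ (n + m) = x * c ^+ n + y * d ^+ m], then [s] is
    [(x * a + y * b) / (c + d) ^+ (n + m)] on [D(c + d)]. *)
Lemma section_on_basic U (s : spec_sec U) f : basic_open f `<=` U ->
  exists n a, forall q (Uq : oset U q), ~ pset q f ->
    sfun s Uq * to_loc (compl q) (f ^+ n) = to_loc (compl q) a.
Proof.
move=> fU.
pose Q c n a := forall q (Uq : oset U q), ~ pset q c ->
    sfun s Uq * to_loc (compl q) (c ^+ n) = to_loc (compl q) a.
pose I := [set c | basic_open c `<=` U /\ exists n a, Q c n a].
have II : is_ideal I.
  split=> [|c d [cU [n [a ca]]] [dU [m [b db]]]|e c [cU [n [a ca]]]].
  + split; first by move=> p /= /(_ (prime0 p)).
    by exists 0%N, 0 => q Uq /(_ (prime0 q)).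
  + split.
      move=> p /= pcd; have [pc|pc] := pselect (pset p c); last exact: cU.
      by apply: dU => pd; apply: pcd; exact: primeD.
    have [q|N eN] := @to_loc_eq_powers (c * d) (a * d ^+ m) (b * c ^+ n).
      move=> qcd; have qc : ~ pset q c by move=> /primeMr; exact.
      have qd : ~ pset q d by move=> /primeMl; exact.
      rewrite !to_locM -(ca q (cU q qc) qc) -(db q (cU q qc) qd).
      by rewrite mulrAC.
    have ca' q (Uq : oset U q) : ~ pset q c ->
        sfun s Uq * to_loc (compl q) (c ^+ (n + N)) = to_loc (compl q) (a * c ^+ N).
      by move=> qc; rewrite exprD !to_locM mulrA ca.
    have db' q (Uq : oset U q) : ~ pset q d ->
        sfun s Uq * to_loc (compl q) (d ^+ (m + N)) = to_loc (compl q) (b * d ^+ N).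
      by move=> qd; rewrite exprD !to_locM mulrA db.
    have e : a * c ^+ N * d ^+ (m + N) = b * d ^+ N * c ^+ (n + N).
      rewrite !exprD; transitivity ((c * d) ^+ N * (a * d ^+ m)).
        by rewrite exprMn; ring.
      by rewrite eN exprMn; ring.
    move: ca' db' e; set n' := (n + N)%N; set m' := (m + N)%N.
    set a' := a * _; set b' := b * _ => ca' db' e.
    (* Every monomial of the binomial expansion is divisible by one of the two
       powers. *)
    have [x [y xy]] : exists x y, (c + d) ^+ (n' + m') = x * c ^+ n' + y * d ^+ m'.
      elim: n' m' {ca' db' e} => [|n0 ih] m0.
        by exists ((c + d) ^+ m0), 0; rewrite expr0 mulr1 mul0r addr0.
      elim: m0 => [|m0 [x [y e]]].
        by exists 0, ((c + d) ^+ n0.+1); rewrite addn0 expr0 mulr1 mul0r add0r.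
      have [x' [y' e']] := ih m0.+1.
      exists (x' + d * x), (c * y' + y).
      have -> : (c + d) ^+ (n0.+1 + m0.+1) =
          c * (c + d) ^+ (n0 + m0.+1) + d * (c + d) ^+ (n0.+1 + m0).
        by rewrite addSn exprS mulrDl addSnnS.
      by rewrite e e' !exprS; ring.
    exists (n' + m')%N, (x * a' + y * b') => q Uq qcd.
    have [qc|qc] := pselect (pset q c).
      have qd : ~ pset q d by move=> qd; apply: qcd; exact: primeD.
      have qdm : mset (compl q) (d ^+ m') by exact: powers_prime.
      apply: (to_loc_reg qdm); rewrite mulrAC db' // -!to_locM; congr to_loc.
      by rewrite xy mulrDr mulrDl -[x * a' * _]mulrA e; ring.
    have qcn : mset (compl q) (c ^+ n') by exact: powers_prime.
    apply: (to_loc_reg qcn); rewrite mulrAC ca' // -!to_locM; congr to_loc.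
    by rewrite xy mulrDr mulrDl -[y * b' * _]mulrA -e; ring.
  + split; first by move=> p /= pec; apply: cU => /= pc; apply: pec; exact: primeMl.
    exists n, (e ^+ n * a) => q Uq qec.
    have qc : ~ pset q c by move=> qc; apply: qec; exact: primeMl.
    by rewrite exprMn !to_locM mulrCA ca.
have [p pf|k [_ [n [a H]]]] := @ideal_power R I f II.
  have [a [c [pc cU ca]]] := sfun_local s (fU p pf).
  by exists c; split=> //; split=> //; exists 1%N, a; rewrite /Q expr1.
exists (k * n)%N, a => q Uq qf; rewrite exprM; apply: H.
exact: powers_prime.
Qed.

Definition const_sec U (a : R) : spec_sec U := SpecSec (@sec_const R U a).

Lemma const_secE U a q (Uq : oset U q) : sfun (const_sec U a) Uq = to_loc (compl q) a.
Proof. by []. Qed.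

Fact const_sec_zmod_morphism U : zmod_morphism (const_sec U).
Proof.
by move=> a b; apply: spec_sec_eq => q Uq; exact: to_loc_zmod_morphism.
Qed.

Fact const_sec_monoid_morphism U : monoid_morphism (const_sec U).
Proof.
by split=> [|a b]; apply: spec_sec_eq => q Uq; [|exact: to_locM].
Qed.

HB.instance Definition _ U := GRing.isZmodMorphism.Build R (spec_sec U) (const_sec U)
  (@const_sec_zmod_morphism U).
HB.instance Definition _ U := GRing.isMonoidMorphism.Build R (spec_sec U) (const_sec U)
  (@const_sec_monoid_morphism U).

Lemma const_secB U a b : const_sec U (a - b) = const_sec U a - const_sec U b.
Proof. exact: rmorphB. Qed.

Lemma const_secM U a b : const_sec U (a * b) = const_sec U a * const_sec U b.
Proof. exact: rmorphM. Qed.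

Lemma const_sec1 U : const_sec U 1 = 1.
Proof. exact: rmorph1. Qed.

Lemma global_section U (s : spec_sec U) : (forall q, oset U q) ->
  exists a, s = const_sec U a.
Proof.
move=> UT; have [|n [a sa]] := @section_on_basic U s 1; first by move=> q _.
exists a; apply: spec_sec_eq => q Uq; rewrite const_secE -(sa q Uq (@prime1 _ q)).
by rewrite expr1n mulr1.
Qed.

Lemma const_sec_inj U : (forall q, oset U q) -> injective (const_sec U).
Proof.
move=> UT a b e; apply: to_loc_eq => q.
by have := congr1 (fun s : spec_sec U => sfun s (UT q)) e.
Qed.

End Sections.

(** * Morphisms between affine schemes *)

Definition full_open (X : topologicalType) : opens X := Opens (@openT X).

Lemma invertible_morph (R S : comPzRingType) (u : {rmorphism R -> S}) x :
  invertible x -> invertible (u x).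
Proof. by move=> [y xy]; exists (u y); rewrite -rmorphM xy rmorph1. Qed.

Lemma germ_unit_morph (X Y : lrspace) (f : lrs_hom X Y) (x : X) (V : opens Y)
    (s : sections Y V) :
  germ_unit (f x) s -> germ_unit x (hsharp f V s).
Proof.
move=> [W [WV [Wx su]]].
have k : preim (hcont f) W `<=` preim (hcont f) V by move=> y /WV.
exists (preim (hcont f) W), k; split=> //.
by rewrite -(hsharp_res WV); exact: invertible_morph.
Qed.

Lemma to_loc_unit (R : comPzRingType) (p : prime_ideal R) (a : R) :
  invertible (to_loc (compl p) a) <-> ~ pset p a.
Proof. exact: loc_unit_num. Qed.

Section Adjunction.
Variables (R S : comPzRingType) (f : lrs_hom (Spec S) (Spec R)).

Let T := full_open (Spec R).
Let pull (a : R) : spec_sec (preim (hcont f) T) := hsharp f T (const_sec T a).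

(** The map on global sections, read through [R = O(Spec R)]. *)
Definition ring_of_hom (a : R) : S :=
  sval (cid (global_section (pull a) (fun q => I))).

Lemma ring_of_homE a : pull a = const_sec _ (ring_of_hom a).
Proof. exact: (svalP (cid (global_section (pull a) (fun q => I)))). Qed.

Fact ring_of_hom_zmod_morphism : zmod_morphism ring_of_hom.
Proof.
move=> a b; apply: (@const_sec_inj _ (preim (hcont f) T)) => //.
rewrite -ring_of_homE const_secB -!ring_of_homE /pull const_secB.
exact: rmorphB.
Qed.

Fact ring_of_hom_monoid_morphism : monoid_morphism ring_of_hom.
Proof.
split=> [|a b]; apply: (@const_sec_inj _ (preim (hcont f) T)) => //.
  by rewrite -ring_of_homE /pull !const_sec1; exact: rmorph1.
rewrite -ring_of_homE const_secM -!ring_of_homE /pull const_secM.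
exact: rmorphM.
Qed.

HB.instance Definition _ := GRing.isZmodMorphism.Build R S ring_of_hom
  ring_of_hom_zmod_morphism.
HB.instance Definition _ := GRing.isMonoidMorphism.Build R S ring_of_hom
  ring_of_hom_monoid_morphism.

(** The maps on stalks are local: [a] is outside [f q] iff the germ of [a] at
    [f q] is a unit, iff the germ of its pullback at [q] is a unit. *)
Lemma ring_of_hom_point q : f q = spec_fun ring_of_hom q.
Proof.
have H a : ~ pset (f q) a <-> ~ pset q (ring_of_hom a).
  have Tq : oset T (f q) by [].
  have Tq' : oset (preim (hcont f) T) q by [].
  split=> [/to_loc_unit u|/to_loc_unit u]; apply/to_loc_unit.
    have /germ_unit_morph : @germ_unit _ (sheaf (Spec R)) (f q) T (const_sec T a).
      exact/(spec_germ_unit _ Tq).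
    by move=> /(@spec_germ_unit _ _ _ _ Tq'); rewrite -/(pull a) ring_of_homE.
  have : @germ_unit _ (sheaf (Spec R)) (f q) T (const_sec T a).
    apply: hlocal => //; apply/(spec_germ_unit _ Tq').
    by rewrite -/(pull a) ring_of_homE.
  by move=> /(@spec_germ_unit _ _ _ _ Tq).
apply: prime_eq; apply/seteqP; split=> a fa; apply: contrapT => /=.
  by move=> /H; exact.
by move=> /H; exact.
Qed.

(** Near a point a section is a fraction [a / g] with [g] invertible, so that its
    pullback is determined by those of the global sections [a] and [g]. *)
Lemma hom_ring_of_hom : f = Spec_map ring_of_hom.
Proof.
apply: lrs_hom_eq => [q|V W h k s]; first exact: ring_of_hom_point.
apply: spec_sec_eq => q Wq /=.
have Vq : oset V (f q) := h q Wq.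
have Vq' : oset V (spec_fun ring_of_hom q) := k q Wq.
have [a [g [qg gV sV]]] := sfun_local (s : spec_sec V) Vq.
have gq : ~ pset (spec_fun ring_of_hom q) g by rewrite -ring_of_hom_point.
pose D : opens (Spec R) := basic_open g.
have gT : D `<=` T by [].
have gV' : D `<=` V by [].
have kV : preim (hcont f) D `<=` preim (hcont f) V by move=> x /gV'.
have kT : preim (hcont f) D `<=` preim (hcont f) T by [].
have E : res (sheaf (Spec S)) kV (hsharp f V s) *
    res (sheaf (Spec S)) kT (pull g) = res (sheaf (Spec S)) kT (pull a).
  rewrite -(hsharp_res gV') -!(hsharp_res gT) -rmorphM; congr (hsharp _ _ _).
  by apply: spec_sec_eq => p gp; exact: sV.
have := congr1 (fun t : spec_sec (preim (hcont f) D) =>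
  sfun t (qg : oset (preim (hcont f) D) q)) E.
rewrite !ring_of_homE [LHS]sfunM /= => {}E.
rewrite (sfun_irr (s : spec_sec V) _ Vq').
rewrite (mkfrac_unique (gq : mset (compl _) g) (sV _ Vq' gq)) loc_mapE.
rewrite -[LHS](sfun_irr _ (kV q qg)).
exact: mkfrac_unique.
Qed.

End Adjunction.

Lemma Spec_map_inj (R S : comPzRingType) (u v : {rmorphism R -> S}) :
  Spec_map u = Spec_map v -> forall a, u a = v a.
Proof.
move=> e a.
have sharpE (w : {rmorphism R -> S}) :
    spec_sharp w (const_sec (full_open (Spec R)) a) = const_sec _ (w a).
  apply: spec_sec_eq => q Tq; rewrite /= /to_loc loc_mapE.
  by apply/mkfrac_eq; exists 1; split; [exact: mset1|rewrite rmorph1].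
have ringE (w : {rmorphism R -> S}) : ring_of_hom (Spec_map w) a = w a.
  apply: (@const_sec_inj _ (preim (hcont (Spec_map w)) (full_open (Spec R)))) => //.
  by rewrite -ring_of_homE -sharpE.
by rewrite -(ringE u) -(ringE v) e.
Qed.

(** * Open immersions *)

Section Inclusion.
Variables (X : lrspace) (U : opens X).
Local Notation US := (open_lrspace U).

Definition cut (V : opens X) : opens US := Opens (@open_cut X U V).

Lemma in_U (x : US) : oset U (set_val x).
Proof. exact: set_valP. Qed.

Fact incl_cont : continuous (set_val : US -> X).
Proof. by apply/continuousP => V oV; exists V. Qed.

Fact incl_sub (V : opens X) : img (preim incl_cont V) `<=` V.
Proof. by move=> _ [x Vx <-]. Qed.

Fact incl_res (V W : opens X) (h : V `<=` W)
    (k : preim incl_cont V `<=` preim incl_cont W) s :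
  (res (sheaf X) (@incl_sub V) (res (sheaf X) h s) : sections US _) =
  res (sheaf US) k (res (sheaf X) (@incl_sub W) s : sections US _).
Proof.
have l : img (preim incl_cont V) `<=` W by move=> x /incl_sub/h.
by rewrite /= !(res_comp _ _ l).
Qed.

Fact incl_local (x : US) (V : opens X) (s : sections X V) : oset V (set_val x) ->
  @germ_unit _ (sheaf US) x _ (res (sheaf X) (@incl_sub V) s) ->
  germ_unit (set_val x) s.
Proof.
move=> _ [W [WV [Wx]]].
have l : img W `<=` V by move=> _ [y /WV Wy <-].
by rewrite /= (res_comp _ _ l) => u; exists (img W), l; split=> //; exists x.
Qed.

Definition open_incl : lrs_hom US X :=
  @LRSHom US X set_val incl_cont (fun V => res (sheaf X) (@incl_sub V))
    incl_res incl_local.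

Section Lift.
Variables (Y : lrspace) (f : lrs_hom Y X).
Hypothesis fU : forall y, oset U (f y).

Definition lift_fun (y : Y) : US := SigSub (mem_set (fU y)).

Fact lift_cont : continuous lift_fun.
Proof.
by apply/continuousP => _ [V oV <-]; exact: (iffLR (continuousP f) (hcont f) V oV).
Qed.

Fact lift_sub (V : opens US) : preim lift_cont V `<=` preim (hcont f) (img V).
Proof. by move=> y Vy; exists (lift_fun y). Qed.

Definition lift_sharp (V : opens US) :
    {rmorphism sections US V -> sections Y (preim lift_cont V)} :=
  res (sheaf Y) (@lift_sub V) \o hsharp f (img V).

Fact lift_res (V W : opens US) (h : V `<=` W)
    (k : preim lift_cont V `<=` preim lift_cont W) s :
  lift_sharp V (res (sheaf US) h s) = res (sheaf Y) k (lift_sharp W s).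
Proof.
have k' : preim (hcont f) (img V) `<=` preim (hcont f) (img W).
  by move=> y /(img_sub h).
have l : preim lift_cont V `<=` preim (hcont f) (img W) by move=> y /lift_sub/k'.
by rewrite /= (hsharp_res _ k') !(res_comp _ _ l).
Qed.

Fact lift_local (y : Y) (V : opens US) (s : sections US V) :
  oset V (lift_fun y) -> germ_unit y (lift_sharp V s) -> germ_unit (lift_fun y) s.
Proof.
move=> Vy [W [WV [Wy u]]].
have l : W `<=` preim (hcont f) (img V) by move=> z /WV/lift_sub.
have [|V' [V'V [V'y u']]] := @hlocal _ _ f y (img V) s (@lift_sub V y Vy).
  by exists W, l; split=> //; move: u; rewrite /= (res_comp _ _ l).
have C : cut V' `<=` V by move=> z /V'V/img_val.
exists (cut V'), C; split=> //.
have D : img (cut V') `<=` V' by exact: incl_sub.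
by rewrite /= -(res_comp D V'V); exact: invertible_morph.
Qed.

Definition open_lift : lrs_hom Y US := LRSHom lift_res lift_local.

Lemma incl_lift : lrs_comp open_incl open_lift = f.
Proof.
apply: lrs_hom_eq => // V W h k s.
have l : preim (hcont f) (img (preim incl_cont V)) `<=` preim (hcont f) V.
  by move=> y /incl_sub.
rewrite /= /lrs_comp_sharp /= (hsharp_res _ l).
rewrite (res_comp _ _ (h : W `<=` preim lift_cont (preim incl_cont V))).
have h' : W `<=` preim (hcont f) (img (preim incl_cont V)).
  by move=> y /h Vy; exact: lift_sub.
by rewrite (res_comp _ _ h') (res_comp _ _ (k : W `<=` preim (hcont f) V)).
Qed.

End Lift.

(** A section over [V] is also a section over the image of [V] in [X], where the
    composite with the inclusion determines its pullback. *)
Lemma lift_unique (Y : lrspace) (g : lrs_hom Y US)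
  (H : forall y, oset U (lrs_comp open_incl g y)) : g = open_lift H.
Proof.
apply: lrs_hom_eq => [y|V W h k s]; first exact: val_inj.
have VV : V `<=` preim incl_cont (img V) by move=> x Vx; exists x.
have VV' : preim incl_cont (img V) `<=` V by move=> x /img_val.
have l : preim (hcont g) (preim incl_cont (img V)) `<=` preim (hcont g) V.
  by move=> y /VV'.
have E : (res (sheaf X) (@incl_sub (img V)) s : sections US _) =
    res (sheaf US) VV' s.
  by rewrite /= (Prop_irrelevance (@incl_sub _) (img_sub VV')).
have h'' : W `<=` preim (hcont g) (preim incl_cont (img V)) by move=> y /h/VV.
have k' : W `<=` preim (hcont (lrs_comp open_incl g)) (img V) by move=> y /h''.
rewrite /= /lrs_comp_sharp /= E (hsharp_res _ l).
rewrite [RHS](res_comp _ _ k').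
by rewrite (res_comp _ _ h'') (res_comp _ _ h).
Qed.

Lemma open_incl_mono (Y : lrspace) (g g' : lrs_hom Y US) :
  lrs_comp open_incl g = lrs_comp open_incl g' -> g = g'.
Proof.
move=> e; have H y : oset U (lrs_comp open_incl g y) by exact: in_U.
have H' y : oset U (lrs_comp open_incl g' y) by exact: in_U.
rewrite (lift_unique H) (lift_unique H').
by case: _ / e H' => H'; rewrite (Prop_irrelevance H H').
Qed.

End Inclusion.

Lemma res_bij (X : topologicalType) (F : presheaf X) (U V : opens X)
  (UV : U `<=` V) (VU : V `<=` U) : bijective (res F UV).
Proof.
exists (res F VU) => s.
  by rewrite (res_comp _ _ (@subset_refl _ V)) res_id.
by rewrite (res_comp _ _ (@subset_refl _ U)) res_id.
Qed.

Lemma rmorph_inverse (R S : comPzRingType) (f : {rmorphism R -> S}) :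
  bijective f -> {g : {rmorphism S -> R} | cancel f g /\ cancel g f}.
Proof.
move=> fb; have [g [fg gf]] : {g : S -> R | cancel f g /\ cancel g f}.
  by apply: cid; case: fb => g fg gf; exists g.
have gB : zmod_morphism g.
  by move=> x y; apply: (can_inj fg); rewrite rmorphB !gf.
have gM : monoid_morphism g.
  split=> [|x y]; first by apply: (can_inj fg); rewrite rmorph1 gf.
  by apply: (can_inj fg); rewrite rmorphM !gf.
pose m1 := GRing.isZmodMorphism.Build S R g gB.
pose m2 := GRing.isMonoidMorphism.Build S R g gM.
pose G : {rmorphism S -> R} := HB.pack g m1 m2.
by exists G.
Qed.

Section IsoCriterion.
Variables (X Y : lrspace) (f : lrs_hom X Y) (g : Y -> X).
Hypotheses (gK : cancel f g) (fK : cancel g f) (gc : continuous g).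
Hypothesis fb : forall V : opens Y, bijective (hsharp f V).

Let sub (U : opens X) : preim (hcont f) (preim gc U) `<=` U.
Proof. by move=> x; rewrite /= /preimage /= gK. Qed.

Let inv (V : opens Y) := sval (rmorph_inverse (fb V)).

Let invK (V : opens Y) : cancel (inv V) (hsharp f V).
Proof. by case: (svalP (rmorph_inverse (fb V))). Qed.

Let finj (V : opens Y) : injective (hsharp f V).
Proof. exact: bij_inj (fb V). Qed.

Let sharp (U : opens X) :
    {rmorphism sections X U -> sections Y (preim gc U)} :=
  inv (preim gc U) \o res (sheaf X) (@sub U).

Let sharpK U s : hsharp f (preim gc U) (sharp U s) = res (sheaf X) (@sub U) s.
Proof. exact: invK. Qed.

Let sharp_res (U V : opens X) (h : U `<=` V)
  (k : preim gc U `<=` preim gc V) s :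
  sharp U (res (sheaf X) h s) = res (sheaf Y) k (sharp V s).
Proof.
apply: finj; rewrite sharpK.
have l : preim (hcont f) (preim gc U) `<=` preim (hcont f) (preim gc V).
  by move=> x /k.
rewrite (hsharp_res _ l) sharpK.
have m : preim (hcont f) (preim gc U) `<=` V by move=> x /sub/h.
by rewrite !(res_comp _ _ m).
Qed.

Let sharp_local (y : Y) (U : opens X) (s : sections X U) : oset U (g y) ->
  germ_unit y (sharp U s) -> germ_unit (g y) s.
Proof.
move=> Uy; rewrite -{1}(fK y) => /germ_unit_morph; rewrite sharpK.
move=> [W [WU [Wy u]]].
have l : W `<=` U by move=> x /WU/sub.
by exists W, l; split=> //; move: u; rewrite (res_comp _ _ l).
Qed.

(** The inverse morphism uses the inverses of the maps on sections. *)
Lemma iso_criterion : lrs_iso Y X.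
Proof.
exists (LRSHom sharp_res sharp_local), f; split; apply: lrs_hom_eq => //.
- move=> V W h k s; apply: finj.
  have h' : W `<=` preim gc (preim (hcont f) V) by [].
  have k' : W `<=` V by [].
  have l : preim (hcont f) W `<=` preim (hcont f) (preim gc (preim (hcont f) V)).
    by move=> x /h'.
  have m : preim (hcont f) W `<=` preim (hcont f) V by move=> x /k'.
  rewrite /= /lrs_comp_sharp [LHS]/= (res_comp _ _ h') (hsharp_res _ l) sharpK.
  by rewrite (res_comp _ _ k') (hsharp_res _ m) (res_comp _ _ m).
- move=> U W h k s.
  have h' : W `<=` preim (hcont f) (preim gc U) by [].
  have k' : W `<=` U by [].
  rewrite /= /lrs_comp_sharp [LHS]/= (res_comp _ _ h') sharpK.
  by rewrite !(res_comp _ _ k').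
Qed.

End IsoCriterion.

(** [h] identifies [Y] with the open subspace [U] of [X]. *)
Definition open_immersion (Y X : lrspace) (h : lrs_hom Y X) (U : opens X) :=
  [/\ forall y, oset U (h y), forall x, oset U x -> exists y, h y = x,
      injective h, forall V : opens Y, open (h @` V) &
      forall W : opens X, W `<=` U -> bijective (hsharp h W)].

Lemma lift_open_immersion (Y X : lrspace) (h : lrs_hom Y X) (U W : opens X)
    (hU : forall y, oset U (h y)) :
  W `<=` U -> open_immersion h W -> open_immersion (open_lift hU) (cut U W).
Proof.
move=> WU [hW Wh hinj hopen hbij]; split=> [//|x Wx|y y' e|V|V VW].
- by have [y e] := Wh _ Wx; exists y; apply: val_inj.
- by apply: hinj; exact: (congr1 val e).
- exists (h @` V) => //; apply/seteqP; split=> [x [y Vy e]|_ [y Vy <-]] /=.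
    by exists y => //; apply: val_inj.
  by exists y.
have imgVW : img V `<=` W by exact: subset_trans (img_sub VW) (@incl_sub _ U W).
have sub : preim (hcont h) (img V) `<=` preim (@lift_cont X U Y h hU) V.
  by move=> y [x Vx e]; rewrite /= /preimage /= (_ : lift_fun hU y = x) //;
    apply: val_inj.
exact: bij_comp (res_bij _ _ sub) (hbij _ imgVW).
Qed.

Lemma open_immersion_iso (Y X : lrspace) (h : lrs_hom Y X) (U : opens X) :
  (forall x, oset U x) -> open_immersion h U -> lrs_iso X Y.
Proof.
move=> UT [_ Uh hinj hopen hbij].
have [g gK] : {g : X -> Y | cancel g h}.
  exists (fun x => sval (cid (Uh x (UT x)))) => x.
  by case: (cid (Uh x (UT x))).
have hK : cancel h g by move=> y; apply: hinj; rewrite gK.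
have gc : continuous g.
  apply/continuousP => V oV; suff -> : g @^-1` V = h @` V by exact: (hopen (Opens oV)).
  apply/seteqP; split=> [x Vx|_ [y Vy <-]]; first by exists (g x).
  by rewrite /preimage /= hK.
apply: (iso_criterion hK gK gc) => V; apply: hbij => x _; exact: UT.
Qed.

Lemma open_immersion_affine (R : comPzRingType) (X : lrspace)
    (h : lrs_hom (Spec R) X) (U : opens X) :
  open_immersion h U -> is_affine (open_lrspace U).
Proof.
move=> hU; have H y : oset U (h y) by case: hU.
have := lift_open_immersion H (@subset_refl _ U) hU.
by move=> /open_immersion_iso iso; exists R; apply: iso => x; exact: in_U.
Qed.

(** * Basic open sets are affine *)

Section BasicOpen.
Variables (R : comPzRingType) (f : R).
Local Notation S := (powers f).
Local Notation lam := (@to_loc R S).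
Local Notation lamM := (@to_loc R S : {rmorphism R -> loc S}).

Lemma powers_self n : mset S (f ^+ n).
Proof. by exists n. Qed.

Lemma loc_powers (x : loc S) : exists a n, x * lam (f ^+ n) = lam a.
Proof. by have [a [_ [[n ->] e]]] := loc_num x; exists a, n. Qed.

Lemma prime_lam (q : prime_ideal (loc S)) n : ~ pset q (lam (f ^+ n)).
Proof.
move=> qf; have [y fy] := to_loc_inv (powers_self n).
by apply: (@prime1 _ q); rewrite -fy; exact: primeMr.
Qed.

Lemma prime_num (q : prime_ideal (loc S)) x n a : x * lam (f ^+ n) = lam a ->
  pset q x <-> pset q (lam a).
Proof.
move=> <-; split=> [|/primeM[//|/prime_lam//]].
exact: primeMr.
Qed.

Section Above.
Variable p : prime_ideal R.
Hypothesis pf : ~ pset p f.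

(** The fractions whose numerator lies in [p] form the prime that lies over
    [p]; whether a numerator lies in [p] does not depend on its choice, because
    [f] is not in [p]. *)
Let ext : set (loc S) := [set x | exists a n, x * lam (f ^+ n) = lam a /\ pset p a].

Let extP x a n : x * lam (f ^+ n) = lam a -> ext x <-> pset p a.
Proof.
move=> xa; split=> [[b [m [xb pb]]]|pa]; last by exists a, n.
have : lam (a * f ^+ m) = lam (b * f ^+ n).
  by rewrite !to_locM -xa -xb mulrAC.
move=> /to_locP[_ [[k ->] e]].
have : pset p (f ^+ k * (a * f ^+ m)) by rewrite e; apply/primeMl/primeMr.
by move=> /primeM[/primeX//|/primeM[//|/primeX//]].
Qed.

Let ext_ideal : is_ideal ext.
Proof.
split=> [|x y [a [n [xa pa]]] [b [m [yb pb]]]|c x [a [n [xa pa]]]].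
- by exists 0, 0%N; rewrite mul0r rmorph0; split=> //; exact: prime0.
- exists (a * f ^+ m + b * f ^+ n), (n + m)%N; split.
    rewrite [RHS]rmorphD /= !to_locM -xa -yb exprD to_locM.
    by ring.
  by apply: primeD; exact: primeMr.
- have [d [k cd]] := loc_powers c.
  exists (d * a), (k + n)%N; split; last exact: primeMl.
  by rewrite exprD !to_locM -xa -cd; ring.
Qed.

Let ext_prime1 : ~ ext 1.
Proof.
by move/(@extP 1 1 0); rewrite mul1r expr0 => /(_ erefl); exact: prime1.
Qed.

Let ext_primeM x y : ext (x * y) -> ext x \/ ext y.
Proof.
have [a [n xa]] := loc_powers x; have [b [m yb]] := loc_powers y.
have xyab : x * y * lam (f ^+ (n + m)) = lam (a * b).
  by rewrite exprD !to_locM -xa -yb; ring.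
by move=> /(extP xyab)/primeM[pa|pb]; [left; apply/(extP xa)|right; apply/(extP yb)].
Qed.

Lemma prime_above : exists q, spec_fun lamM q = p.
Proof.
exists (PrimeIdeal ext_ideal ext_prime1 ext_primeM); apply: prime_eq.
apply/seteqP; split=> a; rewrite /= /preimage /=.
  by move/(@extP _ a 0%N); apply; rewrite expr0 mulr1.
by move=> pa; exists a, 0%N; rewrite expr0 mulr1.
Qed.

End Above.

Lemma spec_lam_inj : injective (spec_fun lamM).
Proof.
move=> q q' e; apply: prime_eq; apply/seteqP.
have H a : pset q (lam a) <-> pset q' (lam a).
  by rewrite -[X in X <-> _]/(pset (spec_fun lamM q) a) e.
by split=> x; have [a [n xa]] := loc_powers x;
  move=> /(prime_num _ xa)/H qa; apply/(prime_num _ xa).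
Qed.

(** The image of [D(a / f ^+ n)] is [D(a * f)]. *)
Lemma spec_lam_open (V : opens (Spec (loc S))) : open (Spec_map lamM @` V).
Proof.
apply: open_from_basic => _ [q Vq <-].
have [x [qx xV]] := open_basic Vq; have [a [n xa]] := loc_powers x.
exists (a * f); split=> [|p /= paf].
  move=> /primeM[|/(@prime_lam q 1)//].
  by move/(prime_num _ xa).
have [|q' e] := @prime_above p; first by move/primeMl; exact.
exists q' => //; apply: xV => /= /(prime_num _ xa) qa; apply: paf.
by rewrite -e; exact: primeMr.
Qed.

(** The local rings at [q] and at its image are the same, since the powers of
    [f] are already invertible in the latter.  This is the injectivity; the
    surjectivity is in [lam_fraction], uniformly near [q]. *)
Lemma loc_lam_eq (q : prime_ideal (loc S)) a b :
  to_loc (compl q) (lam a) = to_loc (compl q) (lam b) ->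
  to_loc (compl (spec_fun lamM q)) a = to_loc (compl (spec_fun lamM q)) b.
Proof.
move=> /to_locP[r [qr e]]; have [c [n rc]] := loc_powers r.
have : lam (c * a) = lam (c * b) by rewrite !to_locM -rc mulrAC e mulrAC.
move=> /to_locP[_ [[m ->] e']]; apply/to_locP; exists (f ^+ m * c).
split; last by rewrite -!mulrA.
by apply: msetM; [exact: prime_lam|move/(prime_num _ rc)].
Qed.

Lemma lam_fraction (V : opens (Spec (loc S))) (t : spec_sec V) q (Vq : oset V q) :
  exists a g, [/\ ~ pset q (lam g), basic_open (lam g) `<=` V &
    forall q' (Vq' : oset V q'), ~ pset q' (lam g) ->
      sfun t Vq' * to_loc (compl q') (lam g) = to_loc (compl q') (lam a)].
Proof.
have [x [y [qy yV txy]]] := sfun_local t Vq.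
have [a [n xa]] := loc_powers x; have [b [m yb]] := loc_powers y.
have E q' : pset q' (lam (b * f ^+ n)) -> pset q' y.
  rewrite to_locM => /primeM[qb|/prime_lam//].
  exact/(prime_num q' yb).
exists (a * f ^+ m), (b * f ^+ n); split=> [/E//|q' /= qy'|q' Vq' qy'].
  by apply: yV => /= /(prime_num q' yb) qb; apply: qy'; rewrite to_locM; exact: primeMr.
have {}qy' : ~ pset q' y.
  by move=> /(prime_num q' yb) qb; apply: qy'; rewrite to_locM; exact: primeMr.
rewrite !(@to_locM _ S) -xa -yb !(to_locM (compl q')) !mulrA txy //.
by rewrite mulrAC.
Qed.

Section SharpBij.
Variable W : opens (Spec R).
Hypothesis Wf : W `<=` basic_open f.
Local Notation V := (preim (spec_fun_cont (u := lamM)) W).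

Lemma spec_lam_sharp_inj : injective (@spec_sharp _ _ lamM W).
Proof.
move=> s t e; apply: spec_sec_eq => p Wp.
have [q qp] := prime_above (Wf Wp); move: Wp; rewrite -qp => Wq.
have := congr1 (fun z : spec_sec V => sfun z (Wq : oset V q)) e => /=.
have [a [g [gq ->]]] := mkfracP (sfun s Wq).
have [b [h [hq ->]]] := mkfracP (sfun t Wq).
rewrite !loc_mapE => E; apply/mkfrac_unique/(to_loc_reg gq).
rewrite mulrAC mkfracK -!to_locM; apply: loc_lam_eq.
rewrite !to_locM -(mkfracK (lam a) (compl_preim gq)) E.
by rewrite mulrAC mkfracK.
Qed.

(** The preimage of [t] is defined one local ring at a time: [F p z] says that
    [z] is the element of the local ring at [p] that corresponds to the value of
    [t] at the prime over [p]. *)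
Lemma spec_lam_sharp_surj (t : spec_sec V) : exists s, spec_sharp lamM s = t.
Proof.
pose F p (z : loc (compl p)) := forall q (Vq : oset V q), spec_fun lamM q = p ->
  exists a g (gp : mset (compl p) g), z = mkfrac a gp /\
   sfun t Vq * to_loc (compl q) (lam g) = to_loc (compl q) (lam a).
have FE p (Wp : oset W p) : exists z, F p z.
  have [q qp] := prime_above (Wf Wp).
  have Vq : oset V q by rewrite /= /preimage /= qp.
  have [a [g [qg _ tg]]] := lam_fraction t Vq.
  have gp : mset (compl p) g by rewrite -qp.
  exists (mkfrac a gp) => q' Vq' q'p; exists a, g, gp; split=> //.
  by apply: tg; move: gp; rewrite -q'p.
pose z p Wp := sval (cid (FE p Wp)).
have zF p Wp : F p (z p Wp) by exact: svalP (cid (FE p Wp)).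
have zE q (Vq : oset V q) a g (qg : mset (compl (spec_fun lamM q)) g) :
    sfun t Vq * to_loc (compl q) (lam g) = to_loc (compl q) (lam a) ->
    z (spec_fun lamM q) Vq = mkfrac a qg.
  move=> tg; have [a' [g' [qg' [-> tg']]]] := zF (spec_fun lamM q) Vq q Vq erefl.
  apply/mkfrac_unique/(to_loc_reg qg').
  rewrite mulrAC mkfracK -!to_locM; apply: loc_lam_eq.
  by rewrite !to_locM -tg -tg' mulrAC.
have zP : @locally_fraction _ W z.
  move=> p Wp; have [q qp] := prime_above (Wf Wp); move: Wp; rewrite -qp => Vq.
  have [a [g [qg gV tg]]] := lam_fraction t Vq.
  exists (opensI W (basic_open g)), a, g; split=> // [p' []//|p' Wp' [_ pg']].
  have [q' qp'] := prime_above (Wf Wp'); move: Wp' pg'; rewrite -qp' => Vq' qg'.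
  by exists qg'; apply: zE; exact: tg.
exists (SpecSec zP); apply: spec_sec_eq => q Vq /=.
have [a [g [qg gV tg]]] := lam_fraction t Vq.
rewrite (zE q Vq a g qg (tg q Vq qg)) loc_mapE; apply: esym.
exact/mkfrac_unique/tg.
Qed.

End SharpBij.

Lemma bijectiveP (T T' : Type) (g : T -> T') :
  injective g -> (forall y, exists x, g x = y) -> bijective g.
Proof.
move=> gi gs; pose h y := sval (cid (gs y)).
have hK : cancel h g by move=> y; exact: svalP (cid (gs y)).
by exists h => // x; apply: gi; rewrite hK.
Qed.

Lemma spec_lam_open_immersion :
  open_immersion (Spec_map lamM) (basic_open f : opens (Spec R)).
Proof.
split=> [q|p pf||V|W Wf].
- by have := @prime_lam q 1.
- exact: prime_above.
- exact: spec_lam_inj.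
- exact: spec_lam_open.
- apply: bijectiveP; first exact: spec_lam_sharp_inj.
  exact: spec_lam_sharp_surj.
Qed.

End BasicOpen.

(** * Generated subalgebras *)

Section Adjoin.
Variables (A B : comPzRingType) (phi : {rmorphism A -> B}) (k : nat).
Variable theta : k.-tuple B.

Definition monomial (e : 'I_k -> nat) : B := \prod_(i < k) tnth theta i ^+ e i.

Definition adjoin : set B := [set b | exists p : seq (A * {ffun 'I_k -> nat}),
  b = \sum_(u <- p) phi u.1 * monomial u.2].

Lemma adjoinP : is_generating phi theta <-> forall b, adjoin b.
Proof. by []. Qed.

Lemma monomialD (e e' : 'I_k -> nat) :
  monomial (fun i => e i + e' i)%N = monomial e * monomial e'.
Proof. by rewrite -big_split; apply: eq_bigr => i _; rewrite exprD. Qed.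

Lemma adjoin_term a (e : 'I_k -> nat) : adjoin (phi a * monomial e).
Proof.
exists [:: (a, [ffun i => e i])]; rewrite big_seq1; congr (_ * _).
by apply: eq_bigr => i _; rewrite ffunE.
Qed.

Lemma adjoin0 : adjoin 0.
Proof. by exists [::]; rewrite big_nil. Qed.

Lemma adjoinD x y : adjoin x -> adjoin y -> adjoin (x + y).
Proof. by move=> [p ->] [q ->]; exists (p ++ q); rewrite big_cat. Qed.

Lemma adjoin_sum (J : Type) (r : seq J) (P : pred J) (F : J -> B) :
  (forall j, P j -> adjoin (F j)) -> adjoin (\sum_(j <- r | P j) F j).
Proof.
by move=> H; elim/big_ind: _ => //; [exact: adjoin0|move=> *; exact: adjoinD].
Qed.

Lemma adjoinM x y : adjoin x -> adjoin y -> adjoin (x * y).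
Proof.
move=> [p ->] [q ->]; rewrite big_distrlr; apply: adjoin_sum => u _.
apply: adjoin_sum => v _; have := adjoin_term (u.1 * v.1) (fun i => u.2 i + v.2 i)%N.
by rewrite monomialD rmorphM mulrACA.
Qed.

Lemma adjoin_base a : adjoin (phi a).
Proof.
have := adjoin_term a (fun=> 0%N); by rewrite /monomial big1 ?mulr1.
Qed.

Lemma adjoinX x n : adjoin x -> adjoin (x ^+ n).
Proof.
move=> Ax; elim: n => [|n ih]; last by rewrite exprS; exact: adjoinM.
by rewrite expr0 -(rmorph1 phi); exact: adjoin_base.
Qed.

Lemma adjoin_gen i : adjoin (tnth theta i).
Proof.
have := adjoin_term 1 (fun j => nat_of_bool (j == i)); rewrite rmorph1 mul1r /monomial.
rewrite (bigD1 i) //= eqxx expr1 big1 ?mulr1 // => j /negbTE ->.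
by rewrite expr0.
Qed.

Lemma adjoin_prod (J : Type) (r : seq J) (P : pred J) (F : J -> B) :
  (forall j, P j -> adjoin (F j)) -> adjoin (\prod_(j <- r | P j) F j).
Proof.
move=> H; elim/big_ind: _ => //; last by move=> *; exact: adjoinM.
by rewrite -(rmorph1 phi); exact: adjoin_base.
Qed.

End Adjoin.

(** * Compactness of spectra *)

(** An ultrafilter [F] on a spectrum converges to the prime of the elements that
    vanish at [F]-almost all points, and this prime lies in every finite union of
    basic open sets that belongs to [F]. *)
Section LimitPrime.
Variables (R : comPzRingType) (F : set_system (Spec R)).
Hypotheses (FF : ProperFilter F) (Fdec : forall D, F D \/ F (~` D)).

Let lim : set R := [set a | F [set q : Spec R | pset q a]].

Fact limit_ideal : is_ideal lim.
Proof.
split=> [|x y Fx Fy|a x]; rewrite /lim /=.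
- by apply: filterS (@filterT _ F _) => q _; exact: prime0.
- by apply: filterS2 Fx Fy => q; exact: primeD.
- by apply: filterS => q; exact: primeMl.
Qed.

Fact limit_prime1 : ~ lim 1.
Proof.
move=> F1; apply: (@filter_not_empty _ F); apply: filterS F1 => q.
exact: prime1.
Qed.

Fact limit_primeM x y : lim (x * y) -> lim x \/ lim y.
Proof.
move=> Fxy; have [|Fx] := Fdec [set q : Spec R | pset q x]; first by left.
right; apply: filterS2 Fxy Fx => q /= /primeM[|//].
by move=> qx /(_ qx).
Qed.

Definition limit_prime : Spec R :=
  PrimeIdeal limit_ideal limit_prime1 limit_primeM.

Lemma limit_prime_basic a : ~ pset limit_prime a <-> F (basic_open a).
Proof.
split=> [La|Fa La]; first by have [] := Fdec [set q : Spec R | pset q a].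
by apply: (@filter_not_empty _ F); apply: filterS2 Fa La => q /=.
Qed.

Lemma limit_prime_cvg (V : opens (Spec R)) : oset V limit_prime -> F V.
Proof.
move=> /open_basic[f [/limit_prime_basic Ff fV]].
by apply: filterS Ff.
Qed.

(** The limit prime is contained in every cluster point, and an open set that
    contains a prime contains all smaller ones. *)
Lemma limit_prime_cluster (V : opens (Spec R)) (v : Spec R) :
  cluster F v -> oset V v -> oset V limit_prime.
Proof.
move=> Fv /open_basic[f [vf fV]]; apply: fV => /=; apply/limit_prime_basic.
have [//|Fn] := Fdec (basic_open f).
have [|q [qn qf]] := Fv _ (basic_open f : set (Spec R)) Fn; last by case: (qn qf).
apply: open_nbhs_nbhs; split=> //; exact: opensP.
Qed.

Lemma limit_prime_finite (J : finType) (m : J -> R) :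
  F [set p | exists j, ~ pset p (m j)] -> exists j, ~ pset limit_prime (m j).
Proof.
move=> Fm; apply: contrapT => /forallNP H.
have {}H j : F [set q : Spec R | pset q (m j)] by exact: contrapT (H j).
have K : F [set q : Spec R | forall j, pset q (m j)] by exact: filter_forall.
by apply: (@filter_not_empty _ F); apply: filterS2 Fm K => q [j qj] /(_ j).
Qed.

End LimitPrime.

(** * Open subschemes of an affine scheme over [A] *)

Lemma lrs_comp_idl (X Y : lrspace) (g : lrs_hom X Y) : lrs_comp (lrs_id Y) g = g.
Proof.
apply: lrs_hom_eq => // V W h k s.
have l : preim (hcont g) (preim (hcont (lrs_id Y)) V) `<=` preim (hcont g) V by [].
rewrite /= /lrs_comp_sharp /= (hsharp_res _ l).
by rewrite (res_comp _ _ (h : W `<=` preim (hcont g) (preim (hcont (lrs_id Y)) V)))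
  (res_comp _ _ k).
Qed.

Lemma lrs_comp_idr (X Y : lrspace) (g : lrs_hom X Y) : lrs_comp g (lrs_id X) = g.
Proof.
apply: lrs_hom_eq => // V W h k s.
rewrite /= /lrs_comp_sharp /=.
by rewrite (res_comp _ _ (h : W `<=` preim (hcont (lrs_id X)) (preim (hcont g) V)))
  (res_comp _ _ k).
Qed.

Section OpenSubscheme.
Variables (A R : comPzRingType) (iota : {rmorphism A -> R}).
Variable U : opens (Spec R).
Local Notation US := (open_lrspace U).

Lemma open_basic_affine (f : R) : basic_open f `<=` U ->
  affine_open (cut U (basic_open f)).
Proof.
move=> fU; have [H _ _ _ _] := @spec_lam_open_immersion R f.
have hU q : oset U (Spec_map (@to_loc R (powers f) : {rmorphism R -> _}) q).
  exact/fU/H.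
have := lift_open_immersion hU fU (@spec_lam_open_immersion R f).
exact: open_immersion_affine.
Qed.

Lemma open_is_scheme : is_scheme US.
Proof.
move=> x; have [f [xf fU]] := open_basic (in_U x).
by exists (cut U (basic_open f)); split; [exact: xf|exact: open_basic_affine].
Qed.

Definition open_scheme : scheme_over A :=
  SchemeOver open_is_scheme (lrs_comp (Spec_map iota) (open_incl U)).

(** Composition with the inclusion and passage to global sections identify the
    [A']-points of the open subscheme [U] with the morphisms [R -> A'] over [A]
    under which the primes of [A'] have their preimages in [U]. *)
Section Points.
Variables (A' : comPzRingType) (alpha : {rmorphism A -> A'}).

Definition point_morph (f : points open_scheme alpha) : {rmorphism R -> A'} :=
  ring_of_hom (lrs_comp (open_incl U) (sval f)).

Lemma point_morphE f :
  lrs_comp (open_incl U) (sval f) = Spec_map (point_morph f).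
Proof. exact: hom_ring_of_hom. Qed.

Lemma point_morph_base f a : point_morph f (iota a) = alpha a.
Proof.
have := svalP f; rewrite -lrs_compA point_morphE => e.
rewrite -[LHS]/((point_morph f \o iota : {rmorphism A -> A'}) a).
by apply: Spec_map_inj; rewrite -e; apply: esym; exact: Spec_map_comp.
Qed.

Lemma point_morph_open f q : oset U (spec_fun (point_morph f) q).
Proof. by rewrite -ring_of_hom_point; exact: in_U. Qed.

Lemma point_morph_inj f f' : (forall a, point_morph f a = point_morph f' a) -> f = f'.
Proof.
move=> e; have {}e : point_morph f = point_morph f' by exact: rmorphism_eq.
have E : sval f = sval f' by apply: open_incl_mono; rewrite !point_morphE e.
case: f f' E {e} => f Hf [f' Hf'] /= E; case: _ / E Hf' => Hf'.
by rewrite (Prop_irrelevance Hf Hf').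
Qed.

Lemma point_morph_surj (v : {rmorphism R -> A'}) :
  (forall a, v (iota a) = alpha a) -> (forall q, oset U (spec_fun v q)) ->
  exists f, forall a, point_morph f a = v a.
Proof.
move=> va vU; have H : lrs_comp (structure_map open_scheme)
    (open_lift (f := Spec_map v) vU) = Spec_map alpha.
  by rewrite /= -lrs_compA incl_lift; exact: Spec_map_comp.
pose g : points open_scheme alpha :=
  exist (fun f => lrs_comp (structure_map open_scheme) f = Spec_map alpha) _ H.
exists g; apply: Spec_map_inj.
by rewrite -point_morphE /= incl_lift.
Qed.

End Points.

Lemma point_morph_natural (A1 A2 : comPzRingType) (alpha1 : {rmorphism A -> A1})
    (alpha2 : {rmorphism A -> A2}) (u : {rmorphism A1 -> A2})
    (ualpha : forall a, u (alpha1 a) = alpha2 a) (f : points open_scheme alpha1) a :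
  point_morph (points_map ualpha f) a = u (point_morph f a).
Proof.
rewrite -[RHS]/((u \o point_morph f : {rmorphism R -> A2}) a).
apply: Spec_map_inj; rewrite -point_morphE /= lrs_compA point_morphE.
exact: Spec_map_comp.
Qed.

Lemma open_scheme_affine : (forall p, oset U p) -> is_affine open_scheme.
Proof.
move=> UT; exists R; exists (open_incl U), (open_lift (f := lrs_id _) UT).
split; last exact: incl_lift.
by apply: open_incl_mono; rewrite lrs_compA incl_lift lrs_comp_idl lrs_comp_idr.
Qed.

Section QuasiAffine.
Variables (J : finType) (m : J -> R).
Hypothesis UE : forall p, oset U p <-> exists j, ~ pset p (m j).

(** The limit of an ultrafilter on [U], with the position of its image in
    [Spec A]: both compactness statements below are read off from it. *)
Lemma ultra_limit (F : set_system US) : UltraFilter F ->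
  exists x : US, F --> x /\ forall (W : opens (Spec A)) v,
    cluster (spec_fun iota \o set_val @ F) v -> oset W v ->
    oset W (structure_map open_scheme x).
Proof.
move=> FU; have FF : ProperFilter F by exact: ultra_proper.
have Fdec (T : Type) (g : US -> T) (D : set T) : (g @ F) D \/ (g @ F) (~` D).
  exact: (in_ultra_setVsetC (g @^-1` D) FU).
have GF : ProperFilter (set_val @ F : set_system (Spec R)).
  exact: fmap_proper_filter.
have HF : ProperFilter (spec_fun iota \o set_val @ F : set_system (Spec A)).
  exact: fmap_proper_filter.
pose p := limit_prime GF (@Fdec _ set_val).
have Up : oset U p.
  apply/UE/limit_prime_finite.
  have H (x : US) : exists j, ~ pset (set_val x) (m j) by apply/UE; exact: in_U.
  exact: (filterS (fun x _ => H x) (@filterT _ F _)).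
exists (SigSub (mem_set Up)); split.
  move=> D; rewrite nbhsE => -[_ [[V oV <-] Vp] VD].
  by apply: filterS VD _; apply: (@limit_prime_cvg _ _ GF (@Fdec _ set_val) (Opens oV)).
move=> W v Hv Wv.
have := @limit_prime_cluster _ _ HF (@Fdec _ _) W v Hv Wv.
congr (oset W _).
exact: prime_eq.
Qed.

Lemma open_scheme_quasiaffine : is_quasiaffine open_scheme.
Proof.
split; last first.
  by exists R, U, (lrs_id _), (lrs_id _); split; exact: lrs_comp_idl.
rewrite compact_ultra => F FU _; have [x [Fx _]] := ultra_limit FU.
by exists x.
Qed.

Lemma open_scheme_quasicompact : quasi_compact (structure_map open_scheme).
Proof.
move=> V Vc; rewrite compact_ultra => F FU FV.
have [x [Fx xV]] := ultra_limit FU; exists x; split=> //.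
have FF : ProperFilter F by exact: ultra_proper.
have [v [Vv Hv]] := Vc (spec_fun iota \o set_val @ F) _ FV.
exact: xV Hv Vv.
Qed.

End QuasiAffine.

(** The sections over [D(f)] are generated over [R] by [1 / f]. *)
Lemma open_scheme_locally_finite_type :
  finite_type_morphism iota -> locally_of_finite_type (structure_map open_scheme).
Proof.
move=> [k [theta gen]] x; have [f [xf fU]] := open_basic (in_U x).
pose V : opens (Spec A) := basic_open 1.
have UV : cut U (basic_open f) `<=` preim (hcont (structure_map open_scheme)) V.
  by move=> y _; exact: (@prime1 _ (spec_fun iota (set_val y))).
exists (cut U (basic_open f)), V, UV; split=> //; first exact: open_basic_affine.
- have [H _ _ _ _] := @spec_lam_open_immersion A 1.
  exact: open_immersion_affine (@spec_lam_open_immersion A 1).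
set W := img (cut U (basic_open f)).
set psi := (_ \o _ : {rmorphism _ -> _}).
have Wf p : oset W p -> ~ pset p f by move=> [y yf <-].
have psi_const a : psi (const_sec V a) = const_sec W (iota a) :> spec_sec W.
  apply: spec_sec_eq => q Wq /=; rewrite /to_loc loc_mapE.
  by apply/mkfrac_eq; exists 1; split; [exact: mset1|rewrite rmorph1].
have invP : @locally_fraction _ W (fun p Wp => mkfrac (S := compl p) 1 (Wf p Wp)).
  by move=> p Wp; exists W, 1, f; split=> // q Wq _; exists (Wf q Wq).
pose fi : spec_sec W := SpecSec invP.
pose th : k.+1.-tuple (spec_sec W) := [tuple of fi :: map_tuple (const_sec W) theta].
exists k.+1, th => s; rewrite -[X in exists _, X = _]/(s : spec_sec W).
have [n [a sa]] : exists n a, s = const_sec W a * fi ^+ n.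
  have [|n [a sa]] := @section_on_basic _ W s f.
    by move=> q qf; exists (SigSub (mem_set (fU q qf))).
  exists n, a; apply: spec_sec_eq => q Wq; rewrite sfunM.
  have qfn : mset (compl q) (f ^+ n) by apply: powers_prime; exact: (Wf q Wq).
  apply: (to_loc_reg qfn); rewrite sa; last exact: (Wf q Wq).
  have -> : sfun (fi ^+ n) Wq = sfun fi Wq ^+ n.
    by elim: n {sa qfn} => [//|n ih]; rewrite !exprS -ih.
  rewrite const_secE -mulrA rmorphXn -exprMn /= mkfracK to_loc1 expr1n.
  by rewrite mulr1.
rewrite sa; apply: (@adjoinM _ _ psi _ th); last first.
  by apply: adjoinX; exact: (adjoin_gen psi th ord0).
have [p ->] := gen a.
rewrite [const_sec W _](raddf_sum (const_sec W)).
apply: adjoin_sum => u _.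
rewrite [X in adjoin _ _ X](rmorphM (const_sec W)) /= rmorph_prod.
apply: adjoinM; first by rewrite -psi_const; exact: adjoin_base.
apply: adjoin_prod => i _; rewrite rmorphXn; apply: adjoinX.
have := adjoin_gen psi th (lift ord0 i).
by rewrite tnthS tnth_map.
Qed.

End OpenSubscheme.

(** * Tensor products *)

Section TensorFacts.
Variables (A B C : comPzRingType).
Variables (phi : {rmorphism A -> B}) (psi : {rmorphism A -> C}).
Local Notation T := (tensor phi psi).
Local Notation inl := (tensor_inl phi psi).
Local Notation inr := (tensor_inr phi psi).

Fact tensor_inl_zmod_morphism : zmod_morphism inl.
Proof.
have D b b' : inl (b + b') = inl b + inl b'.
  apply: etrans (esym (tclassD _ _ _ _)).
  by apply/tclassP; exact: TAddl.
by move=> b b'; apply/eqP; rewrite eq_sym subr_eq -D subrK.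
Qed.

Fact tensor_inl_monoid_morphism : monoid_morphism inl.
Proof.
split=> [//|b b']; apply: etrans (esym (tclassM _ _ _ _)).
by rewrite /tmul /= mulr1.
Qed.

HB.instance Definition _ := GRing.isZmodMorphism.Build B T inl
  tensor_inl_zmod_morphism.
HB.instance Definition _ := GRing.isMonoidMorphism.Build B T inl
  tensor_inl_monoid_morphism.

Lemma tensor_inlM b b' : inl (b * b') = inl b * inl b'.
Proof. exact: rmorphM. Qed.

Lemma tensor_inrM c c' : inr (c * c') = inr c * inr c'.
Proof. exact: rmorphM. Qed.

Lemma tensor_base a : inl (phi a) = inr (psi a).
Proof.
apply/tclassP; have := TScal phi psi a 1 1.
by rewrite !mulr1.
Qed.

Lemma pure_tensorE b c : pure_tensor phi psi b c = inl b * inr c.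
Proof.
apply: esym; apply: etrans (tclassM _ _ _ _) _.
by rewrite /tmul /= mulr1 mul1r.
Qed.

Lemma tclassE s : tclass phi psi s = \sum_(y <- s) inl y.1 * inr y.2.
Proof.
elim: s => [|[b c] s ih]; first by rewrite big_nil.
by rewrite big_cons -ih -pure_tensorE; apply: esym; exact: tclassD.
Qed.

Lemma tensorE (x : T) : exists s : seq (B * C), x = \sum_(y <- s) inl y.1 * inr y.2.
Proof. by have [s ->] := tclass_surj x; exists s; exact: tclassE. Qed.

Lemma tensor_ind (P : T -> Prop) : P 0 ->
  (forall b c, P (inl b * inr c)) -> (forall x y, P x -> P y -> P (x + y)) ->
  forall x, P x.
Proof.
move=> P0 P1 PD x; have [s ->] := tensorE x.
by elim/big_ind: _ => // y _; exact: P1.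
Qed.

(** The universal property, for balanced biadditive maps. *)
Section Universal.
Variables (D : zmodType) (g : B -> C -> D).
Hypotheses (gDl : forall b b' c, g (b + b') c = g b c + g b' c)
  (gDr : forall b c c', g b (c + c') = g b c + g b c')
  (gS : forall a b c, g (phi a * b) c = g b (psi a * c)).

Definition tensor_univ (x : T) : D := \sum_(y <- repr x) g y.1 y.2.

Lemma tensor_univ_class s : tensor_univ (tclass phi psi s) = \sum_(y <- s) g y.1 y.2.
Proof.
have g0 c : g 0 c = 0 by apply: (@addrI _ (g 0 c)); rewrite -gDl !addr0.
rewrite /tensor_univ; have := repr_tclass phi psi s; move: (repr _) => t.
elim=> //.
- by move=> v w z _ -> _ ->.
- by move=> v v' w w' _ IH _ IH'; rewrite !big_cat /= IH IH'.
- by move=> v w; rewrite !big_cat /= addrC.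
- by move=> b b' c; rewrite !big_cons !big_nil !addr0 gDl.
- by move=> b c c'; rewrite !big_cons !big_nil !addr0 gDr.
- by move=> a b c; rewrite !big_cons !big_nil !addr0 gS.
- by move=> c; rewrite big_cons !big_nil g0 addr0.
Qed.

Lemma tensor_univ_pure b c : tensor_univ (inl b * inr c) = g b c.
Proof. by rewrite -pure_tensorE tensor_univ_class big_seq1. Qed.

Lemma tensor_univD x y : tensor_univ (x + y) = tensor_univ x + tensor_univ y.
Proof.
have [s ->] := tclass_surj x; have [t ->] := tclass_surj y.
rewrite [_ + _](tclassD phi psi s t) !tensor_univ_class.
by rewrite big_cat.
Qed.

Lemma tensor_univ0 : tensor_univ 0 = 0.
Proof. by apply: (@addrI _ (tensor_univ 0)); rewrite -tensor_univD !addr0. Qed.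

End Universal.

End TensorFacts.

Section TensorMapFacts.
Variables (A B C C' : comPzRingType) (phi : {rmorphism A -> B}).
Variables (psi : {rmorphism A -> C}) (psi' : {rmorphism A -> C'}).
Variables (u : {rmorphism C -> C'}) (upsi : forall a, u (psi a) = psi' a).
Local Notation tm := (tensor_map (phi := phi) upsi).

Fact tensor_map_zmod_morphism : zmod_morphism tm.
Proof.
have D x y : tm (x + y) = tm x + tm y.
  have [s ->] := tclass_surj x; have [t ->] := tclass_surj y.
  rewrite [_ + _](tclassD phi psi s t) !tensor_mapE map_cat.
  by apply: esym; exact: tclassD.
by move=> x y; apply/eqP; rewrite eq_sym subr_eq -D subrK.
Qed.

Fact tensor_map_monoid_morphism : monoid_morphism tm.
Proof.
split=> [|x y]; first by rewrite [1]/(tclass _ _ _) tensor_mapE /= rmorph1.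
have [s ->] := tclass_surj x; have [t ->] := tclass_surj y.
rewrite [_ * _](tclassM phi psi s t) !tensor_mapE.
apply: esym; apply: etrans (tclassM _ _ _ _) _; congr tclass.
rewrite /tmul map_allpairs allpairs_mapl allpairs_mapr.
by apply: eq_allpairs => // z w; rewrite /= rmorphM.
Qed.

HB.instance Definition _ := GRing.isZmodMorphism.Build _ _ tm
  tensor_map_zmod_morphism.
HB.instance Definition _ := GRing.isMonoidMorphism.Build _ _ tm
  tensor_map_monoid_morphism.

Lemma tensor_map_inl b : tm (tensor_inl phi psi b) = tensor_inl phi psi' b.
Proof. by rewrite tensor_mapE /= rmorph1. Qed.

Lemma tensor_map_inr c : tm (tensor_inr phi psi c) = tensor_inr phi psi' (u c).
Proof. by rewrite tensor_mapE. Qed.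

End TensorMapFacts.

(** * Two determinant identities *)

Section Determinants.
Variable A : comPzRingType.

(** The part of the Cauchy-Binet formula that puts the determinant of a product
    into the ideal of the maximal minors of the left factor. *)
Lemma det_sum_minors n (E : finType) (T : 'I_n -> E -> A) (C : E -> 'I_n -> A) :
  \det (\matrix_(i, j) \sum_e T i e * C e j) =
  \sum_(g : {ffun 'I_n -> E}) (\prod_j C (g j) j) * \det (\matrix_(i, j) T i (g j)).
Proof.
rewrite -[LHS]det_tr [LHS]/determinant.
under [RHS]eq_bigr => g _ do rewrite -det_tr /determinant big_distrr /=.
rewrite exchange_big /=; apply: eq_bigr => s _.
under [X in _ * X]eq_bigr => j _ do rewrite !mxE.
rewrite bigA_distr_bigA big_distrr /=; apply: eq_bigr => g _.
rewrite mulrCA; congr (_ * _); rewrite big_split /= mulrC; congr (_ * _).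
by apply: eq_bigr => j _; rewrite !mxE.
Qed.

(** The characteristic polynomial is only evaluated, at elements of algebras that
    may be zero, so that polynomial functions serve the purpose. *)
Section CharacteristicPolynomial.
Variables (B : comPzRingType) (phi : {rmorphism A -> B}).

(** The argument [a] records the coefficient in degree [n], which has to be [1] in
    [polyfun_det]. *)
Definition polyfun n (a : A) (f : B -> B) := exists c : nat -> A,
  c n = a /\ forall y, f y = \sum_(i < n.+1) phi (c i) * y ^+ i.

Lemma polyfun_sum n (J : Type) (r : seq J) (P : pred J) (a : J -> A)
    (f : J -> B -> B) : (forall j, polyfun n (a j) (f j)) ->
  polyfun n (\sum_(j <- r | P j) a j) (fun y => \sum_(j <- r | P j) f j y).
Proof.
move=> H; elim: r => [|j r [c [cn cE]]].
  exists (fun=> 0); split=> [|y]; rewrite !big_nil // big1 // => i _.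
  by rewrite rmorph0 mul0r.
have [d [dn dE]] := H j.
exists (fun i => (if P j then d i else 0) + c i); split=> [|y]; rewrite !big_cons.
  by case: (P j); rewrite cn ?dn ?add0r.
case: (P j); last by rewrite cE; apply: eq_bigr => i _; rewrite add0r.
rewrite cE dE -big_split /=; apply: eq_bigr => i _.
by rewrite rmorphD mulrDl.
Qed.

Lemma polyfunZ n a b f : polyfun n a f -> polyfun n (b * a) (fun y => phi b * f y).
Proof.
move=> [c [<- cE]]; exists (fun i => b * c i); split=> // y.
by rewrite cE big_distrr /=; apply: eq_bigr => i _; rewrite rmorphM mulrA.
Qed.

Lemma polyfunM n a f b m : polyfun n a f ->
  polyfun n.+1 (b * a) (fun y => (phi b * y + phi m) * f y).
Proof.
move=> [c [<- cE]].
exists (fun i => (if i is j.+1 then b * c j else 0) +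
                 (if (i <= n)%N then m * c i else 0)).
split=> [|y]; first by rewrite ltnn addr0.
under [RHS]eq_bigr => i _ do rewrite rmorphD mulrDl.
rewrite big_split /= [X in _ = X + _]big_ord_recl rmorph0 mul0r add0r.
rewrite [X in _ = _ + X]big_ord_recr /= ltnn rmorph0 mul0r addr0.
rewrite cE mulrDl !big_distrr /=; congr (_ + _); apply: eq_bigr => i _.
  by rewrite /= rmorphM exprS; ring.
by rewrite -ltnS ltn_ord rmorphM mulrA.
Qed.

Lemma polyfun_prod n (b m : 'I_n -> A) :
  polyfun n (\prod_i b i) (fun y => \prod_i (phi (b i) * y + phi (m i))).
Proof.
elim: n b m => [|n IH] b m.
  exists (fun=> 1); rewrite big_ord0; split=> // y.
  by rewrite big_ord0 big_ord1 rmorph1 mul1r expr0.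
have [c [cn cE]] := polyfunM (b ord0) (m ord0) (IH (b \o lift ord0) (m \o lift ord0)).
by exists c; split=> [|y]; rewrite big_ord_recl // -cE.
Qed.

Lemma polyfun_det n (M : 'M[A]_n) :
  polyfun n 1 (fun y => \det (\matrix_(i, j) (phi (i == j)%:R * y + phi (M i j)))).
Proof.
have E : \sum_(s : {perm 'I_n}) (-1) ^+ s * \prod_i ((i == s i)%:R : A) = 1.
  apply: etrans (det1 A n); apply: eq_bigr => s _; congr (_ * _).
  by apply: eq_bigr => i _; rewrite mxE.
have [c [cn cE]] := polyfun_sum (index_enum _) xpredT (fun s : {perm 'I_n} =>
  polyfunZ ((-1) ^+ s) (polyfun_prod (fun i => (i == s i)%:R) (fun i => M i (s i)))).
exists c; split=> [|y]; first by rewrite cn.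
rewrite -cE; apply: eq_bigr => s _.
rewrite rmorph_sign; congr (_ * _).
by apply: eq_bigr => i _; rewrite mxE.
Qed.

End CharacteristicPolynomial.
End Determinants.

(** * Spans up to powers of an element *)

Section NearSpan.
Variables (A B : comPzRingType) (phi : {rmorphism A -> B}) (h : A).
Variables (E : finType) (w : E -> B).

(** The elements of [B] that lie in the span of [w] after inverting [h]. *)
Definition near_span : set B := [set y | exists K (c : E -> A),
  phi h ^+ K * y = \sum_e phi (c e) * w e].

Lemma near_span_mem e : near_span (w e).
Proof.
exists 0%N, (fun i => (i == e)%:R); rewrite expr0 mul1r (bigD1 e) //= eqxx rmorph1.
by rewrite mul1r big1 ?addr0 // => i /negbTE ->; rewrite rmorph0 mul0r.
Qed.

Lemma near_span0 : near_span 0.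
Proof.
exists 0%N, (fun=> 0); rewrite mulr0 big1 // => e _.
by rewrite rmorph0 mul0r.
Qed.

Lemma near_spanZ a y : near_span y -> near_span (phi a * y).
Proof.
move=> [K [c yc]]; exists K, (fun e => a * c e); rewrite mulrCA yc big_distrr /=.
by apply: eq_bigr => e _; rewrite rmorphM mulrA.
Qed.

Lemma near_spanK K y : near_span (phi h ^+ K * y) -> near_span y.
Proof. by move=> [L [c yc]]; exists (L + K)%N, c; rewrite exprD -mulrA. Qed.

Lemma near_spanD x y : near_span x -> near_span y -> near_span (x + y).
Proof.
move=> [K [c xc]] [L [d yd]]; apply: (@near_spanK (K + L)).
exists 0%N, (fun e => h ^+ L * c e + h ^+ K * d e).
transitivity (phi h ^+ L * (phi h ^+ K * x) + phi h ^+ K * (phi h ^+ L * y)).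
  by rewrite expr0 exprD; ring.
rewrite xc yd !big_distrr -big_split; apply: eq_bigr => e _ /=.
by rewrite rmorphD !rmorphM !rmorphXn mulrDl !mulrA.
Qed.

Lemma near_span_sum (J : Type) (r : seq J) (P : pred J) (F : J -> B) :
  (forall j, P j -> near_span (F j)) -> near_span (\sum_(j <- r | P j) F j).
Proof.
by move=> H; elim/big_ind: _ => //; [exact: near_span0|move=> *; exact: near_spanD].
Qed.

Lemma near_spanM x y : (forall e, near_span (w e * x)) -> near_span y ->
  near_span (y * x).
Proof.
move=> wx [K [c yc]]; apply: (@near_spanK K); rewrite mulrA yc big_distrl.
by apply: near_span_sum => e _; rewrite /= -mulrA; exact: near_spanZ.
Qed.

Lemma near_spanX x n y : (forall e, near_span (w e * x)) -> near_span y ->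
  near_span (y * x ^+ n).
Proof.
move=> wx wy; elim: n => [|n ih]; first by rewrite expr0 mulr1.
by rewrite exprSr mulrA; exact: near_spanM.
Qed.

End NearSpan.

(** * Frames *)

(** What local freeness of [B] amounts to without denominators: over [D(h_l)] the
    [fb l s] are a basis, and the [fmu l s] are [h_l] times the dual basis.  The
    data are defined over [A], hence they can be transported along any [A -> A'].
    The last condition says that pieces of different ranks do not meet. *)
Record frame (A B : comPzRingType) (phi : {rmorphism A -> B}) := Frame {
  fq : nat;
  fh : 'I_fq -> A;
  fg : 'I_fq -> A;
  fr : 'I_fq -> nat;
  fb : 'I_fq -> nat -> B;
  fmu : 'I_fq -> nat -> B -> A;
  fpart : \sum_l fg l * fh l = 1;
  fmuD : forall l s x y, fmu l s (x + y) = fmu l s x + fmu l s y;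
  fmuZ : forall l s a x, fmu l s (phi a * x) = a * fmu l s x;
  fexp : forall l x, phi (fh l) * x = \sum_(s < fr l) phi (fmu l s x) * fb l s;
  fdual : forall l (s t : 'I_(fr l)), fmu l s (fb l t) = fh l * (s == t)%:R;
  fdisj : forall l m, fr l != fr m -> fh l * fh m = 0
}.

Section Local.
Variables (A B : comPzRingType) (phi : {rmorphism A -> B}) (F : frame phi).
Variable l : 'I_(fq F).
Local Notation h := (fh l).
Local Notation r := (fr l).
Local Notation b := (fb l).
Local Notation mu := (fmu l).

Lemma fmu0 s : mu s 0 = 0.
Proof. by apply: (@addrI _ (mu s 0)); rewrite -fmuD !addr0. Qed.

Lemma fmu_sum s (J : Type) (w : seq J) (P : pred J) (f : J -> B) :
  mu s (\sum_(j <- w | P j) f j) = \sum_(j <- w | P j) mu s (f j).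
Proof. exact: (big_morph _ (fmuD l s) (fmu0 s)). Qed.

(** Over [D(h)] multiplication by [x] is an [r] by [r] matrix, hence [x] is a root
    of a monic polynomial of degree [r].  The matrix [N] below is [h * x] minus
    [h] times that matrix, and it kills the vector of the [b s]. *)
Lemma cayley_hamilton x : near_span phi h (fun i : 'I_r => x ^+ i) (x ^+ r).
Proof.
have [c [cr cE]] := polyfun_det phi (\matrix_(t, s) - mu s (x * b t) : 'M_r).
pose N := \matrix_(t, s) (phi (t == s)%:R * (phi h * x) +
  phi ((\matrix_(t, s) - mu s (x * b t) : 'M_r) t s)) : 'M_r.
have Nb t : \sum_s N t s * b s = 0.
  under eq_bigr => s _ do rewrite !mxE rmorphN mulrDl mulNr.
  rewrite big_split /= sumrN -fexp (bigD1 t) //= eqxx rmorph1 mul1r -mulrA.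
  rewrite big1 ?addr0 ?subrr // => s /negbTE st.
  by rewrite eq_sym st rmorph0 !mul0r.
have detb (s : 'I_r) : \det N * b s = 0.
  transitivity (\sum_s' (\adj N *m N) s s' * b s').
    rewrite mul_adj_mx (bigD1 s) //= !mxE eqxx mulr1n big1 ?addr0 // => s' /negbTE st.
    by rewrite !mxE eq_sym st mulr0n mul0r.
  under eq_bigr => s' _ do rewrite mxE big_distrl /=.
  rewrite exchange_big big1 //= => t _.
  under eq_bigr => s' _ do rewrite -mulrA.
  by rewrite -big_distrr /= Nb mulr0.
have : \det N * phi h = 0.
  rewrite -[phi h]mulr1 fexp big_distrr big1 //= => s _.
  by rewrite mulrCA detb mulr0.
rewrite /N cE big_ord_recr /= cr rmorph1 mul1r mulrDl exprMn => /eqP.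
rewrite addrC addr_eq0 => /eqP e.
exists r.+1, (fun i : 'I_r => - (c i * h ^+ i.+1)).
transitivity (phi h ^+ r * x ^+ r * phi h); first by rewrite exprS; ring.
rewrite e big_distrl -sumrN; apply: eq_bigr => i _ /=.
rewrite rmorphN rmorphM rmorphXn exprMn exprS.
by ring.
Qed.

Section Minor.
Variable v : 'I_r -> B.

Definition coord_mx : 'M[A]_r := \matrix_(s, t) mu s (v t).

(** By Cramer's rule this is [\det coord_mx] times the coefficient of [x] on
    [v t], when [v] is a basis over [D(h)]. *)
Definition cramer (t : 'I_r) (x : B) : A := \sum_s (\adj coord_mx) t s * mu s x.

Lemma cramer_expand x :
  phi h * \sum_t phi (cramer t x) * v t = phi (h * \det coord_mx) * x.
Proof.
rewrite big_distrr /=.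
transitivity (\sum_t \sum_(s < r) phi (cramer t x * coord_mx s t) * b s).
  apply: eq_bigr => t _; rewrite mulrCA fexp big_distrr; apply: eq_bigr => s _ /=.
  by rewrite mxE rmorphM mulrA.
rewrite exchange_big /=.
transitivity (\sum_(s < r) phi (\det coord_mx * mu s x) * b s); last first.
  transitivity (phi (\det coord_mx) * (phi h * x)); last by rewrite rmorphM; ring.
  by rewrite fexp big_distrr; apply: eq_bigr => s _ /=; rewrite rmorphM mulrA.
apply: eq_bigr => s _; rewrite -big_distrl -rmorph_sum; congr (phi _ * _).
transitivity (\sum_s' (coord_mx *m \adj coord_mx) s s' * mu s' x).
  under [RHS]eq_bigr => s' _ do rewrite mxE big_distrl /=.
  rewrite [RHS]exchange_big; apply: eq_bigr => t _ /=.
  rewrite mulrC big_distrr; apply: eq_bigr => s' _ /=.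
  by rewrite mulrA.
rewrite mul_mx_adj (bigD1 s) //= !mxE eqxx mulr1n big1 ?addr0 // => s' /negbTE st.
by rewrite !mxE eq_sym st mulr0n mul0r.
Qed.

Lemma cramer_dual t t' : cramer t (v t') = \det coord_mx * (t == t')%:R.
Proof.
transitivity ((\adj coord_mx *m coord_mx) t t').
  by rewrite mxE; apply: eq_bigr => s _; congr (_ * _); rewrite mxE.
by rewrite mul_adj_mx mxE mulr_natr.
Qed.

End Minor.

(** Expressing the [b s] through [w] exhibits a power of [h] as the determinant of
    a product, which lies in the ideal of the minors by [det_sum_minors]. *)
Lemma near_span_minor (E : finType) (w : E -> B) (q : prime_ideal A) :
  (forall y, near_span phi h w y) -> ~ pset q h ->
  exists g : {ffun 'I_r -> E}, ~ pset q (\det (coord_mx (w \o g))).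
Proof.
move=> wB qh.
have [K KP] : exists K : nat, forall s : 'I_r, exists c : E -> A,
    phi h ^+ K * b s = \sum_e phi (c e) * w e.
  have [K KP] : {K : 'I_r -> nat | forall s : 'I_r, exists c : E -> A,
      phi h ^+ K s * b s = \sum_e phi (c e) * w e}.
    exists (fun s => sval (cid (wB (b s)))) => s.
    exact: svalP (cid (wB (b s))).
  exists (\sum_s K s)%N => s; have [c cE] := KP s.
  exists (fun e => h ^+ (\sum_(s' | s' != s) K s')%N * c e).
  rewrite (bigD1 s) //= addnC exprD -mulrA cE big_distrr; apply: eq_bigr => e _ /=.
  by rewrite rmorphM rmorphXn mulrA.
pose c s := sval (cid (KP s)).
have cE (s : 'I_r) : phi h ^+ K * b s = \sum_e phi (c s e) * w e := svalP (cid (KP s)).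
apply: contrapT => /forallNP H.
have : pset q (\det (\matrix_(s, t) \sum_e mu s (w e) * c t e : 'M_r)).
  rewrite det_sum_minors; apply: prime_sum => g _; apply: primeMl.
  exact: contrapT (H g).
rewrite (_ : \matrix_(s, t) _ = (h ^+ K.+1)%:M); last first.
  apply/matrixP => s t; rewrite !mxE.
  transitivity (mu s (phi h ^+ K * b t)).
    by rewrite cE fmu_sum; apply: eq_bigr => e _; rewrite fmuZ mulrC.
  by rewrite -rmorphXn fmuZ fdual mulrA exprSr mulr_natr.
by rewrite det_scalar => /primeX/primeX.
Qed.

End Local.

(** * Generating tuples and monogenerators in a frame *)

Section Generating.
Variables (A B : comPzRingType) (phi : {rmorphism A -> B}) (F : frame phi).

Section Bounded.
Variables (k : nat) (theta : k.-tuple B) (l : 'I_(fq F)).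
Local Notation r := (fr l).

Definition bounded_exponents := {ffun 'I_k -> 'I_r}.
HB.instance Definition _ := Finite.on bounded_exponents.

Definition bounded_monomial (e : bounded_exponents) : B :=
  monomial theta (fun i => e i).

(** Where the rank is zero there may be no bounded monomial at all, but then [B]
    vanishes over [D(h_l)]. *)
Lemma near_span_rank0 (E : finType) (w : E -> B) y : r = 0%N ->
  near_span phi (fh l) w y.
Proof.
move=> r0; apply: (@near_spanK _ _ _ _ _ _ 1); rewrite expr1 fexp.
have -> : \sum_(s < r) phi (fmu l s y) * fb l s = 0.
  by apply: big1 => s _; move: (ltn_ord s); rewrite {2}r0.
exact: near_span0.
Qed.

(** By [cayley_hamilton] the span of the bounded monomials is stable under
    multiplication by each [theta_i]. *)
Lemma near_span_bounded (y : B) : adjoin phi theta y ->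
  near_span phi (fh l) bounded_monomial y.
Proof.
have [r0|r0] := posnP r; first by move=> _; exact: near_span_rank0.
have mulx i e : near_span phi (fh l) bounded_monomial
    (bounded_monomial e * tnth theta i).
  have upd (j : 'I_r) : \prod_(i' < k | i' != i) tnth theta i' ^+ e i' *
      tnth theta i ^+ j = bounded_monomial [ffun i' => if i' == i then j else e i'].
    rewrite /bounded_monomial /monomial [RHS](bigD1 i) //= ffunE eqxx mulrC.
    by congr (_ * _); apply: eq_bigr => i' /negbTE ii'; rewrite ffunE ii'.
  have -> : bounded_monomial e * tnth theta i =
      \prod_(i' < k | i' != i) tnth theta i' ^+ e i' * tnth theta i ^+ (e i).+1.
    by rewrite /bounded_monomial /monomial (bigD1 i) //= exprS; ring.
  have [lt_e|] := ltnP (e i).+1 r.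
    by rewrite (upd (Ordinal lt_e)); exact: near_span_mem.
  rewrite leq_eqVlt ltnNge ltn_ord orbF => /eqP <-.
  have [K [c cE]] := cayley_hamilton l (tnth theta i).
  apply: (@near_spanK _ _ _ _ _ _ K); rewrite mulrCA cE big_distrr.
  apply: near_span_sum => j _ /=; rewrite mulrCA upd; apply: near_spanZ.
  exact: near_span_mem.
have one : near_span phi (fh l) bounded_monomial 1.
  have := near_span_mem phi (fh l) bounded_monomial [ffun=> Ordinal r0].
  by rewrite /bounded_monomial /monomial big1 // => i _; rewrite ffunE expr0.
move=> [p ->]; apply: near_span_sum => u _; apply: near_spanZ.
suff H z : near_span phi (fh l) bounded_monomial z ->
    near_span phi (fh l) bounded_monomial (z * monomial theta u.2).
  by have := H 1 one; rewrite mul1r.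
rewrite /monomial; elim/big_rec: _ z => [z|i x _ IH z] zw; first by rewrite mulr1.
by rewrite mulrA; apply: IH; exact: near_spanX.
Qed.

Lemma near_span_powers (x y : B) : is_monogenerator phi x ->
  near_span phi (fh l) (fun i : 'I_r => x ^+ i) y.
Proof.
move=> /(_ y)[c ->]; have [r0|r0] := posnP r; first exact: near_span_rank0.
apply: near_span_sum => i _; apply: near_spanZ; rewrite -[_ ^+ _]mul1r.
apply: near_spanX; last exact: (near_span_mem _ _ _ (Ordinal r0)).
move=> e; rewrite -exprSr; have [lt_e|] := ltnP e.+1 r.
  exact: (near_span_mem _ _ _ (Ordinal lt_e)).
rewrite leq_eqVlt ltnNge ltn_ord orbF => /eqP <-.
exact: cayley_hamilton.
Qed.

End Bounded.

Section Minors.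
Variables (k : nat) (theta : k.-tuple B).

Definition minor_index := {l : 'I_(fq F) & {ffun 'I_(fr l) -> bounded_exponents k l}}.
HB.instance Definition _ := Finite.on minor_index.

(** The maximal minors of the bounded monomials, in the basis over [D(h_l)]; the
    factor [h_l] confines each minor to the piece where it has a meaning. *)
Definition minor (j : minor_index) : A :=
  fh (tag j) * \det (coord_mx (@bounded_monomial k theta (tag j) \o tagged j)).

(** If the minors have no common zero, they generate the unit ideal, and Cramer's
    rule puts each of them, times any element, into the generated subalgebra. *)
Lemma generating_minors :
  is_generating phi theta <-> forall q : prime_ideal A, exists j, ~ pset q (minor j).
Proof.
split=> [gen q|H].
  have [l ql] := partition_cover q (fpart F).
  have [g qg] := @near_span_minor _ _ _ F l _ (@bounded_monomial k theta l) q
    (fun y => near_span_bounded l (gen y)) ql.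
  by exists (existT _ l g : minor_index) => /primeM[].
have [c c1] := partition_of_unity H.
apply/adjoinP => y; rewrite -[y]mul1r -(rmorph1 phi) -c1 raddf_sum big_distrl /=.
apply: adjoin_sum => j _; rewrite rmorphM -mulrA; apply: adjoinM.
  exact: adjoin_base.
rewrite -cramer_expand; apply: adjoinM; first exact: adjoin_base.
apply: adjoin_sum => t _; exact: adjoin_term.
Qed.

End Minors.

Definition max_rank := \max_l fr (l : 'I_(fq F)).

(** The powers of a monogenerator form local bases of varying lengths [r_l].  The
    dual bases, extended by zero, glue to global functionals [D_i].  By
    uniqueness, giving [theta] is the same as giving the pair of [theta] and [D],
    and such pairs are the solutions of equations. *)
Record dual_powers (theta : B) (D : nat -> B -> A) : Prop := DualPowers {
  dpD : forall i x y, D i (x + y) = D i x + D i y;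
  dpZ : forall i a x, D i (phi a * x) = a * D i x;
  dp_expand : forall x, x = \sum_(i < max_rank) phi (D i x) * theta ^+ i;
  dp_dual : forall (l : 'I_(fq F)) (i t : 'I_(fr l)),
    fh l * D i (theta ^+ t) = fh l * (i == t)%:R;
  dp_zero : forall (l : 'I_(fq F)) i x, (fr l <= i)%N -> fh l * D i x = 0
}.

Lemma frame_eq (a a' : A) : (forall l, fh (l : 'I_(fq F)) * a = fh l * a') -> a = a'.
Proof.
move=> e; rewrite -[a]mul1r -[a']mul1r -(fpart F) !big_distrl.
by apply: eq_bigr => l _; rewrite /= -!mulrA e.
Qed.

Lemma fr_max l : (fr (l : 'I_(fq F)) <= max_rank)%N.
Proof. exact: leq_bigmax. Qed.

(** Apply [D'] to the expansion of [x] given by [D]. *)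
Lemma dual_powers_unique theta D D' : dual_powers theta D -> dual_powers theta D' ->
  forall i x, D i x = D' i x.
Proof.
move=> HD HD' i x; apply: frame_eq => l; have [ri|ir] := leqP (fr l) i.
  by rewrite (dp_zero HD) // (dp_zero HD').
have D'0 : D' i 0 = 0.
  by apply: (@addrI _ (D' i 0)); rewrite -(dpD HD') !addr0.
rewrite [in RHS](dp_expand HD x) (big_morph _ (dpD HD' i) D'0) big_distrr /=.
transitivity (\sum_(t < max_rank) fh l * D t x * (i == t)%:R).
  rewrite (bigD1 (Ordinal (leq_trans ir (fr_max l)))) //= eqxx mulr1 big1 ?addr0 //.
  by move=> t; rewrite -val_eqE /= eq_sym => /negbTE ->; rewrite mulr0.
apply: eq_bigr => t _; have [rt|tr] := leqP (fr l) t.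
  by rewrite (dpZ HD') mulrA !(dp_zero HD) // !mul0r.
rewrite (dpZ HD') mulrCA (dp_dual HD' (Ordinal ir) (Ordinal tr)) -val_eqE /=.
by rewrite mulrCA mulrA.
Qed.

Lemma dual_powers_monogenerator theta D :
  dual_powers theta D -> is_monogenerator phi theta.
Proof.
move=> HD x; exists (mkseq (D^~ x) max_rank); rewrite size_mkseq.
by rewrite {1}(dp_expand HD x); apply: eq_bigr => i _; rewrite nth_mkseq.
Qed.

(** Over [D(h_l)] the first [r_l] powers of a monogenerator form a basis, and
    Cramer's rule gives the dual basis.  These local solutions are summed with a
    partition of unity; pieces of different rank do not meet. *)
Lemma monogenerator_dual_powers theta :
  is_monogenerator phi theta -> exists D, dual_powers theta D.
Proof.
move=> gen.
pose v l (i : 'I_(fr (l : 'I_(fq F)))) := theta ^+ i.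
pose m l := fh l * \det (coord_mx (@v l)).
have [c c1] : exists c, \sum_l c l * m l = 1.
  apply: partition_of_unity => q; have [l ql] := partition_cover q (fpart F).
  exists l => /primeM[//|qdet].
  have [g] := @near_span_minor _ _ _ F l _ (@v l) q
    (fun y => near_span_powers l y gen) ql; apply.
  have -> : coord_mx (@v l \o g) =
      coord_mx (@v l) *m \matrix_(i, t) (i == g t)%:R.
    apply/matrixP => s t; rewrite !mxE (bigD1 (g t)) //= !mxE eqxx mulr1.
    rewrite big1 ?addr0 // => i /negbTE ig.
    by rewrite !mxE ig mulr0.
  by rewrite det_mulmx; exact: primeMr.
pose loc l i x := if insub i is Some i' then cramer (@v l) i' x else 0.
have locE l (i : 'I_(fr l)) x : loc l i x = cramer (@v l) i x.
  by rewrite /loc insubT //= => H; congr (cramer _ _ _); apply: val_inj.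
have loc0 l i x : (fr (l : 'I_(fq F)) <= i)%N -> loc l i x = 0.
  by move=> li; rewrite /loc insubF // ltnNge li.
have locD l i x y : loc l i (x + y) = loc l i x + loc l i y.
  rewrite /loc; case: insubP => [i' _ _|]; last by rewrite addr0.
  by rewrite /cramer -big_split; apply: eq_bigr => s _; rewrite fmuD mulrDr.
have locZ l i a x : loc l i (phi a * x) = a * loc l i x.
  rewrite /loc; case: insubP => [i' _ _|]; last by rewrite mulr0.
  by rewrite /cramer big_distrr; apply: eq_bigr => s _; rewrite fmuZ mulrCA.
have other l l' : fr (l : 'I_(fq F)) != fr l' -> fh l * (c l' * (fh l' * 1)) = 0.
  by move=> ll'; rewrite mulr1 mulrCA (fdisj ll') mulr0.
exists (fun i x => \sum_l c l * fh l * loc l i x); split.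
- move=> i x y; rewrite -big_split; apply: eq_bigr => l _.
  by rewrite locD mulrDr.
- move=> i a x; rewrite big_distrr; apply: eq_bigr => l _.
  by rewrite locZ mulrCA.
- move=> x; rewrite -[LHS]mul1r -(rmorph1 phi) -c1 raddf_sum big_distrl /=.
  under [RHS]eq_bigr => i _ do rewrite raddf_sum big_distrl /=.
  rewrite exchange_big; apply: eq_bigr => l _ /=.
  rewrite rmorphM -mulrA -cramer_expand mulrA -rmorphM big_distrr /=.
  under [RHS]eq_bigr => i _ do rewrite rmorphM -mulrA.
  rewrite -(subnKC (fr_max l)) big_split_ord /= [X in _ = _ + X]big1 ?addr0 => [|i _].
    by apply: eq_bigr => i _; rewrite locE.
  by rewrite loc0 ?leq_addr // rmorph0 mul0r mulr0.
- move=> l i t.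
  rewrite -[RHS]mulr1 -[X in _ = _ * X]c1 !big_distrr; apply: eq_bigr => l' _ /=.
  have [e|ll'] := eqVneq (fr l) (fr l'); last first.
    transitivity (fh l * (c l' * (fh l' * 1)) * loc l' i (theta ^+ t)); first by ring.
    transitivity (fh l * (c l' * (fh l' * 1)) *
      ((i == t)%:R * \det (coord_mx (@v l')))); last by rewrite /m; ring.
    by rewrite other // !mul0r.
  have := @cramer_dual _ _ _ F l' (@v l') (cast_ord e i) (cast_ord e t).
  rewrite -locE /= /v /= => ->.
  by rewrite -val_eqE /= /m; ring.
- move=> l i x li; rewrite big_distrr big1 // => l' _ /=.
  have [e|ll'] := eqVneq (fr l) (fr l').
    by rewrite loc0 ?mulr0 // -e.
  transitivity (fh l * (c l' * (fh l' * 1)) * loc l' i x); first by ring.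
  by rewrite other // mul0r.
Qed.

(** The finitely many [b_l,s], with coordinate functionals [g_l mu_l,s], are dual
    bases of the projective module [B] in the usual sense. *)
Definition base_index := {l : 'I_(fq F) & 'I_(fr l)}.
HB.instance Definition _ := Finite.on base_index.

Definition base_elem (j : base_index) : B := fb (tag j) (tagged j).
Definition coordinate (j : base_index) (x : B) : A :=
  fg (tag j) * fmu (tag j) (tagged j) x.
Definition combination (c : base_index -> A) : B := \sum_j phi (c j) * base_elem j.

Lemma coordinateK x : combination (coordinate^~ x) = x.
Proof.
rewrite -[RHS]mul1r -(rmorph1 phi) -(fpart F) raddf_sum big_distrl /=.
rewrite /combination -(@sig_big_dep _ _ _ _ _ predT (fun=> predT)
  (fun (l : 'I_(fq F)) (s : 'I_(fr l)) => phi (fg l * fmu l s x) * fb l s)) /=.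
apply: eq_bigr => l _; rewrite rmorphM -mulrA fexp big_distrr.
by apply: eq_bigr => s _; rewrite /= rmorphM mulrA.
Qed.

Lemma coordinateD j x y : coordinate j (x + y) = coordinate j x + coordinate j y.
Proof. by rewrite /coordinate fmuD mulrDr. Qed.

Lemma coordinateZ j a x : coordinate j (phi a * x) = a * coordinate j x.
Proof. by rewrite /coordinate fmuZ mulrCA. Qed.

Lemma coordinate_inj x y : (forall j, coordinate j x = coordinate j y) -> x = y.
Proof.
by move=> e; rewrite -[x]coordinateK -[y]coordinateK; apply: eq_bigr => j _; rewrite e.
Qed.

End Generating.

(** * Base change of frames *)

Section BaseChange.
Variables (A B A' : comPzRingType) (phi : {rmorphism A -> B}) (F : frame phi).
Variable alpha : {rmorphism A -> A'}.
Local Notation B' := (tensor phi alpha).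
Local Notation inl := (tensor_inl phi alpha).
Local Notation inr := (tensor_inr phi alpha).

Definition base_mu (l : 'I_(fq F)) (s : nat) : B' -> A' :=
  tensor_univ (fun b c => alpha (fmu l s b) * c).

Section Functional.
Variables (l : 'I_(fq F)) (s : nat).

Let gDl b b' c :
  alpha (fmu l s (b + b')) * c = alpha (fmu l s b) * c + alpha (fmu l s b') * c.
Proof. by rewrite fmuD rmorphD mulrDl. Qed.

Let gDr b c c' :
  alpha (fmu l s b) * (c + c') = alpha (fmu l s b) * c + alpha (fmu l s b) * c'.
Proof. exact: mulrDr. Qed.

Let gS a b c :
  alpha (fmu l s (phi a * b)) * c = alpha (fmu l s b) * (alpha a * c).
Proof. by rewrite fmuZ rmorphM; ring. Qed.

Lemma base_mu_pure b c : base_mu l s (inl b * inr c) = alpha (fmu l s b) * c.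
Proof. exact: (tensor_univ_pure gDl gDr gS). Qed.

Lemma base_mu_inl b : base_mu l s (inl b) = alpha (fmu l s b).
Proof.
have := base_mu_pure b 1; rewrite (_ : inr 1 = 1) ?mulr1 //; exact: rmorph1.
Qed.

Lemma base_muD x y : base_mu l s (x + y) = base_mu l s x + base_mu l s y.
Proof. exact: (tensor_univD gDl gDr gS). Qed.

Lemma base_mu0 : base_mu l s 0 = 0.
Proof. exact: (tensor_univ0 gDl gDr gS). Qed.

Lemma base_muZ a x : base_mu l s (inr a * x) = a * base_mu l s x.
Proof.
elim/(@tensor_ind _ _ _ phi alpha): x => [|b c|x y IHx IHy].
- by rewrite mulr0 base_mu0 mulr0.
- by rewrite mulrCA -tensor_inrM !base_mu_pure mulrCA.
- by rewrite mulrDr !base_muD IHx IHy mulrDr.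
Qed.

End Functional.

Let part : \sum_l alpha (fg (f := F) l) * alpha (fh l) = 1.
Proof.
rewrite -(rmorph1 alpha) -(fpart F) rmorph_sum; apply: eq_bigr => l _.
by rewrite rmorphM.
Qed.

Let expand (l : 'I_(fq F)) x : (inr : {rmorphism A' -> B'}) (alpha (fh l)) * x =
  \sum_(s < fr l) (inr : {rmorphism A' -> B'}) (base_mu l s x) * inl (fb l s).
Proof.
rewrite /=; elim/(@tensor_ind _ _ _ phi alpha): x => [|b c|x y IHx IHy].
- rewrite mulr0 big1 // => s _; rewrite base_mu0.
  by rewrite (rmorph0 (tensor_inr phi alpha)) mul0r.
- rewrite -tensor_base mulrA -tensor_inlM fexp (rmorph_sum inl) big_distrl.
  apply: eq_bigr => s _ /=; rewrite base_mu_pure tensor_inlM tensor_base tensor_inrM.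
  by ring.
- rewrite mulrDr IHx IHy -big_split; apply: eq_bigr => s _ /=.
  by rewrite base_muD (rmorphD (tensor_inr phi alpha)) mulrDl.
Qed.

Let dual (l : 'I_(fq F)) (s t : 'I_(fr l)) :
  base_mu l s (inl (fb l t)) = alpha (fh l) * (s == t)%:R.
Proof. by rewrite base_mu_inl fdual rmorphM rmorph_nat. Qed.

Let disj (l m : 'I_(fq F)) : fr l != fr m -> alpha (fh l) * alpha (fh m) = 0.
Proof. by move=> lm; rewrite -rmorphM (fdisj lm) rmorph0. Qed.

Definition base_frame : frame (inr : {rmorphism A' -> B'}) :=
  @Frame _ _ (inr : {rmorphism A' -> B'}) (fq F) (fun l => alpha (fh l))
    (fun l => alpha (fg l)) (fr (f := F)) (fun l s => inl (fb l s)) base_mu part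
    base_muD base_muZ expand dual disj.

End BaseChange.

Section Naturality.
Variables (A B A1 A2 : comPzRingType) (phi : {rmorphism A -> B}) (F : frame phi).
Variables (alpha1 : {rmorphism A -> A1}) (alpha2 : {rmorphism A -> A2}).
Variables (u : {rmorphism A1 -> A2}) (ualpha : forall a, u (alpha1 a) = alpha2 a).
Local Notation F1 := (base_frame F alpha1).
Local Notation F2 := (base_frame F alpha2).
Local Notation um := (tensor_map (phi := phi) ualpha).

Lemma base_mu_natural (l : 'I_(fq F)) s (x : tensor phi alpha1) :
  base_mu l s (um x) = u (base_mu l s x).
Proof.
elim/(@tensor_ind _ _ _ phi alpha1): x => [|b c|x y IHx IHy].
- by rewrite (rmorph0 um) !base_mu0 rmorph0.
- rewrite (rmorphM um) /= tensor_map_inl tensor_map_inr !base_mu_pure rmorphM.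
  by rewrite ualpha.
- by rewrite (rmorphD um) !base_muD rmorphD /= IHx IHy.
Qed.

Lemma coordinate_natural (j : base_index F) x :
  coordinate (F := F2) j (um x) = u (coordinate (F := F1) j x).
Proof. by rewrite /coordinate /= base_mu_natural rmorphM ualpha. Qed.

Lemma combination_natural (c : base_index F -> A1) :
  um (combination (F := F1) c) = combination (F := F2) (u \o c).
Proof.
rewrite /combination (rmorph_sum um); apply: eq_bigr => j _.
by rewrite (rmorphM um) /base_elem /= tensor_map_inl tensor_map_inr.
Qed.

Lemma monomial_natural k (theta : k.-tuple (tensor phi alpha1)) e :
  um (monomial theta e) = monomial (map_tuple um theta) e.
Proof.
rewrite /monomial (rmorph_prod um); apply: eq_bigr => i _.
by rewrite (rmorphXn um) tnth_map.
Qed.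

Lemma minor_natural k (theta : k.-tuple (tensor phi alpha1)) (j : minor_index F k) :
  minor (F := F2) (map_tuple um theta) j = u (minor (F := F1) theta j).
Proof.
rewrite /minor rmorphM /= ualpha -det_map_mx; congr (_ * \det _).
apply/matrixP => s t; rewrite !mxE /= -base_mu_natural; congr (base_mu _ _ _).
by rewrite /bounded_monomial monomial_natural.
Qed.

End Naturality.

Section TrivialBaseChange.
Variables (A B : comPzRingType) (phi : {rmorphism A -> B}).
Local Notation inl := (tensor_inl phi (idfun : {rmorphism A -> A})).
Local Notation inr := (tensor_inr phi (idfun : {rmorphism A -> A})).

(** [B (x)_A A] is [B]; the inverse map sends [b (x) c] to [b * phi c]. *)
Lemma tensor_inl_bij : bijective inl.
Proof.
pose g (x : tensor phi (idfun : {rmorphism A -> A})) : B :=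
  tensor_univ (fun b c => b * phi c) x.
have gE b c : g (inl b * inr c) = b * phi c.
  apply: tensor_univ_pure => [b1 b2 c'|b' c1 c2|a b' c'] /=.
  - exact: mulrDl.
  - by rewrite rmorphD mulrDr.
  - by rewrite rmorphM; ring.
have gK b : g (inl b) = b.
  by rewrite -[LHS]/(g (inl b)) -[inl b]mulr1 (gE b 1) rmorph1 mulr1.
exists g => // x; suff [b ->] : exists b, x = inl b by rewrite gK.
elim/(@tensor_ind _ _ _ phi (idfun : {rmorphism A -> A})): x => [|b c|x y [b ->] [b' ->]].
- by exists 0; rewrite (rmorph0 inl).
- by exists (b * phi c); rewrite tensor_inlM tensor_base.
- by exists (b + b'); rewrite (rmorphD inl).
Qed.

End TrivialBaseChange.

(** * Algebras presented by the points that they should have *)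

Inductive term (A X : Type) : Type :=
| TCst of A
| TVar of X
| TAdd of term A X & term A X
| TOpp of term A X
| TMul of term A X & term A X.
Arguments TCst {A X}.
Arguments TVar {A X}.

HB.instance Definition _ A X := gen_eqMixin (term A X).
HB.instance Definition _ A X := gen_choiceMixin (term A X).

Section Classifying.
Variables (A : comPzRingType) (X : Type).
Variable G : forall A' : comPzRingType, {rmorphism A -> A'} -> (X -> A') -> Prop.

Fixpoint eval (A' : comPzRingType) (alpha : A -> A') (x : X -> A') (t : term A X) : A' :=
  match t with
  | TCst a => alpha a
  | TVar i => x i
  | TAdd t1 t2 => eval alpha x t1 + eval alpha x t2
  | TOpp t1 => - eval alpha x t1
  | TMul t1 t2 => eval alpha x t1 * eval alpha x t2
  end.

Definition same_values (t t' : term A X) : bool :=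
  `[< forall (A' : comPzRingType) (alpha : {rmorphism A -> A'}) (x : X -> A'),
      G alpha x -> eval alpha x t = eval alpha x t' >].

Fact same_values_refl : reflexive same_values.
Proof. by move=> t; apply/asboolP. Qed.

Fact same_values_sym : symmetric same_values.
Proof.
by move=> t t'; apply/asboolP/asboolP => e A' alpha x Gx; rewrite e.
Qed.

Fact same_values_trans : transitive same_values.
Proof.
move=> t s u /asboolP e /asboolP e'; apply/asboolP => A' alpha x Gx.
by rewrite e // e'.
Qed.

Canonical same_values_equiv :=
  EquivRel same_values same_values_refl same_values_sym same_values_trans.

(** A moduli problem is given by a predicate [G] that selects the good families
    [x] indexed by [X] in each [A]-algebra.  Terms in the indeterminates [X]
    define functions on the good families, and these functions form the ring that
    should represent [G].  Two of them are equal as soon as they agree on all good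
    families, hence a condition made of equations passes from the good families to
    the family of the indeterminates itself. *)
Definition classifying := {eq_quot same_values}.
HB.instance Definition _ := Choice.on classifying.
HB.instance Definition _ : EqQuotient _ same_values classifying :=
  EqQuotient.on classifying.

Definition value (t : term A X) : classifying := \pi_classifying t.

Lemma valueP t t' : value t = value t' <->
  forall (A' : comPzRingType) (alpha : {rmorphism A -> A'}) (x : X -> A'),
    G alpha x -> eval alpha x t = eval alpha x t'.
Proof. by split=> [/eqmodP/asboolP|h] //; apply/eqmodP/asboolP. Qed.

Lemma value_surj z : exists t, z = value t.
Proof. by exists (repr z); rewrite /value reprK. Qed.

Lemma repr_value (A' : comPzRingType) (alpha : {rmorphism A -> A'}) (x : X -> A') t :
  G alpha x -> eval alpha x (repr (value t)) = eval alpha x t.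
Proof. by apply: (iffLR (valueP _ _)); rewrite /value reprK. Qed.

Definition value_add (y z : classifying) := value (TAdd (repr y) (repr z)).
Definition value_opp (y : classifying) := value (TOpp (repr y)).
Definition value_mul (y z : classifying) := value (TMul (repr y) (repr z)).

Lemma valueD t t' : value_add (value t) (value t') = value (TAdd t t').
Proof. by apply/valueP => A' alpha x Gx; rewrite /= !repr_value. Qed.

Lemma valueN t : value_opp (value t) = value (TOpp t).
Proof. by apply/valueP => A' alpha x Gx; rewrite /= !repr_value. Qed.

Lemma valueM t t' : value_mul (value t) (value t') = value (TMul t t').
Proof. by apply/valueP => A' alpha x Gx; rewrite /= !repr_value. Qed.

Fact value_addA : associative value_add.
Proof.
move=> x y z; have [s ->] := value_surj x; have [t ->] := value_surj y.
have [u ->] := value_surj z; rewrite !valueD; apply/valueP => A' alpha w _ /=.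
exact: addrA.
Qed.

Fact value_addC : commutative value_add.
Proof.
move=> x y; have [s ->] := value_surj x; have [t ->] := value_surj y.
by rewrite !valueD; apply/valueP => A' alpha w _ /=; exact: addrC.
Qed.

Fact value_add0 : left_id (value (TCst 0)) value_add.
Proof.
move=> x; have [s ->] := value_surj x; rewrite valueD.
by apply/valueP => A' alpha w _ /=; rewrite rmorph0 add0r.
Qed.

Fact value_addN : left_inverse (value (TCst 0)) value_opp value_add.
Proof.
move=> x; have [s ->] := value_surj x; rewrite valueN valueD.
by apply/valueP => A' alpha w _ /=; rewrite rmorph0 addNr.
Qed.

HB.instance Definition _ := GRing.isZmodule.Build classifying
  value_addA value_addC value_add0 value_addN.

Fact value_mulA : associative value_mul.
Proof.
move=> x y z; have [s ->] := value_surj x; have [t ->] := value_surj y.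
have [u ->] := value_surj z; rewrite !valueM; apply/valueP => A' alpha w _ /=.
exact: mulrA.
Qed.

Fact value_mulC : commutative value_mul.
Proof.
move=> x y; have [s ->] := value_surj x; have [t ->] := value_surj y.
by rewrite !valueM; apply/valueP => A' alpha w _ /=; exact: mulrC.
Qed.

Fact value_mul1 : left_id (value (TCst 1)) value_mul.
Proof.
move=> x; have [s ->] := value_surj x; rewrite valueM.
by apply/valueP => A' alpha w _ /=; rewrite rmorph1 mul1r.
Qed.

Fact value_mulD : left_distributive value_mul +%R.
Proof.
move=> x y z; have [s ->] := value_surj x; have [t ->] := value_surj y.
have [u ->] := value_surj z.
have D (v w : classifying) : v + w = value_add v w by [].
rewrite !D !(valueD, valueM); apply/valueP => A' alpha w _ /=.
exact: mulrDl.
Qed.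

HB.instance Definition _ := GRing.Zmodule_isComPzRing.Build classifying
  value_mulA value_mulC value_mul1 value_mulD.

Definition classifying_base (a : A) : classifying := value (TCst a).
Definition classifying_gen (i : X) : classifying := value (TVar i).

Fact classifying_base_zmod_morphism : zmod_morphism classifying_base.
Proof.
have D a b : classifying_base (a + b) = classifying_base a + classifying_base b.
  apply: etrans (esym (valueD _ _)).
  by apply/valueP => A' alpha x _ /=; exact: rmorphD.
by move=> a b; apply/eqP; rewrite eq_sym subr_eq -D subrK.
Qed.

Fact classifying_base_monoid_morphism : monoid_morphism classifying_base.
Proof.
split=> // a b; apply: etrans (esym (valueM _ _)).
by apply/valueP => A' alpha x _ /=; exact: rmorphM.
Qed.

HB.instance Definition _ := GRing.isZmodMorphism.Build A classifying
  classifying_base classifying_base_zmod_morphism.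
HB.instance Definition _ := GRing.isMonoidMorphism.Build A classifying
  classifying_base classifying_base_monoid_morphism.

Lemma valueE t : value t = eval classifying_base classifying_gen t.
Proof.
elim: t => [//|//|s IHs t IHt|s IHs|s IHs t IHt] /=.
- by rewrite -IHs -IHt; apply: esym; exact: valueD.
- by rewrite -IHs; apply: esym; exact: valueN.
- by rewrite -IHs -IHt; apply: esym; exact: valueM.
Qed.

Lemma eval_morph (A1 A2 : comPzRingType) (u : {rmorphism A1 -> A2}) (alpha : A -> A1)
    (x : X -> A1) t : u (eval alpha x t) = eval (u \o alpha) (u \o x) t.
Proof.
elim: t => [//|//|s IHs t IHt|s IHs|s IHs t IHt] /=.
- by rewrite rmorphD IHs IHt.
- by rewrite rmorphN IHs.
- by rewrite rmorphM IHs IHt.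
Qed.

Lemma classifying_morph_eq (A' : comPzRingType) (u v : {rmorphism classifying -> A'}) :
  (forall a, u (classifying_base a) = v (classifying_base a)) ->
  (forall i, u (classifying_gen i) = v (classifying_gen i)) -> forall z, u z = v z.
Proof.
move=> ea ex z; have [t ->] := value_surj z; rewrite valueE !eval_morph.
by elim: t => [a|i|s IHs t IHt|s IHs|s IHs t IHt] /=; rewrite ?IHs ?IHt.
Qed.

Section Specialization.
Variables (A' : comPzRingType) (alpha : {rmorphism A -> A'}) (x : X -> A').
Hypothesis Gx : G alpha x.

Definition specialize of G alpha x := fun z : classifying => eval alpha x (repr z).
Local Notation sp := (specialize Gx).

Lemma specializeE t : sp (value t) = eval alpha x t.
Proof. exact: repr_value. Qed.

Fact specialize_zmod_morphism : zmod_morphism sp.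
Proof.
have D y z : sp (y + z) = sp y + sp z.
  have [s ->] := value_surj y; have [t ->] := value_surj z.
  by rewrite [_ + _]valueD !specializeE.
by move=> y z; apply/eqP; rewrite eq_sym subr_eq -D subrK.
Qed.

Fact specialize_monoid_morphism : monoid_morphism sp.
Proof.
split=> [|y z]; first by rewrite [1]/(value _) specializeE /= rmorph1.
have [s ->] := value_surj y; have [t ->] := value_surj z.
by rewrite [_ * _]valueM !specializeE.
Qed.

HB.instance Definition _ := GRing.isZmodMorphism.Build classifying A' sp
  specialize_zmod_morphism.
HB.instance Definition _ := GRing.isMonoidMorphism.Build classifying A' sp
  specialize_monoid_morphism.

Lemma specialize_base a : sp (classifying_base a) = alpha a.
Proof. exact: specializeE. Qed.

Lemma specialize_gen i : sp (classifying_gen i) = x i.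
Proof. exact: specializeE. Qed.

End Specialization.

Lemma classifying_eq (y z : classifying) :
  (forall (A' : comPzRingType) (alpha : {rmorphism A -> A'}) (x : X -> A')
     (Gx : G alpha x), specialize Gx y = specialize Gx z) -> y = z.
Proof.
have [s ->] := value_surj y; have [t ->] := value_surj z => e.
by apply/valueP => A' alpha x Gx; have := e A' alpha x Gx; rewrite !specializeE.
Qed.

End Classifying.

Lemma classifying_finite_type (A : comPzRingType) (X : finType)
    (G : forall A' : comPzRingType, {rmorphism A -> A'} -> (X -> A') -> Prop) :
  finite_type_morphism (classifying_base G : {rmorphism A -> classifying G}).
Proof.
pose th := [tuple classifying_gen G (enum_val i) | i < #|X|].
exists #|X|, th; apply/adjoinP => z; have [t ->] := value_surj z; rewrite valueE.
elim: t => [a|i|s IHs t IHt|s IHs|s IHs t IHt] /=.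
- exact: (adjoin_base (classifying_base G : {rmorphism A -> classifying G})).
- have := adjoin_gen (classifying_base G : {rmorphism A -> classifying G}) th
    (enum_rank i).
  by rewrite tnth_mktuple enum_rankK.
- exact: adjoinD.
- rewrite -mulN1r; apply: adjoinM IHs.
  rewrite -(rmorph1 (classifying_base G)) -(rmorphN (classifying_base G)).
  exact: (adjoin_base (classifying_base G : {rmorphism A -> classifying G})).
- exact: adjoinM.
Qed.

(** * Locally free algebras have frames *)

(** The [f]-power torsion is an ideal, and an exponent that serves its finitely many
    generators serves all of it. *)
Lemma noetherian_torsion (R : comPzRingType) (f : R) : noetherian R ->
  exists M, forall a b, to_loc (powers f) a = to_loc (powers f) b ->
    f ^+ M * a = f ^+ M * b.
Proof.
move=> noeth; pose T := [set a | exists m, f ^+ m * a = 0].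
have [|n [g TE]] := noeth T.
  split=> [|x y [m xm] [k yk]|a x [m xm]].
  - by exists 0%N; rewrite mulr0.
  - exists (m + k)%N; rewrite exprD mulrDr [X in X + _]mulrAC xm mul0r add0r.
    by rewrite -mulrA yk mulr0.
  - by exists m; rewrite mulrCA xm mulr0.
have Tg i : T (g i).
  rewrite TE; have [c ->] := span_mem g i.
  by exists c.
pose m i := sval (cid (Tg i)); have mP i : f ^+ m i * g i = 0 := svalP (cid (Tg i)).
exists (\sum_i m i)%N => a b /to_locP[_ [[k ->] e]].
have : T (a - b) by exists k; rewrite mulrBr e subrr.
rewrite TE => -[c cE]; apply/eqP; rewrite -subr_eq0 -mulrBr cE big_distrr big1 //= => i _.
rewrite (bigD1 i) //= exprD; set F := f ^+ (\sum_(_ < _ | _) _).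
transitivity (F * c i * (f ^+ m i * g i)); first by ring.
by rewrite mP mulr0.
Qed.

Section LocallyFree.
Variables (A B : comPzRingType) (phi : {rmorphism A -> B}).
Hypotheses (noethA : noetherian A) (noethB : noetherian B).

Section LocalBasis.
Variable f : A.
Local Notation lA := (@to_loc A (powers f)).
Local Notation lB := (@to_loc B (powers (phi f))).
Local Notation phif := (loc_map (@powers_morph A B phi f)).

Lemma phif_base a : phif (lA a) = lB (phi a).
Proof.
rewrite /to_loc loc_mapE; apply/mkfrac_eq; exists 1; split; first exact: mset1.
by rewrite rmorph1.
Qed.

(** A basis of [B_f] over [A_f] with denominators cleared: over [A_f] the [b i] are
    [f ^+ m] times a basis, and [kappa] are the coordinates in that basis. *)
Record local_basis n (b : 'I_n -> B) (m : nat) (kappa : 'I_n -> B -> loc (powers f)) :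
  Prop := LocalBasis {
  kappaD : forall i x y, kappa i (x + y) = kappa i x + kappa i y;
  kappaZ : forall i a x, kappa i (phi a * x) = lA a * kappa i x;
  kappa_expand : forall x, lB (phi (f ^+ m) * x) = \sum_i phif (kappa i x) * lB (b i);
  kappa_dual : forall i j, kappa i (b j) = lA (f ^+ m * (i == j)%:R)
}.

Lemma common_denominator (R : comPzRingType) (g : R) n (x : 'I_n -> loc (powers g)) :
  exists (a : 'I_n -> R) m, forall i,
    x i * to_loc (powers g) (g ^+ m) = to_loc (powers g) (a i).
Proof.
pose a i := sval (cid (loc_powers (x i))).
have aP i : exists k, x i * to_loc (powers g) (g ^+ k) = to_loc (powers g) (a i).
  exact: svalP (cid (loc_powers (x i))).
pose k i := sval (cid (aP i)).
have kP i : x i * to_loc (powers g) (g ^+ k i) = to_loc (powers g) (a i).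
  exact: svalP (cid (aP i)).
exists (fun i => a i * g ^+ (\sum_(j | j != i) k j)%N), (\sum_j k j)%N => i.
by rewrite (bigD1 i) //= exprD !to_locM mulrA kP.
Qed.

Lemma finite_free_local_basis : finite_free phif ->
  exists n (b : 'I_n -> B) m kappa, local_basis b m kappa.
Proof.
move=> [n [e eP]]; have [b [m bE]] := common_denominator e.
pose c y := sval (cid (eP y)).
have cE y : y = \sum_i phif (c y i) * e i by case: (svalP (cid (eP y))).
have cU y (d : {ffun 'I_n -> loc (powers f)}) : y = \sum_i phif (d i) * e i -> c y = d.
  by case: (svalP (cid (eP y))) => _; apply.
exists n, b, m, (fun i x => c (lB x) i); split.
- move=> i x y; rewrite (cU _ [ffun j => c (lB x) j + c (lB y) j]) ?ffunE //.
  rewrite (rmorphD lB) /= {1}(cE (lB x)) {1}(cE (lB y)) -big_split /=.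
  by apply: eq_bigr => j _; rewrite ffunE rmorphD mulrDl.
- move=> i a x; rewrite (cU _ [ffun j => lA a * c (lB x) j]) ?ffunE //.
  rewrite to_locM {1}(cE (lB x)) big_distrr /=; apply: eq_bigr => j _.
  by rewrite ffunE rmorphM /= phif_base mulrA.
- move=> x; rewrite to_locM {1}(cE (lB x)) big_distrr /=; apply: eq_bigr => j _.
  by rewrite rmorphXn -bE; ring.
- move=> i j; rewrite (cU _ [ffun i => lA (f ^+ m * (i == j)%:R)]) ?ffunE //.
  rewrite (bigD1 j) //= ffunE eqxx mulr1 phif_base rmorphXn -bE mulrC big1 ?addr0 //.
  move=> i' /negbTE ij; rewrite ffunE ij mulr0 phif_base rmorph0.
  by rewrite (rmorph0 lB) mul0r.
Qed.

Lemma local_basis_near_span n (b : 'I_n -> B) m kappa : local_basis b m kappa ->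
  forall y, near_span phi f b y.
Proof.
move=> Hb y; have [a [k ka]] := common_denominator (kappa^~ y).
have : lB (phi f ^+ (k + m) * y) = lB (\sum_i phi (a i) * b i).
  rewrite exprD -mulrA to_locM -[phi f ^+ m]rmorphXn (kappa_expand Hb).
  rewrite big_distrr (rmorph_sum lB); apply: eq_bigr => i _ /=.
  by rewrite to_locM -phif_base -ka rmorphM /= phif_base rmorphXn; ring.
move=> /to_locP[_ [[K ->] e]]; exists (K + (k + m))%N, (fun i => f ^+ K * a i).
rewrite exprD -mulrA e big_distrr; apply: eq_bigr => i _ /=.
by rewrite rmorphM rmorphXn mulrA.
Qed.

(** Finite generation makes the denominators of all coordinates bounded; killing
    torsion then makes the numerators well defined. *)
Lemma local_dual_basis (E : finType) (w : E -> B) n (b : 'I_n -> B) m kappa :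
  (forall y, exists a : E -> A, y = \sum_e phi (a e) * w e) ->
  local_basis b m kappa ->
  exists N (mu : 'I_n -> B -> A), [/\
    forall i x y, mu i (x + y) = mu i x + mu i y,
    forall i a x, mu i (phi a * x) = a * mu i x,
    forall x, phi (f ^+ N) * x = \sum_i phi (mu i x) * b i &
    forall i j, mu i (b j) = f ^+ N * (i == j)%:R].
Proof.
move=> wB Hb.
have [M MP] := noetherian_torsion f noethA.
have [MB MBP] := noetherian_torsion (phi f) noethB.
have [k kP] : exists k, forall i x, exists a, kappa i x * lA (f ^+ k) = lA a.
  pose p (z : 'I_n * E) := kappa z.1 (w z.2).
  have [a [k ka]] := common_denominator (p \o enum_val (A := [set: 'I_n * E]%SET)).
  exists k => i x; have [c ->] := wB x.
  have k0 : kappa i 0 = 0 by apply: (@addrI _ (kappa i 0)); rewrite -(kappaD Hb) !addr0.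
  rewrite (big_morph _ (kappaD Hb i) k0) big_distrl /=.
  have H e : exists a', kappa i (w e) * lA (f ^+ k) = lA a'.
    have ie : (i, e) \in [set: 'I_n * E]%SET by rewrite finset.inE.
    exists (a (enum_rank_in ie (i, e))).
    by rewrite -ka /= enum_rankK_in // /p.
  pose d e := sval (cid (H e)).
  have dE e : kappa i (w e) * lA (f ^+ k) = lA (d e) := svalP (cid (H e)).
  exists (\sum_e c e * d e); rewrite (rmorph_sum lA); apply: eq_bigr => e _ /=.
  by rewrite (kappaZ Hb) -mulrA dE -to_locM.
pose al i x := sval (cid (kP i x)).
have alE i x : lA (al i x) = kappa i x * lA (f ^+ k).
  by apply: esym; exact: svalP (cid (kP i x)).
exists (MB + M + (M + k + m))%N, (fun i x => f ^+ (MB + M) * (f ^+ M * al i x)).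
have mu0D i x y : f ^+ M * al i (x + y) = f ^+ M * al i x + f ^+ M * al i y.
  rewrite -mulrDr; apply: MP; rewrite alE (kappaD Hb) (rmorphD lA) /= !alE.
  by rewrite mulrDl.
have mu0Z i a x : f ^+ M * al i (phi a * x) = a * (f ^+ M * al i x).
  rewrite mulrCA; apply: MP; rewrite alE (kappaZ Hb) to_locM alE.
  by rewrite mulrA.
split=> [i x y|i a x|x|i j].
- by rewrite mu0D mulrDr.
- by rewrite mu0Z mulrCA.
- have := @MBP (phi (f ^+ (M + k + m)) * x) (\sum_i phi (f ^+ M * al i x) * b i).
  move=> H; transitivity (phi (f ^+ M) * (phi f ^+ MB * (phi (f ^+ (M + k + m)) * x))).
    by rewrite -addnA [f ^+ _]exprD [f ^+ (M + _)]exprD !rmorphM !rmorphXn; ring.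
  rewrite H; last first.
    rewrite exprD rmorphM -mulrA to_locM (kappa_expand Hb) big_distrr.
    rewrite (rmorph_sum lB); apply: eq_bigr => i _ /=.
    rewrite !to_locM -!phif_base exprD !to_locM alE !rmorphM /= !phif_base.
    by ring.
  rewrite !big_distrr; apply: eq_bigr => i _ /=.
  by rewrite exprD !rmorphM !rmorphXn; ring.
- transitivity (f ^+ MB * (f ^+ M * (f ^+ M * al i (b j)))).
    by rewrite exprD; ring.
  have -> : f ^+ M * (f ^+ M * al i (b j)) = f ^+ M * (f ^+ (M + k + m) * (i == j)%:R).
    apply: MP; rewrite to_locM alE (kappa_dual Hb) -!to_locM.
    by congr to_loc; rewrite !exprD; ring.
  by rewrite !exprD; ring.
Qed.

End LocalBasis.

Hypothesis flf : finite_locally_free phi.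

(** The local bases together generate [B], as the powers of the [f l] that clear
    the denominators generate the unit ideal. *)
Lemma locally_free_finite : exists (E : finType) (w : E -> B),
  forall y, exists a : E -> A, y = \sum_e phi (a e) * w e.
Proof.
have [r [f [[g gf] ff]]] := flf.
pose ex l := cid (finite_free_local_basis (ff l)).
pose n l := sval (ex l); pose b l := sval (cid (svalP (ex l))) : 'I_(n l) -> B.
have bP l y : near_span phi (f l) (b l) y.
  have [m [kappa H]] := svalP (cid (svalP (ex l))).
  exact: local_basis_near_span H y.
exists {l : 'I_r & 'I_(n l)}, (fun j => b (tag j) (tagged j)) => y.
pose K l := sval (cid (bP l y)).
have KP l : exists c : 'I_(n l) -> A, phi (f l) ^+ K l * y = \sum_i phi (c i) * b l i.
  exact: svalP (cid (bP l y)).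
pose c l := sval (cid (KP l)).
have cE l : phi (f l) ^+ K l * y = \sum_i phi (c l i) * b l i := svalP (cid (KP l)).
have [d d1] := partition_powers K gf.
exists (fun j => d (tag j) * c (tag j) (tagged j)).
rewrite -[LHS]mul1r -(rmorph1 phi) -d1 raddf_sum big_distrl /=.
rewrite -(@sig_big_dep _ _ _ _ _ predT (fun=> predT)
  (fun (l : 'I_r) (i : 'I_(n l)) => phi (d l * c l i) * b l i)) /=.
apply: eq_bigr => l _; rewrite rmorphM rmorphXn -mulrA cE big_distrr.
by apply: eq_bigr => i _; rewrite /= rmorphM mulrA.
Qed.

(** Free modules of different ranks are isomorphic only over the zero ring: here
    [(h * h') ^+ n] is the determinant of a product through a smaller rank. *)
Lemma dual_bases_rank (h h' : A) n n' (b : 'I_n -> B) (b' : 'I_n' -> B)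
    (mu : 'I_n -> B -> A) (mu' : 'I_n' -> B -> A) :
  (forall i x y, mu i (x + y) = mu i x + mu i y) ->
  (forall i a x, mu i (phi a * x) = a * mu i x) ->
  (forall x, phi h' * x = \sum_i phi (mu' i x) * b' i) ->
  (forall i j, mu i (b j) = h * (i == j)%:R) ->
  (n' < n)%N -> (h * h') ^+ n = 0.
Proof.
move=> muD muZ mu'E mub n'n.
have mu0 i : mu i 0 = 0 by apply: (@addrI _ (mu i 0)); rewrite -muD !addr0.
have <- : \det (\matrix_(i, j) \sum_t mu i (b' t) * mu' t (b j)) = (h * h') ^+ n.
  rewrite -det_scalar; congr (\det _); apply/matrixP => i j; rewrite !mxE.
  transitivity (mu i (phi h' * b j)); last by rewrite muZ mub mulrA mulr_natr mulrC.
  rewrite mu'E (big_morph _ (muD i) (mu0 i)); apply: eq_bigr => t _.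
  by rewrite muZ mulrC.
rewrite det_sum_minors big1 // => g _.
have /injectivePn[i [j ij gij]] : ~~ injectiveb g.
  by apply/negP => /injectiveP/leq_card; rewrite !card_ord leqNgt n'n.
rewrite -det_tr (@determinant_alternate _ _ _ i j) ?mulr0 // => s.
by rewrite !mxE gij.
Qed.

Lemma locally_free_frame : inhabited (frame phi).
Proof.
have [E [w wB]] := locally_free_finite; have [r [f [[g gf] ff]]] := flf.
have loc l : exists n (b : 'I_n -> B) N (mu : 'I_n -> B -> A), [/\
    forall i x y, mu i (x + y) = mu i x + mu i y,
    forall i a x, mu i (phi a * x) = a * mu i x,
    forall x, phi (f l ^+ N) * x = \sum_i phi (mu i x) * b i &
    forall i j, mu i (b j) = f l ^+ N * (i == j)%:R].
  have [n [b [m [kappa Hb]]]] := finite_free_local_basis (ff l).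
  have [N [mu Hmu]] := local_dual_basis wB Hb.
  by exists n, b, N, mu.
pose n l := sval (cid (loc l)).
have loc1 l := svalP (cid (loc l)) : exists (b : 'I_(n l) -> B), _.
pose b l := sval (cid (loc1 l)); have loc2 l := svalP (cid (loc1 l)).
pose N0 l := sval (cid (loc2 l)); have loc3 l := svalP (cid (loc2 l)).
have [N [mu muP]] : exists (N : 'I_r -> nat) (mu : forall l, 'I_(n l) -> B -> A),
    forall l, [/\
    forall i x y, mu l i (x + y) = mu l i x + mu l i y,
    forall i a x, mu l i (phi a * x) = a * mu l i x,
    forall x, phi (f l ^+ N l) * x = \sum_i phi (mu l i x) * b l i &
    forall i j, mu l i (b l j) = f l ^+ N l * (i == j)%:R].
  by exists N0, (fun l => sval (cid (loc3 l))) => l; exact: svalP (cid (loc3 l)).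
pose Q := (\sum_l n l)%N.
have disj l m : n l != n m -> (f l ^+ N l * f m ^+ N m) ^+ Q = 0.
  wlog nml : l m / (n m < n l)%N.
    move=> H nlm; have [lt|lt|eq] := ltngtP (n m) (n l).
    - exact: H.
    - by rewrite mulrC H // eq_sym.
    - by rewrite eq eqxx in nlm.
  move=> _; have [muD muZ _ mub] := muP l; have [_ _ mu'E _] := muP m.
  have -> : Q = (n l + \sum_(l' | l' != l) n l')%N by rewrite /Q (bigD1 l).
  by rewrite exprD (dual_bases_rank muD muZ mu'E mub nml) mul0r.
(* The extra power makes the product of two [h l] of different ranks vanish. *)
pose h l := f l ^+ N l ^+ Q.+1.
pose bb l s := if insub s is Some i then b l i else 0.
pose mm l s x := if insub s is Some i then f l ^+ N l ^+ Q * mu l i x else 0.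
have bbE l (i : 'I_(n l)) : bb l i = b l i by rewrite /bb valK.
have mmE l (i : 'I_(n l)) x : mm l i x = f l ^+ N l ^+ Q * mu l i x by rewrite /mm valK.
have [d d1] := partition_powers (fun l => N l * Q.+1)%N gf.
have hpart : \sum_l d l * h l = 1.
  by rewrite -d1; apply: eq_bigr => l _; rewrite exprM.
have mmD l s x y : mm l s (x + y) = mm l s x + mm l s y.
  rewrite /mm; case: insub => [i|]; last by rewrite addr0.
  by have [muD _ _ _] := muP l; rewrite muD mulrDr.
have mmZ l s a x : mm l s (phi a * x) = a * mm l s x.
  rewrite /mm; case: insub => [i|]; last by rewrite mulr0.
  by have [_ muZ _ _] := muP l; rewrite muZ mulrCA.
have hexp l x : phi (h l) * x = \sum_(s < n l) phi (mm l s x) * bb l s.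
  have [_ _ muE _] := muP l.
  rewrite /h exprSr rmorphM -mulrA muE big_distrr; apply: eq_bigr => i _ /=.
  by rewrite mmE bbE rmorphM mulrA.
have hdual l (s t : 'I_(n l)) : mm l s (bb l t) = h l * (s == t)%:R.
  have [_ _ _ mub] := muP l.
  by rewrite mmE bbE mub /h exprSr mulrA.
have hdisj l m : n l != n m -> h l * h m = 0.
  by move=> /disj e; rewrite /h -exprMn exprS e mulr0.
exact: inhabits (Frame hpart mmD mmZ hexp hdual hdisj).
Qed.

End LocallyFree.

(** * The two moduli schemes *)

Lemma set_bij_transport (P T T' : Type) (g : T' -> T) (S : set T) (S' : set T')
    (Phi : P -> T) : bijective g -> (forall z, S (g z) <-> S' z) ->
  set_bij setT S Phi ->
  exists Psi : P -> T', set_bij setT S' Psi /\ forall f, Phi f = g (Psi f).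
Proof.
move=> [h gK hK] SS' [Phi_fun Phi_inj Phi_surj]; exists (h \o Phi).
split=> [|f]; last by rewrite /= hK.
split=> [f _|f f' _ _ e|z /SS'/Phi_surj[f _ e]].
- by apply/SS'; rewrite /= hK; exact: Phi_fun.
- by apply: Phi_inj; rewrite ?in_setT // -[LHS]hK -[RHS]hK; congr g.
- by exists f; rewrite //= e gK.
Qed.

Section Moduli.
Variables (A B : comPzRingType) (phi : {rmorphism A -> B}) (F : frame phi).

(** A point of an open subscheme of the spectrum of a classifying ring is given by
    its coordinates, the images of the indeterminates. *)
Section OverClassifying.
Variables (X : Type).
Variable G : forall A' : comPzRingType, {rmorphism A -> A'} -> (X -> A') -> Prop.
Local Notation R := (classifying G).
Local Notation iota := (classifying_base G : {rmorphism A -> R}).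
Variable U : opens (Spec R).
Local Notation M := (open_scheme iota U).

Definition point_coords (A' : comPzRingType) (alpha : {rmorphism A -> A'})
    (f : points M alpha) (i : X) : A' := point_morph f (classifying_gen G i).

Lemma point_coords_inj (A' : comPzRingType) (alpha : {rmorphism A -> A'})
    (f f' : points M alpha) : (forall i, point_coords f i = point_coords f' i) -> f = f'.
Proof.
move=> e; apply: point_morph_inj; apply: classifying_morph_eq => // a.
by rewrite -[classifying_base G a]/(iota a) !point_morph_base.
Qed.

Lemma point_coords_natural (A1 A2 : comPzRingType) (alpha1 : {rmorphism A -> A1})
    (alpha2 : {rmorphism A -> A2}) (u : {rmorphism A1 -> A2})
    (ualpha : forall a, u (alpha1 a) = alpha2 a) (f : points M alpha1) i :
  point_coords (points_map ualpha f) i = u (point_coords f i).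
Proof. exact: point_morph_natural. Qed.

Lemma point_coords_surj (A' : comPzRingType) (alpha : {rmorphism A -> A'}) (x : X -> A')
    (Gx : G alpha x) : (forall q, oset U (spec_fun (specialize Gx) q)) ->
  exists f : points M alpha, forall i, point_coords f i = x i.
Proof.
move=> xU; have [f fE] := @point_morph_surj _ _ iota U _ alpha (specialize Gx)
  (specialize_base Gx) xU.
by exists f => i; rewrite /point_coords fE /= specialize_gen.
Qed.

End OverClassifying.

(** ** Monogenerators *)

Local Notation X1 := (base_index F + nat * base_index F)%type.

Section MonoPoints.
Variables (A' : comPzRingType) (alpha : {rmorphism A -> A'}) (x : X1 -> A').
Local Notation F' := (base_frame F alpha).

Definition mono_elem : tensor phi alpha := combination (F := F') (x \o inl).

Definition mono_dual (i : nat) (y : tensor phi alpha) : A' :=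
  \sum_(j : base_index F) coordinate (F := F') j y * x (inr (i, j)).

(** The equations on coordinates that express [dual_powers].  The first two make
    the coordinates unique: on [base_elem], which are not independent, an element
    and a functional have other coefficients as well.  The expansion is imposed on
    the finitely many [base_elem] only, so that all conditions are visibly
    compatible with a change of rings. *)
Record mono_point : Prop := MonoPoint {
  mp_elem : forall j, x (inl j) = coordinate (F := F') j mono_elem;
  mp_dual : forall i j, x (inr (i, j)) = mono_dual i (base_elem (F := F') j);
  mp_expand : forall j, base_elem (F := F') j =
    \sum_(i < max_rank F)
      tensor_inr phi alpha (x (inr (nat_of_ord i, j))) * mono_elem ^+ i;
  mp_powers : forall (l : 'I_(fq F)) (i t : 'I_(fr l)),
    alpha (fh l) * mono_dual i (mono_elem ^+ t) = alpha (fh l) * (i == t)%:R;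
  mp_zero : forall (l : 'I_(fq F)) i j, (fr l <= i)%N ->
    alpha (fh l) * x (inr (i, j)) = 0
}.

Lemma mono_point_dual_powers : mono_point ->
  dual_powers F' mono_elem mono_dual.
Proof.
move=> Hx; split.
- move=> i y z; rewrite -big_split; apply: eq_bigr => j _.
  by rewrite coordinateD mulrDl.
- move=> i a y; rewrite big_distrr; apply: eq_bigr => j _ /=.
  by rewrite (coordinateZ (F := F')) mulrA.
- move=> y; rewrite -{1}(coordinateK F' y) /combination.
  under [RHS]eq_bigr => i _ do rewrite rmorph_sum big_distrl /=.
  rewrite exchange_big; apply: eq_bigr => j _.
  rewrite [in LHS](mp_expand Hx j) big_distrr; apply: eq_bigr => i _ /=.
  by rewrite tensor_inrM mulrA.
- exact: (mp_powers Hx).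
- move=> l i y li; rewrite big_distrr big1 // => j _ /=.
  by rewrite mulrCA (mp_zero Hx) // mulr0.
Qed.

End MonoPoints.

Lemma dual_powers_mono_point (A' : comPzRingType) (alpha : {rmorphism A -> A'})
    (theta : tensor phi alpha) D : dual_powers (base_frame F alpha) theta D ->
  exists x, mono_point alpha x /\ mono_elem alpha x = theta.
Proof.
move=> HD; pose F' := base_frame F alpha.
pose x (z : X1) := match z with
  | inl j => coordinate (F := F') j theta
  | inr (i, j) => D i (base_elem (F := F') j) end.
have xe : mono_elem alpha x = theta by exact: (coordinateK F').
have xD i (y : tensor phi alpha) : mono_dual x i y = D i y.
  have D0 : D i 0 = 0 by apply: (@addrI _ (D i 0)); rewrite -(dpD HD) !addr0.
  rewrite -[in RHS](coordinateK F' y) (big_morph _ (dpD HD i) D0).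
  by apply: eq_bigr => j _; rewrite (dpZ HD).
exists x; split=> //; split.
- by move=> j; rewrite xe.
- by move=> i j; rewrite xD.
- by move=> j; rewrite xe; exact: (dp_expand HD).
- by move=> l i t; rewrite xe xD; exact: (dp_dual HD).
- by move=> l i j li; exact: (dp_zero HD).
Qed.

Section MonoNatural.
Variables (A1 A2 : comPzRingType) (alpha1 : {rmorphism A -> A1}).
Variables (alpha2 : {rmorphism A -> A2}) (u : {rmorphism A1 -> A2}).
Variables (ualpha : forall a, u (alpha1 a) = alpha2 a) (x : X1 -> A1).
Local Notation um := (tensor_map (phi := phi) ualpha).

Lemma mono_elem_natural : um (mono_elem alpha1 x) = mono_elem alpha2 (u \o x).
Proof. exact: combination_natural. Qed.

Lemma mono_dual_natural i y :
  mono_dual (u \o x) i (um y) = u (mono_dual x i y).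
Proof.
rewrite /mono_dual rmorph_sum; apply: eq_bigr => j _.
by rewrite coordinate_natural rmorphM.
Qed.

Lemma base_elem_natural (j : base_index F) :
  um (base_elem (F := base_frame F alpha1) j) = base_elem (F := base_frame F alpha2) j.
Proof. exact: tensor_map_inl. Qed.

Lemma mono_expand_natural (j : base_index F) :
  um (\sum_(i < max_rank F) tensor_inr phi alpha1 (x (inr (nat_of_ord i, j))) *
        mono_elem alpha1 x ^+ i) =
  \sum_(i < max_rank F) tensor_inr phi alpha2 ((u \o x) (inr (nat_of_ord i, j))) *
        mono_elem alpha2 (u \o x) ^+ i.
Proof.
rewrite (rmorph_sum um); apply: eq_bigr => i _.
by rewrite (rmorphM um) (rmorphXn um) /= tensor_map_inr mono_elem_natural.
Qed.

Lemma mono_point_natural : mono_point alpha1 x -> mono_point alpha2 (u \o x).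
Proof.
move=> Hx; split.
- by move=> j; rewrite -mono_elem_natural coordinate_natural -(mp_elem Hx).
- by move=> i j; rewrite -base_elem_natural mono_dual_natural -(mp_dual Hx).
- by move=> j; rewrite -mono_expand_natural -(mp_expand Hx) base_elem_natural.
- move=> l i t; rewrite -mono_elem_natural -(rmorphXn um) mono_dual_natural.
  by rewrite -!ualpha -!rmorphM (mp_powers Hx) !rmorphM rmorph_nat.
- by move=> l i j li; rewrite -ualpha -rmorphM (mp_zero Hx) // rmorph0.
Qed.

End MonoNatural.

Definition mono_ring := classifying mono_point.
Local Notation iota1 := (classifying_base mono_point : {rmorphism A -> mono_ring}).

(** The conditions on a point are equations, so that they can be checked after
    every specialization. *)
Lemma mono_universal : mono_point iota1 (classifying_gen mono_point).
Proof.
pose x := classifying_gen mono_point.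
have spx (A' : comPzRingType) (alpha : {rmorphism A -> A'}) (y : X1 -> A')
  (Gy : mono_point alpha y) : specialize Gy \o x = y.
  by apply/funext => i; exact: specialize_gen.
have ring_eq (a b : mono_ring) : (forall (A' : comPzRingType)
    (alpha : {rmorphism A -> A'}) (u : {rmorphism mono_ring -> A'})
    (ualpha : forall a, u (iota1 a) = alpha a), mono_point alpha (u \o x) ->
    u a = u b) -> a = b.
  move=> H; apply: classifying_eq => A' alpha y Gy.
  by apply: (H _ alpha (specialize Gy) (specialize_base Gy)); rewrite spx.
split.
- move=> j; apply: ring_eq => A' alpha u ualpha Hu.
  by rewrite -(coordinate_natural ualpha) mono_elem_natural -(mp_elem Hu).
- move=> i j; apply: ring_eq => A' alpha u ualpha Hu.
  by rewrite -(mono_dual_natural ualpha) base_elem_natural -(mp_dual Hu).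
- move=> j; apply: (@coordinate_inj _ _ _ (base_frame F iota1)) => j'.
  apply: ring_eq => A' alpha u ualpha Hu.
  rewrite -!(coordinate_natural ualpha) mono_expand_natural base_elem_natural.
  by rewrite -(mp_expand Hu).
- move=> l i t; apply: ring_eq => A' alpha u ualpha Hu.
  rewrite !rmorphM ualpha -(mono_dual_natural ualpha) (rmorphXn (tensor_map ualpha)) /=.
  by rewrite mono_elem_natural (mp_powers Hu) rmorph_nat.
- move=> l i j li; apply: ring_eq => A' alpha u ualpha Hu.
  by rewrite rmorphM ualpha rmorph0; exact: (mp_zero Hu).
Qed.

Definition mono_scheme : scheme_over A := open_scheme iota1 (full_open (Spec mono_ring)).

Lemma mono_point_coords (A' : comPzRingType) (alpha : {rmorphism A -> A'})
    (f : points mono_scheme alpha) : mono_point alpha (point_coords f).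
Proof. exact: mono_point_natural (point_morph_base f) _ mono_universal. Qed.

Local Notation tinl := (tensor_inl phi (idfun : {rmorphism A -> A})).
Local Notation tinr := (tensor_inr phi (idfun : {rmorphism A -> A})).

Lemma is_monogenerator_base b :
  is_monogenerator tinr (tinl b) <-> is_monogenerator phi b.
Proof.
have E (c : seq A) : \sum_(i < size c) tinr c`_i * tinl b ^+ i =
    tinl (\sum_(i < size c) phi c`_i * b ^+ i).
  rewrite (rmorph_sum tinl); apply: eq_bigr => i _.
  by rewrite (rmorphM tinl) (rmorphXn tinl) /= tensor_base.
split=> [gen y|gen y].
  have [c] := gen (tinl y); rewrite E => e; exists c.
  exact: bij_inj (tensor_inl_bij phi) _ _ e.
have [z zK Kz] := tensor_inl_bij phi.
by have [c e] := gen (z y); exists c; rewrite E -e Kz.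
Qed.

Lemma mono_scheme_represents : represents_monogenerators phi mono_scheme.
Proof.
exists (fun A' alpha f => mono_elem alpha (point_coords f)).
have Phi_bij (A' : comPzRingType) (alpha : {rmorphism A -> A'}) :
    set_bij [set: points mono_scheme alpha]
    [set theta | is_monogenerator (tensor_inr phi alpha) theta]
    (fun f => mono_elem alpha (point_coords f)).
  split=> [f _|f f' _ _ e|theta /(monogenerator_dual_powers (base_frame F alpha))].
  - exact: dual_powers_monogenerator (mono_point_dual_powers (mono_point_coords f)).
  - have Hf := mono_point_coords f; have Hf' := mono_point_coords f'.
    apply: point_coords_inj => -[j|[i j]]; first by rewrite (mp_elem Hf) e -(mp_elem Hf').
    rewrite (mp_dual Hf) (mp_dual Hf'); apply: dual_powers_unique.
      exact: mono_point_dual_powers Hf.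
    by rewrite e; exact: mono_point_dual_powers Hf'.
  - move=> [D /dual_powers_mono_point[x [Hx <-]]].
    have [f fE] := @point_coords_surj _ _ (full_open _) _ _ _ Hx (fun _ => I).
    by exists f => //; congr mono_elem; exact/funext.
split; first exact: Phi_bij.
- move=> A1 A2 alpha1 alpha2 u ualpha f; rewrite mono_elem_natural; congr mono_elem.
  by apply/funext => i; exact: point_coords_natural.
- apply: set_bij_transport (Phi_bij _ _); first exact: tensor_inl_bij.
  exact: is_monogenerator_base.
Qed.

Lemma mono_scheme_affine : is_affine mono_scheme.
Proof. exact: open_scheme_affine. Qed.

(** ** Generating tuples *)

Section Tuples.
Variable k : nat.
Local Notation Xk := ('I_k * base_index F)%type.

Definition tuple_elems (A' : comPzRingType) (alpha : {rmorphism A -> A'}) (x : Xk -> A') :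
    k.-tuple (tensor phi alpha) :=
  [tuple combination (F := base_frame F alpha) (fun j => x (i, j)) | i < k].

Definition tuple_point (A' : comPzRingType) (alpha : {rmorphism A -> A'})
    (x : Xk -> A') :=
  forall i j, x (i, j) =
    coordinate (F := base_frame F alpha) j (tnth (tuple_elems alpha x) i).

Lemma tuple_point_exists (A' : comPzRingType) (alpha : {rmorphism A -> A'})
    (theta : k.-tuple (tensor phi alpha)) :
  exists x, tuple_point alpha x /\ tuple_elems alpha x = theta.
Proof.
pose x (z : Xk) := coordinate (F := base_frame F alpha) z.2 (tnth theta z.1).
have xE : tuple_elems alpha x = theta.
  by apply: eq_from_tnth => i; rewrite tnth_mktuple /x /= coordinateK.
by exists x; split=> // i j; rewrite xE.
Qed.

Section TupleNatural.
Variables (A1 A2 : comPzRingType) (alpha1 : {rmorphism A -> A1}).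
Variables (alpha2 : {rmorphism A -> A2}) (u : {rmorphism A1 -> A2}).
Variables (ualpha : forall a, u (alpha1 a) = alpha2 a) (x : Xk -> A1).

Lemma tuple_elems_natural :
  map_tuple (tensor_map (phi := phi) ualpha) (tuple_elems alpha1 x) =
  tuple_elems alpha2 (u \o x).
Proof.
apply: eq_from_tnth => i; rewrite tnth_map !tnth_mktuple.
exact: combination_natural.
Qed.

Lemma tuple_coordinate_natural i (j : base_index F) :
  coordinate (F := base_frame F alpha2) j (tnth (tuple_elems alpha2 (u \o x)) i) =
  u (coordinate (F := base_frame F alpha1) j (tnth (tuple_elems alpha1 x) i)).
Proof. by rewrite -tuple_elems_natural tnth_map coordinate_natural. Qed.

Lemma tuple_point_natural : tuple_point alpha1 x -> tuple_point alpha2 (u \o x).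
Proof. by move=> Hx i j; rewrite tuple_coordinate_natural -Hx. Qed.

End TupleNatural.

Definition tuple_ring := classifying tuple_point.
Local Notation iotak := (classifying_base tuple_point : {rmorphism A -> tuple_ring}).

Lemma tuple_universal : tuple_point iotak (classifying_gen tuple_point).
Proof.
move=> i j; apply: classifying_eq => A' alpha y Gy.
rewrite specialize_gen -[RHS]/((specialize Gy : {rmorphism _ -> _}) _).
rewrite -(tuple_coordinate_natural (specialize_base Gy)).
have -> : specialize Gy \o classifying_gen tuple_point = y.
  by apply/funext => z; exact: specialize_gen.
exact: Gy.
Qed.

Definition universal_minor (j : minor_index F k) : tuple_ring :=
  minor (F := base_frame F iotak) (tuple_elems iotak (classifying_gen tuple_point)) j.

Fact tuple_open_open :
  open [set p : Spec tuple_ring | exists j, ~ pset p (universal_minor j)].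
Proof.
apply: open_from_basic => p [j pj]; exists (universal_minor j); split=> //.
by move=> q qj; exists j.
Qed.

Definition tuple_open : opens (Spec tuple_ring) := Opens tuple_open_open.

(** Minors commute with change of rings, and [generating_minors] applies to the
    algebra over [A']. *)
Lemma tuple_open_generating (A' : comPzRingType) (alpha : {rmorphism A -> A'})
    (v : {rmorphism tuple_ring -> A'}) (va : forall a, v (iotak a) = alpha a) :
  (forall q, oset tuple_open (spec_fun v q)) <->
  is_generating (tensor_inr phi alpha)
    (tuple_elems alpha (v \o classifying_gen tuple_point)).
Proof.
have E j : minor (F := base_frame F alpha)
    (tuple_elems alpha (v \o classifying_gen tuple_point)) j = v (universal_minor j).
  by rewrite -(tuple_elems_natural va) minor_natural.
split=> [H|/(generating_minors (base_frame F alpha)) H q].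
  apply/(generating_minors (base_frame F alpha)) => q; have [j qj] := H q.
  by exists j; rewrite E.
by have [j qj] := H q; exists j; rewrite E in qj.
Qed.

Definition tuple_scheme : scheme_over A := open_scheme iotak tuple_open.

Lemma tuple_point_coords (A' : comPzRingType) (alpha : {rmorphism A -> A'})
    (f : points tuple_scheme alpha) : tuple_point alpha (point_coords f).
Proof. exact: tuple_point_natural (point_morph_base f) _ tuple_universal. Qed.

Lemma is_generating_base (b : k.-tuple B) :
  is_generating tinr (map_tuple tinl b) <-> is_generating phi b.
Proof.
have E (p : seq (A * {ffun 'I_k -> nat})) :
    \sum_(u <- p) tinr u.1 * \prod_(i < k) tnth (map_tuple tinl b) i ^+ u.2 i =
    tinl (\sum_(u <- p) phi u.1 * \prod_(i < k) tnth b i ^+ u.2 i).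
  rewrite (rmorph_sum tinl); apply: eq_bigr => u _.
  rewrite (rmorphM tinl) (rmorph_prod tinl) /= tensor_base; congr (_ * _).
  by apply: eq_bigr => i _; rewrite (rmorphXn tinl) tnth_map.
split=> [gen y|gen y].
  have [p] := gen (tinl y); rewrite E => e; exists p.
  exact: bij_inj (tensor_inl_bij phi) _ _ e.
have [z zK Kz] := tensor_inl_bij phi.
by have [p e] := gen (z y); exists p; rewrite E -e Kz.
Qed.

Lemma map_tuple_bij (T T' : Type) (g : T -> T') : bijective g ->
  bijective (map_tuple g : k.-tuple T -> k.-tuple T').
Proof.
move=> [h gK hK]; exists (map_tuple h) => t; apply: eq_from_tnth => i.
  by rewrite !tnth_map gK.
by rewrite !tnth_map hK.
Qed.

Lemma tuple_scheme_represents : represents_generating_tuples phi k tuple_scheme.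
Proof.
exists (fun A' alpha f => tuple_elems alpha (point_coords f)).
have Phi_bij (A' : comPzRingType) (alpha : {rmorphism A -> A'}) :
    set_bij [set: points tuple_scheme alpha]
    [set theta | is_generating (tensor_inr phi alpha) theta]
    (fun f => tuple_elems alpha (point_coords f)).
  split=> [f _|f f' _ _ e|theta].
  - apply/(tuple_open_generating (point_morph_base f)) => q; exact: point_morph_open.
  - apply: point_coords_inj => -[i j].
    by rewrite (tuple_point_coords f) e -(tuple_point_coords f').
  - have [x [Hx <-]] := tuple_point_exists theta => gen.
    have xE : specialize Hx \o classifying_gen tuple_point = x.
      by apply/funext => i; exact: specialize_gen.
    have xU : forall q, oset tuple_open (spec_fun (specialize Hx) q).
      by apply/(tuple_open_generating (specialize_base Hx)); rewrite /= xE.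
    have [f fE] := point_coords_surj xU.
    by exists f => //; congr tuple_elems; exact/funext.
split; first exact: Phi_bij.
- move=> A1 A2 alpha1 alpha2 u ualpha f; rewrite tuple_elems_natural; congr tuple_elems.
  by apply/funext => i; exact: point_coords_natural.
- apply: set_bij_transport (Phi_bij _ _); last exact: is_generating_base.
  exact: map_tuple_bij (tensor_inl_bij phi).
Qed.

Lemma tuple_scheme_quasiaffine : is_quasiaffine tuple_scheme.
Proof. exact: (@open_scheme_quasiaffine _ _ iotak tuple_open _ universal_minor). Qed.

Lemma tuple_scheme_finite_type : of_finite_type (structure_map tuple_scheme).
Proof.
split; first exact: (@open_scheme_quasicompact _ _ iotak tuple_open _ universal_minor).
by apply: open_scheme_locally_finite_type; exact: classifying_finite_type.
Qed.

End Tuples.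
End Moduli.

Local Close Scope ring_scope.
Local Close Scope quotient_scope.
Local Close Scope classical_set_scope.

Theorem theorem1p4 (A B : comPzRingType) (phi : {rmorphism A -> B})
    (phi_inj : injective phi)
    (noethA : noetherian A) (noethB : noetherian B)
    (flfB : finite_locally_free phi) :
  (exists M : scheme_over A,
     is_affine M /\ represents_monogenerators phi M) /\
  (forall k : nat, 1 <= k ->
     exists M : scheme_over A,
       [/\ is_quasiaffine M, of_finite_type (structure_map M) &
           represents_generating_tuples phi k M]).
Proof.
have [F] := locally_free_frame noethA noethB flfB.
split=> [|k _].
  exists (mono_scheme F); split; first exact: mono_scheme_affine.
  exact: mono_scheme_represents.
exists (tuple_scheme F k); split; first exact: tuple_scheme_quasiaffine.
  exact: tuple_scheme_finite_type.
exact: tuple_scheme_represents.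
Qed.
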